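(* Let $\theta$ be an arbitrary skew diagram and let $\mu,\nu$ be partitions with $\ell(\nu)\le n$. Consider all sequences of partitions $$R:\ \mu=\rho^{(0)}\stackrel{r_1}{\longrightarrow}\rho^{(1)}\stackrel{r_2}{\longrightarrow}\cdots\stackrel{r_l}{\longrightarrow}\rho^{(l)}=\nu .$$ Whenever there exist such a sequence $R$ and an index $k$ ($1\le k\le l-1$) such that $\rho^{(k+1)}/\rho^{(k-1)}$ consists of two boxes in the same column, set $(a_{\rho^{(k-1)}})_{r_k}=0$, that is, set the variable $a_{n+1-r_k+\rho^{(k-1)}_{r_k}}$ equal to $0$; the remaining variables $a_i$ stay indeterminate. For this sequence $a$, let $g_{\theta\mu}^{\nu}(a,0)$ be the coefficient of $G_\nu(x|a)$ in the expansion of $G_\theta(x)\,G_\mu(x|a)$ in the basis $\{G_\lambda(x|a):\ell(\lambda)\le n\}$, where $G_\theta(x)=G_\theta(x|0)$. Then $$g_{\theta\mu}^{\nu}(a,0)=\sum_{(R,T)}\beta^{|T|-|\theta|}\,w(T),$$ where the sum is over all pairs $(R,T)$ with $R$ a sequence of partitions $\mu=\rho^{(0)}\stackrel{r_1}{\longrightarrow}\rho^{(1)}\stackrel{r_2}{\longrightarrow}\cdots\stackrel{r_l}{\longrightarrow}\rho^{(l)}=\nu$ and $T$ a set-valued $\theta$-tableau (with barred entries) related to $R$.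
   Context: Fix a positive integer $n$, a field $\mathbb{F}$, an indeterminate $\beta$, variables $x=(x_1,\dots,x_n)$ and a sequence $a=(a_i)_{i\ge1}$. Put $x\oplus y=x+y+\beta xy$, $\ominus x=\frac{-x}{1+\beta x}$. Partitions are identified with Young diagrams (box $(i,j)$ in row $i$ from the top, column $j$), $\ell(\lambda)$ is the number of nonzero parts, and partitions with at most $n$ parts are padded with zeros to length $n$; a skew diagram is $\lambda/\mu$ with $\mu\subset\lambda$; $|\cdot|$ counts boxes; $c(i,j)=j-i$. A set-valued $\theta$-tableau $T$ assigns to each box $\alpha\in\theta$ a non-empty $T(\alpha)\subset\{1,\dots,n\}$ such that $\max T(\alpha)\le\min T(\alpha')$ if $\alpha$ is immediately left of $\alpha'$, and $\max T(\alpha)<\min T(\alpha')$ if $\alpha$ is immediately above $\alpha'$. An entry of $T$ is a pair $(r,\alpha)$ with $r\in T(\alpha)$; $|T|$ is the number of entries. The factorial Grothendieck polynomial is $G_\theta(x|a)=\sum_T\beta^{|T|-|\theta|}\prod_{\alpha\in\theta,\,r\in T(\alpha)}(x_r\oplus a_{r+c(\alpha)})$, and $G_\theta(x)=G_\theta(x|0)$ is obtained by replacing the second sequence by zeros. The $G_\lambda(x|a)$ with $\ell(\lambda)\le n$ form a basis of the symmetric polynomials in $x_1,\dots,x_n$ over the field of rational functions over $\mathbb{F}$ in $\beta$ and those $a_i$ not set to zero. For a partition $\lambda$ with at most $n$ parts, $(a_\lambda)_i=\ominus a_{n+1-i+\lambda_i}$, $1\le i\le n$. $\lambda\stackrel{r}{\longrightarrow}\mu$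 means $\mu$ is obtained from $\lambda$ by adding one box in row $r$. Order the entries of $T$ by $(r,(i,j))\prec(r',(i',j'))$ if $j>j'$, or $j=j'$ and $i<i'$, or $(i,j)=(i',j')$ and $r>r'$. $T$ is related to $R$ (with row labels $r_1,\dots,r_l$) if $T$ comes with distinguished (''barred'') entries $(r_1,\alpha_1)\prec\dots\prec(r_l,\alpha_l)$ whose values are $r_1,\dots,r_l$ in this order; all other entries are unbarred. (A tableau with a different choice of barred entries counts as a different $T$.) The weight (in the present case of zero second sequence) is $$w(T)=\prod_{(r,\alpha)\ \text{unbarred}}(a_{\rho(r)})_r\cdot\prod_{i=1}^{l}\bigl(1+\beta(a_{\rho^{(i-1)}})_{r_i}\bigr),$$ where for an unbarred entry $(r,\alpha)$, $\rho(r)=\rho^{(i)}$ if $(r_i,\alpha_i)\prec(r,\alpha)\prec(r_{i+1},\alpha_{i+1})$ (with $\rho(r)=\rho^{(0)}$ if it precedes all barred entries and $\rho(r)=\rho^{(l)}$ if it follows all of them). *)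

(* Defs.v *)
From HB Require Import structures.
From mathcomp Require Import all_boot all_order all_algebra.
From mathcomp Require Import finmap mpoly.

Set Implicit Arguments.
Unset Strict Implicit.
Unset Printing Implicit Defensive.

Import GRing.Theory.
Local Open Scope ring_scope.

(* Rows, columns and the values 1, ..., n are numbered from 0 throughout, so
   that r : 'I_n stands for the value r + 1; only the sequence a keeps its
   original indices 1, 2, 3, ... (a 0 is never used). *)

(* -------------------------------------------------------------------------- *)
(* Partitions and skew diagrams                                               *)

Definition is_partition (s : seq nat) : bool := sorted geq s && (0%N \notin s).

(* [size lam] is the number of nonzero parts and [nth 0 lam i] is the part in
   row i, padded with zeros. *)
Record intpart := IntPart { parts :> seq nat; _ : is_partition parts }.

HB.instance Definition _ := [isSub for parts].
HB.instance Definition _ := [Choice of intpart by <:].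

Definition included (tau sigma : seq nat) : Prop :=
  forall i, (nth 0 tau i <= nth 0 sigma i)%N.

Definition boxes (sigma tau : seq nat) : seq (nat * nat) :=
  [seq (i, j) | i <- iota 0 (size sigma),
                j <- iota (nth 0 tau i) (nth 0 sigma i - nth 0 tau i)]%N.

Definition diagram (sigma : seq nat) : seq (nat * nat) := boxes sigma [::].

(* -------------------------------------------------------------------------- *)
(* Set-valued tableaux                                                        *)

Definition left_of (p q : nat * nat) : bool := (p.1 == q.1) && (p.2.+1 == q.2).
Definition above (p q : nat * nat) : bool := (p.1.+1 == q.1) && (p.2 == q.2).

Section Tableaux.

Variables (n : nat) (theta : seq (nat * nat)).

Definition box : finType := seq_sub theta.
Definition entry : finType := ('I_n * box)%type.
Definition filling : finType := {ffun box -> {set 'I_n}}.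

Definition set_valued_tableau (T : filling) : bool :=
  [&& [forall p, T p != set0],
      [forall p, forall q, left_of (val p) (val q) ==>
         [forall r in T p, forall s in T q, (r <= s)%N]] &
      [forall p, forall q, above (val p) (val q) ==>
         [forall r in T p, forall s in T q, (r < s)%N]]].

Definition entries (T : filling) : {set entry} := [set e | e.1 \in T e.2].

(* |T| - |theta|; no truncation occurs on set-valued tableaux. *)
Definition excess (T : filling) : nat := (#|entries T| - #|box|)%N.

Definition prec (e f : entry) : bool :=
  let: (i, j) := val e.2 in let: (i', j') := val f.2 in
  [|| (j > j')%N, (j == j') && (i < i')%N |
      [&& i == i', j == j' & (e.1 > f.1)%N]].

End Tableaux.

(* -------------------------------------------------------------------------- *)
(* Factorial Grothendieck polynomials                                         *)

Definition oplus (A : comNzRingType) (b x y : A) : A := x + y + b * x * y.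
Definition ominus (K : fieldType) (b x : K) : K := - x / (1 + b * x).

Section Grothendieck.

Variables (K : fieldType) (n : nat) (beta : K).

(* The index of a is r + c(alpha) with r = e.1 + 1 and c(alpha) = j - i.  In a
   straight diagram the values increase strictly down columns, so that
   e.1 >= i and the index is at least 1; in a skew diagram the subtraction may
   truncate, which is harmless for a = 0, the only sequence used there. *)
Definition Groth (theta : seq (nat * nat)) (a : nat -> K) : {mpoly K[n]} :=
  \sum_(T : filling n theta | set_valued_tableau T)
    beta ^+ excess T *:
    \prod_(e in entries T)
      oplus beta%:MP 'X_(e.1) (a (e.1.+1 + (val e.2).2 - (val e.2).1)%N)%:MP.

(* c gives the (finitely supported) coefficients of an expansion of f in the
   G_lambda(x|a) with at most n parts. *)
Definition Groth_expansion (a : nat -> K) (f : {mpoly K[n]})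
    (c : {fsfun intpart -> K with 0}) : Prop :=
  (forall lam : intpart, lam \in finsupp c -> (size lam <= n)%N) /\
  f = \sum_(lam <- finsupp c) c lam *: Groth (diagram lam) a.

(* g is the coefficient of G_nu(x|a) in the expansion of f, as a definite
   description: an expansion exists and all of them have coefficient g at nu. *)
Definition is_Groth_coef (a : nat -> K) (f : {mpoly K[n]}) (nu : intpart)
    (g : K) : Prop :=
  (exists c, Groth_expansion a f c) /\
  (forall c, Groth_expansion a f c -> c nu = g).

(* (a_rho)_(i+1) *)
Definition a_part (a : nat -> K) (rho : seq nat) (i : 'I_n) : K :=
  ominus beta (a (n - i + nth 0%N rho i)%N).

End Grothendieck.

(* -------------------------------------------------------------------------- *)
(* Sequences of partitions                                                    *)

Section Chains.

Variables (n : nat) (mu nu : seq nat).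

(* The length l of any sequence from mu to nu. *)
Definition chain_length : nat := (sumn nu - sumn mu)%N.

(* A sequence R is given by its row labels.  They are all < n when nu has at
   most n parts. *)
Definition labels : finType := chain_length.-tuple 'I_n.

(* rho^(k) *)
Definition chain (R : labels) (k : nat) : seq nat :=
  foldl incr_nth mu (take k [seq val r | r <- R]).

Definition is_chain (R : labels) : bool :=
  [forall k : 'I_chain_length.+1, is_partition (chain R k)]
  && (chain R chain_length == nu).

(* rho^(k+2) / rho^(k) lies in a single column *)
Definition same_column (R : labels) (k : nat) : bool :=
  constant [seq p.2 | p <- boxes (chain R k.+2) (chain R k)].

(* The indices i for which a_i is set to 0.  Here k : 'I_l is one less than
   the index k of the vertical step, which thus satisfies k.+1 < l. *)
Definition zeroed (i : nat) : bool :=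
  [exists R : labels, is_chain R &&
    [exists k : 'I_chain_length,
      [&& (k.+1 < chain_length)%N, same_column R k &
          i == (n - tnth R k + nth 0 (chain R k) (tnth R k))%N]]].

End Chains.

(* -------------------------------------------------------------------------- *)
(* The sum over pairs (R, T)                                                  *)

Section Weights.

Variables (K : fieldType) (n : nat) (beta : K) (a : nat -> K).
Variables (theta : seq (nat * nat)) (mu nu : seq nat).

Local Notation l := (chain_length mu nu).

(* bs lists the barred entries (r_1, alpha_1) < ... < (r_l, alpha_l) of T. *)
Definition related (R : labels n mu nu) (T : filling n theta)
    (bs : l.-tuple (entry n theta)) : bool :=
  [&& all (mem (entries T)) bs, sorted (@prec n theta) bs &
      [seq b.1 | b <- bs] == R :> seq 'I_n].

(* An unbarred entry e lies between the i-th and the (i+1)-st barred entries,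
   where i is the number of barred entries preceding it. *)
Definition weight (R : labels n mu nu) (T : filling n theta)
    (bs : l.-tuple (entry n theta)) : K :=
  (\prod_(e in entries T | e \notin bs)
     a_part beta a (chain R (count (fun b => prec b e) bs)) e.1)
  * \prod_(i < l) (1 + beta * a_part beta a (chain R i) (tnth R i)).

Definition barred_tableau_sum : K :=
  \sum_(R : labels n mu nu | is_chain R)
    \sum_(T : filling n theta | set_valued_tableau T)
      \sum_(bs : l.-tuple (entry n theta) | related R T bs)
        beta ^+ excess T * weight R T bs.

End Weights.

(* -------------------------------------------------------------------------- *)
(* Fields of rational functions                                               *)

(* K is, via iota, the field of rational functions over F in the family
   (t i) indexed by the i in D: the family is algebraically independent over F
   and generates K as a field. *)
Definition rational_function_field (F K : fieldType) (iota : {rmorphism F -> K})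
    (I : eqType) (D : pred I) (t : I -> K) : Prop :=
  (forall (m : nat) (u : 'I_m -> I) (p : {mpoly F[m]}),
     injective u -> (forall j, D (u j)) -> mmap iota (t \o u) p = 0 -> p = 0) /\
  (forall z : K, exists m (u : 'I_m -> I) (p q : {mpoly F[m]}),
     [/\ forall j, D (u j), mmap iota (t \o u) q != 0 &
         z = mmap iota (t \o u) p / mmap iota (t \o u) q]).

(* The family beta (at None) and a_i (at Some i), and the members of it that
   stay indeterminate. *)
Definition variable (K : fieldType) (beta : K) (a : nat -> K) (o : option nat) :
  K := oapp a beta o.

Definition indeterminate (n : nat) (mu nu : seq nat) (o : option nat) : bool :=
  if o is Some i then (0 < i)%N && ~~ zeroed n mu nu i else true.

(* Main.v *)
(* Read the columns of a tableau from right to left, each as a word in the letters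
   1, ..., n.  Comparing words that differ in two adjacent letters only shows that
   G_theta(x|a) is symmetric, and it lets one strip a straight diagram box by box
   from G_lam(x|a) F_0, where
     F_rho = prod_r (x_r|a)^(rho_r + n - r) (1 + beta x_r)^(r - 1),
   which yields the bialternant formula G_lam(x|a) alt(F_0) = alt(F_lam), alt being
   the antisymmetrizer.  Hence the coefficient sought is phi (G_theta(x) F_mu) for
   a linear functional phi that factors through alt and maps F_lam to 1 if lam = nu
   and to 0 otherwise.  Now
     x_r F_rho = (a_rho)_r F_rho + (1 + beta (a_rho)_r) F_(rho + e_r),
   so multiplying F_mu by a monomial of G_theta(x) one letter at a time, in the
   order of the entries, produces the sum over the pairs (R, T), together with
   stray terms where some rho + e_(k+1) is not a partition, that is, where
   rho_k = rho_(k+1).  The stray terms of words differing in the letters k and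
   k + 1 cancel, because alt kills what is symmetric in x_k and x_(k+1), with the
   exception of words in which a k precedes the stray k + 1.  These vanish one by
   one: barring k makes room for k + 1, while an unbarred k contributes
   (a_rho)_k, which is 0 unless rho + e_k + e_(k+1) leaves nu, in which case phi
   vanishes. *)
Require Import Defs.
From HB Require Import structures.
From mathcomp Require Import all_boot all_order all_algebra all_fingroup.
From mathcomp Require Import finmap ssrcomplements mpoly.
From mathcomp Require Import ring zify.

Set Implicit Arguments.
Unset Strict Implicit.
Unset Printing Implicit Defensive.

Import GRing.Theory.
Local Open Scope ring_scope.

(** * Column words *)

(** Symmetry alone does not pass from one column to the next: the letter that opens a box changes
    the constraint on the column to its left. Let x, y be the variables of k, k + 1, let a, b be the
    parameters of these letters in a box of the right-hand column, and let early and late be the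
    sums over the remaining columns when k, respectively k + 1, opens that box. Since 1 + beta (y ⊕
    b) = (1 + beta y)(1 + beta b) and y ⊕ b = y (1 + beta b) + b, the parameter b separates, and
    what has to be symmetric is (1 + beta y)(x ⊕ a) early + y late. This is the induction invariant.
    It also closes the box-stripping argument, and at zero parameters it is the condition under
    which paired stray terms cancel. The functional phi must do more than separate the alternants:
    stray shapes are not partitions and carry arbitrary polynomial multipliers, and those leaving nu
    must vanish without any symmetry, as the hypothesis on a need not set a parameter to 0 for them.
    Hence phi is assembled from Newton coefficients at shapes inside nu only, which vanish by a
    pigeonhole argument once the first rows are too long. *)

Section Words.

Variable n : nat.

(* The letter [r] is absent from the column ([None]), is the least entry of a
   box ([Some true]), or is a further entry of the last box opened by a smaller
   letter ([Some false]). *)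
Definition cword : finType := {ffun 'I_n -> option bool}.

(* The row in which the first box opened by a letter [>= r] is placed, when the
   column starts in row [t]. *)
Definition height (t : nat) (c : cword) (r : nat) : nat :=
  (t + \sum_(i < n | (i < r)%N) (c i == Some true))%N.

Lemma height0 t c : height t c 0 = t.
Proof. by rewrite /height big_pred0 ?addn0. Qed.

Lemma heightS t c (r : 'I_n) :
  height t c r.+1 = (height t c r + (c r == Some true))%N.
Proof.
rewrite /height (bigD1 r) //= -addnA; congr (_ + _)%N; rewrite addnC.
congr (_ + _)%N; apply: eq_bigl => i; rewrite ltnS -val_eqE /=.
by rewrite [RHS]ltn_neqAle andbC.
Qed.

Lemma height_over t c r : (n <= r)%N -> height t c r.+1 = height t c r.
Proof.
move=> le_nr; congr (_ + _)%N; apply: eq_bigl => i.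
by rewrite !(leq_trans (ltn_ord i)) // (leq_trans le_nr).
Qed.

Lemma leq_height t c r s : (r <= s)%N -> (height t c r <= height t c s)%N.
Proof.
move=> le_rs; rewrite leq_add2l big_mkcond [leqRHS]big_mkcond /=.
apply: leq_sum => i _; case: ifP => // lt_ir.
by rewrite (leq_trans lt_ir le_rs).
Qed.

Definition upd (k k1 : 'I_n) (c : cword) (p q : option bool) : cword :=
  [ffun i => if i == k then p else if i == k1 then q else c i].

(** Words are grouped by what is left when the letters [k] and [k1] are erased; the symmetry and
    cancellation arguments compare only the nine words of one group. *)
Lemma sum_window (R : nmodType) (k k1 : 'I_n) (F : cword -> R) :
  k != k1 ->
  \sum_c F c = \sum_(c : cword | (c k == None) && (c k1 == None))
     \sum_p \sum_q F (upd k k1 c p q).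
Proof.
move=> ne_k.
rewrite (partition_big (fun c => upd k k1 c None None)
   (fun c : cword => (c k == None) && (c k1 == None))) /=; last first.
  by move=> c _; rewrite !ffunE !eqxx (eq_sym k1) (negPf ne_k).
apply: eq_bigr => c /andP[/eqP ck /eqP ck1].
rewrite pair_big /=.
rewrite (reindex_onto (fun pq : option bool * option bool => upd k k1 c pq.1 pq.2)
  (fun c' : cword => (c' k, c' k1))) /=; last first.
  move=> c' /eqP/ffunP c'E; apply/ffunP => i; have := c'E i; rewrite !ffunE.
  by case: (eqVneq i k) => [->|_] //; case: (eqVneq i k1) => [->|].
apply: eq_bigl => -[p q] /=; rewrite !ffunE !eqxx (eq_sym k1) (negPf ne_k) eqxx andbT.
apply/eqP/ffunP => i; rewrite !ffunE; case: (eqVneq i k) => [->|_] //.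
by case: (eqVneq i k1) => [->|_].
Qed.

Lemma height_upd t (k k1 : 'I_n) (c : cword) p q r : k != k1 -> c k = None -> c k1 = None ->
  height t (upd k k1 c p q) r =
  (height t c r + ((k < r) && (p == Some true)) + ((k1 < r) && (q == Some true)))%N.
Proof.
move=> ne_k ck ck1; have sum1 (l : 'I_n) (b : bool) :
    (\sum_(i < n | (i < r)%N) ((i == l) && b))%N = ((l < r) && b)%N :> nat.
  rewrite big_mkcond (bigD1 l) //= eqxx big1 ?addn0 /=; first by case: ifP.
  by move=> i /negPf->; case: ifP.
rewrite /height -!addnA; congr (_ + _)%N; rewrite -!sum1 -!big_split /=.
apply: eq_bigr => i _; rewrite !ffunE; case: (eqVneq i k) => [->|_] /=.
  by rewrite ck (negPf ne_k) /= addn0.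
by case: (eqVneq i k1) => [->|_] /=; rewrite ?ck1 ?addn0.
Qed.

End Words.

(** * Symmetry in adjacent variables *)

Section Symmetry.

Variables (K : fieldType) (n : nat) (beta : K) (B : int -> K).
Variables (tops bots : nat -> nat).

Local Notation P := {mpoly K[n]}.
Local Notation bt := (beta%:MP : P).
Local Notation New := (Some true).
Local Notation Ext := (Some false).

Definition wt (r : 'I_n) (z : int) : P := oplus bt 'X_r (B (r.+1%:Z + z))%:MP.

(** [z] is the content of the next box to be opened. The box of a further entry is already counted
    in the height, so its content is one more; [beta] accounts for the extra entry. *)
Definition lweight (r : 'I_n) (z : int) (l : option bool) : P :=
  match l with
  | None => 1
  | Some true => wt r z
  | Some false => bt * wt r (z + 1)
  end.

(* [h] and [g] are the heights at a letter in a column and in the column to its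
   right: rows weakly increase iff [g <= h] throughout, except that a further
   entry of a box must not exceed the box on the right, whence [g < h]. *)
Definition lvalid (top g h : nat) (l : option bool) : bool :=
  (g <= h)%N && ((l == Ext) ==> (top < h)%N && (g < h)%N).

(** [lvalid] compares the heights before each letter; the comparison after the last letter is
    separate because [r] stops at [n - 1]. *)
Definition valid (top bot : nat) (g : nat -> nat) (c : cword n) : bool :=
  [&& g n <= height top c n, height top c n == bot &
      [forall r : 'I_n, lvalid top (g r) (height top c r) (c r)]]%N.

Definition cweight (j : nat) (c : cword n) : P :=
  \prod_(r < n) lweight r (j%:Z - (height (tops j) c r)%:Z) (c r).

(** Columns are filled from right to left, and the column already placed is remembered only through
    its heights [g], which are all that the row condition sees. *)
Fixpoint colsum (J : nat) (g : nat -> nat) : P :=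
  if J is j.+1 then
    \sum_(c | valid (tops j) (bots j) g c)
      cweight j c * colsum j (height (tops j) c)
  else 1.

Lemma eq_colsum J g g' : g =1 g' -> colsum J g = colsum J g'.
Proof.
case: J => [//|j] eq_g /=; apply: eq_bigl => c; rewrite /valid eq_g.
by congr [&& _, _ & _]; apply: eq_forallb => r; rewrite eq_g.
Qed.

Section Window.

Variables (k k1 : 'I_n).
Hypothesis k1E : k1 = k.+1 :> nat.

Let ne_k : k != k1. Proof. by rewrite -val_eqE /= k1E neq_ltn ltnSn. Qed.
Let s := tperm k k1.

Definition swsym (p : P) := msym (tperm k k1) p = p.

Lemma swsymD p q : swsym p -> swsym q -> swsym (p + q).
Proof. by rewrite /swsym rmorphD => /= -> ->. Qed.
Lemma swsymM p q : swsym p -> swsym q -> swsym (p * q).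
Proof. by rewrite /swsym rmorphM => /= -> ->. Qed.
Lemma swsym0 : swsym 0.
Proof. by rewrite /swsym rmorph0. Qed.
Lemma swsym1 : swsym 1.
Proof. by rewrite /swsym rmorph1. Qed.
Lemma swsym_sum I (r : seq I) (Q : pred I) (F : I -> P) :
  (forall i, Q i -> swsym (F i)) -> swsym (\sum_(i <- r | Q i) F i).
Proof. by move=> symF; elim/big_ind: _ => //; [exact: swsym0|exact: swsymD]. Qed.
Lemma swsym_prod I (r : seq I) (Q : pred I) (F : I -> P) :
  (forall i, Q i -> swsym (F i)) -> swsym (\prod_(i <- r | Q i) F i).
Proof. by move=> symF; elim/big_ind: _ => //; [exact: swsym1|exact: swsymM]. Qed.
Lemma msymC (t : 'S_n) (a : K) : msym t (a%:MP : P) = a%:MP.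
Proof. by rewrite -[a%:MP]mulr1 mul_mpolyC linearZ /= rmorph1. Qed.
Lemma msymXU (t : 'S_n) (i : 'I_n) : msym t ('X_i : P) = 'X_(t i).
Proof. by rewrite /msym mmapX mmap1U. Qed.

Lemma swsymC a : swsym (a%:MP). Proof. exact: msymC. Qed.
Lemma msymx : msym s ('X_k : P) = 'X_k1. Proof. by rewrite msymXU tpermL. Qed.
Lemma msymy : msym s ('X_k1 : P) = 'X_k. Proof. by rewrite msymXU tpermR. Qed.
Lemma swsymX i : i != k -> i != k1 -> swsym 'X_i.
Proof. by move=> ? ?; rewrite /swsym msymXU tpermD // eq_sym. Qed.
Lemma swsym_lweight i z l : i != k -> i != k1 -> swsym (lweight i z l).
Proof.
move=> ik ik1; have wtS z' : swsym (wt i z').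
  apply: swsymD; last by do 2?apply: swsymM; try exact: swsymC; exact: swsymX.
  by apply: swsymD; [exact: swsymX | exact: swsymC].
case: l => [[]|]; [exact: wtS| |exact: swsym1].
by apply: swsymM; [exact: swsymC | exact: wtS].
Qed.


(** [d] counts the boxes opened inside the window; outside it, only the letters beyond [k1] notice
    them. *)
Definition wheight (j : nat) (c : cword n) (d r : nat) : nat :=
  (height (tops j) c r + (k1 < r) * d)%N.

Definition wvalid (j : nat) (g : nat -> nat) (c : cword n) (d : nat) : bool :=
  [&& g n <= wheight j c d n, wheight j c d n == bots j &
      [forall r, (r != k) && (r != k1) ==>
         lvalid (tops j) (g r) (wheight j c d r) (c r)]]%N.

Definition wrest (j : nat) (g : nat -> nat) (c : cword n) (d : nat) : P :=
  if wvalid j g c d then \prod_(r | (r != k) && (r != k1))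
         lweight r (j%:Z - (wheight j c d r)%:Z) (c r)
  else 0.

Definition wloc (j g0 g1 h : nat) (p q : option bool) : P :=
  if lvalid (tops j) g0 h p && lvalid (tops j) g1 (h + (p == New)) q then
    lweight k (j%:Z - h%:Z) p * lweight k1 (j%:Z - (h + (p == New))%:Z) q
  else 0.

Definition wleft (j : nat) (c : cword n) (d0 d1 : bool) : P :=
  colsum j (fun r => height (tops j) c r + ((k < r) && d0)
                       + ((k1 < r) && d1))%N.

Lemma height_upd_rest j (c : cword n) p q r :
  c k = None -> c k1 = None -> r != k -> r != k1 ->
  height (tops j) (upd k k1 c p q) r = wheight j c ((p == New) + (q == New)) r.
Proof.
move=> ck ck1 rk rk1; rewrite height_upd // /wheight -addnA; congr (_ + _)%N.
by move: rk rk1; rewrite -!val_eqE /= k1E; case: (p == New); case: (q == New); lia.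
Qed.

Lemma height_upd_k j (c : cword n) p q : c k = None -> c k1 = None ->
  height (tops j) (upd k k1 c p q) k = height (tops j) c k.
Proof. by move=> ck ck1; rewrite height_upd // ltnn k1E ltnNge leqnSn !addn0. Qed.

Lemma height_upd_k1 j (c : cword n) p q : c k = None -> c k1 = None ->
  height (tops j) (upd k k1 c p q) k1 = (height (tops j) c k + (p == New))%N.
Proof.
move=> ck ck1; have ltk : (k < k1)%N by rewrite k1E.
by rewrite height_upd // ltnn ltk addn0 /=; congr (_ + _)%N; rewrite k1E heightS ck addn0.
Qed.

Lemma valid_updE j g (c : cword n) p q : c k = None -> c k1 = None ->
  valid (tops j) (bots j) g (upd k k1 c p q) =
  wvalid j g c ((p == New) + (q == New)) &&
  (lvalid (tops j) (g k) (height (tops j) c k) p &&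
   lvalid (tops j) (g k1) (height (tops j) c k + (p == New)) q).
Proof.
move=> ck ck1; set u := upd k k1 c p q; set d := (_ + _)%N; set h := height _ c k.
have hE r : r != k -> r != k1 -> height (tops j) u r = wheight j c d r.
  exact: height_upd_rest.
have hEn : height (tops j) u n = wheight j c d n.
  by rewrite height_upd // /wheight !ltn_ord mul1n -addnA.
have hk : height (tops j) u k = h by exact: height_upd_k.
have hk1 : height (tops j) u k1 = (h + (p == New))%N by exact: height_upd_k1.
have uk : u k = p by rewrite ffunE eqxx.
have uk1 : u k1 = q by rewrite ffunE eqxx (eq_sym k1) (negPf ne_k).
have ur r : r != k -> r != k1 -> u r = c r.
  by move=> rk rk1; rewrite ffunE (negPf rk) (negPf rk1).
rewrite /valid /wvalid -hEn -2!andbA; congr [&& _, _ & _]; apply/forallP/and3P.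
  move=> vu; split; last 2 first.
  - by have := vu k; rewrite hk uk.
  - by have := vu k1; rewrite hk1 uk1.
  apply/forallP=> r; apply/implyP=> /andP[rk rk1].
  by rewrite -hE // -(ur r).
case=> /forallP vu vk vk1 r; have [->|rk] := eqVneq r k; first by rewrite hk uk.
have [->|rk1] := eqVneq r k1; first by rewrite hk1 uk1.
by have := vu r; rewrite rk rk1 -hE // -(ur r).
Qed.

Lemma colsum_upd j (c : cword n) p q :
  c k = None -> c k1 = None ->
  colsum j (height (tops j) (upd k k1 c p q)) = wleft j c (p == New) (q == New).
Proof. by move=> ck ck1; apply: eq_colsum => r; rewrite height_upd. Qed.

Lemma valid_upd j g (c : cword n) p q : c k = None -> c k1 = None ->
  (if valid (tops j) (bots j) g (upd k k1 c p q) then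
     cweight j (upd k k1 c p q) * colsum j (height (tops j) (upd k k1 c p q))
   else 0) =
  wrest j g c ((p == New) + (q == New))
    * wloc j (g k) (g k1) (height (tops j) c k) p q
    * wleft j c (p == New) (q == New).
Proof.
move=> ck ck1; rewrite valid_updE // colsum_upd // /wrest /wloc.
case: ifP => [/andP[-> ->]|/negbT]; last first.
  by rewrite negb_and => /orP[/negPf->|/negPf->]; rewrite ?mulr0 ?mul0r.
congr (_ * _); rewrite /cweight (bigD1 k) //= (bigD1 k1) ?(eq_sym k1) //=.
rewrite height_upd_k // height_upd_k1 // !ffunE !eqxx (eq_sym k1) (negPf ne_k).
rewrite mulrA mulrC; congr (_ * _).
apply: eq_bigr => r /andP[rk rk1].
by rewrite height_upd_rest // ffunE (negPf rk) (negPf rk1).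
Qed.

Lemma colsum_window j g :
  colsum j.+1 g = \sum_(c : cword n | (c k == None) && (c k1 == None))
    \sum_p \sum_q wrest j g c ((p == New) + (q == New))
      * wloc j (g k) (g k1) (height (tops j) c k) p q
      * wleft j c (p == New) (q == New).
Proof.
rewrite /= big_mkcond (sum_window _ ne_k); apply: eq_bigr => c.
case/andP=> /eqP ck /eqP ck1; apply: eq_bigr => p _; apply: eq_bigr => q _.
exact: valid_upd.
Qed.

Lemma swsym_wrest j g (c : cword n) d : swsym (wrest j g c d).
Proof.
rewrite /wrest; case: ifP => _; last exact: swsym0.
by apply: swsym_prod => r /andP[rk rk1]; exact: swsym_lweight.
Qed.

(** Opening only [d] boxes in the window leaves the column behind its right neighbour just after
    [k1], whatever the other letters do. *)
Lemma wrest_eq0 j g (c : cword n) d : c k = None -> c k1 = None ->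
  (height (tops j) c k + d < g k1.+1)%N -> wrest j g c d = 0.
Proof.
move=> ck ck1 lt_g; rewrite /wrest /wvalid; case: ifP => // /and3P[gn _ /forallP lv].
have hk1 : height (tops j) c k1.+1 = height (tops j) c k.
  by rewrite heightS ck1 k1E heightS ck !addn0.
have wh : wheight j c d k1.+1 = (height (tops j) c k + d)%N.
  by rewrite /wheight hk1 ltnSn mul1n.
(* The comparison just after [k1] is made at the next letter or, if [k1] is the last one, at the end
   of the column. *)
have [lt1|ge1] := ltnP k1.+1 n.
  have /implyP := lv (Ordinal lt1); rewrite /lvalid /= wh leqNgt lt_g /= => lvk; suff: false by [].
  by apply: lvk; rewrite -!val_eqE /=; lia.
have k1n : n = k1.+1 by apply/eqP; rewrite eqn_leq ge1 ltn_ord.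
have : (g k1.+1 <= wheight j c d k1.+1)%N by rewrite -k1n.
by rewrite wh leqNgt lt_g.
Qed.

Lemma sum_option_bool (V : nmodType) (F : option bool -> V) :
  \sum_p F p = F None + F New + F Ext.
Proof.
rewrite (bigD1 None) //= (bigD1 New) //= (bigD1 Ext) //= big_pred0 ?addr0 ?addrA //.
by case=> [[]|].
Qed.

Lemma window_sum (R : nat -> P) (F : option bool -> option bool -> P)
    (lf : bool -> bool -> P) :
  \sum_p \sum_q R ((p == New) + (q == New))%N * F p q * lf (p == New) (q == New) =
  R 0%N * (F None None + F None Ext + F Ext None + F Ext Ext) * lf false false
  + R 1%N * ((F New None + F New Ext) * lf true false
           + (F None New + F Ext New) * lf false true)
  + R 2%N * F New New * lf true true.
Proof. by rewrite !sum_option_bool /=; ring. Qed.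

Local Notation x := ('X_k : P).
Local Notation y := ('X_k1 : P).
Local Notation D z := ((B (k.+1%:Z + z))%:MP : P).

Lemma wt_k z : wt k z = oplus bt x (D z). Proof. by []. Qed.
Lemma wt_k1 z : wt k1 z = oplus bt y (D (z + 1)).
Proof. by rewrite /wt k1E; congr (oplus _ _ (B _)%:MP); lia. Qed.

Section Row.

Variables (u v : P) (z : int).
Hypothesis v_sym : swsym v.
Hypothesis uv_sym : swsym ((1 + bt * y) * oplus bt x (D z) * u + y * v).

Local Notation a := (oplus bt x (D z) * u
  + oplus bt x (D z) * (bt * oplus bt y (D (z + 1))) * u
  + oplus bt y (D (z + 1)) * v).

(** The three summands are the fillings of a window that open one box: by [k], by [k] with [k1] as
    further entry, or by [k1]. Separating the parameter of [k1] leaves the hypothesis [uv_sym] and a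
    multiple of [v]. *)
Lemma swsym_row_a : swsym a.
Proof.
have -> : a = (1 + bt * D (z + 1)) * ((1 + bt * y) * oplus bt x (D z) * u + y * v)
   + D (z + 1) * v by rewrite /oplus; ring.
apply: swsymD; last by apply: swsymM => //; exact: swsymC.
apply: swsymM => //; rewrite /swsym !(rmorphD, rmorphM, rmorph1) /=.
by rewrite !msymC.
Qed.

(** The additional filling has [k] extending the previous box and [k1] opening the next one; the two
    letters then carry the same parameter, so their weights form a symmetric product. *)
Lemma swsym_row_b :
  swsym (a + bt * oplus bt x (D (z + 1)) * oplus bt y (D (z + 1)) * v).
Proof.
apply: swsymD; first exact: swsym_row_a.
apply: swsymM => //; rewrite /swsym /oplus !(rmorphD, rmorphM, rmorph1) /=.
by rewrite !msymC msymx msymy; ring.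
Qed.

(** This is [uv_sym] one column further right, when that column is level with the present one: an
    early opening there forces the present box to be opened by [k] and not extended by [k1], whereas
    a late opening leaves the three fillings of [a]. *)
Lemma swsym_row_c : swsym ((1 + bt * y) * oplus bt x (D (z + 1))
  * (oplus bt x (D z) * u) + y * a).
Proof.
set w := (1 + bt * y) * oplus bt x (D z) * u + y * v.
have -> : (1 + bt * y) * oplus bt x (D (z + 1)) * (oplus bt x (D z) * u) + y * a
  = w * (x * (1 + bt * D (z + 1)) + D (z + 1) + y * (1 + bt * D (z + 1)))
    - x * y * (1 + bt * D (z + 1)) * v by rewrite /w /oplus; ring.
have : swsym w by []; move: w => w wS.
rewrite /swsym !(rmorphD, rmorphN, rmorphM, rmorph1) /= !msymC msymx msymy wS v_sym.
by ring.
Qed.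

End Row.


Lemma early_late_regroup (c R0 R1 R2 a0 a2 b0 b2 m1 m2 f t : P) :
  c * (R0 * a0 * f + R1 * m1 + R2 * a2 * t) + y * (R0 * b0 * f + R1 * m2 + R2 * b2 * t)
  = R0 * (c * a0 + y * b0) * f + R1 * (c * m1 + y * m2) + R2 * (c * a2 + y * b2) * t.
Proof. by ring. Qed.

Ltac sym_ring := rewrite /swsym /oplus ?(rmorphD, rmorphM, rmorph1, rmorph0) /=
  ?msymC ?msymx ?msymy; ring.

Section Step.

Variables (j h : nat) (R : nat -> P) (lf : bool -> bool -> P).
Hypothesis le_top : (tops j <= h)%N.
Hypothesis R_sym : forall d, swsym (R d).
Hypothesis flat_sym : swsym (lf false false).
Hypothesis two_sym : swsym (lf true true).
Hypothesis late_sym : swsym (lf false true).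
Hypothesis early_sym :
  swsym ((1 + bt * y) * oplus bt x (D (j%:Z - h%:Z)) * lf true false + y * lf false true).

Let window g0 g1 := \sum_p \sum_q R ((p == New) + (q == New))%N
  * wloc j g0 g1 h p q * lf (p == New) (q == New).

Ltac decide_leq := repeat match goal with
  | |- context [(?m <= ?p)%N] =>
    first [ have ->: (m <= p)%N = true by lia | have ->: (m <= p)%N = false by lia ]
  end.

Let jhS : j%:Z - h.+1%:Z + 1 = j%:Z - h%:Z. Proof. by lia. Qed.

Ltac norm_wt := rewrite ?(wt_k1 (j%:Z - h.+1%:Z)) ?jhS ?wt_k1 ?wt_k.

(** [R] depends only on the number of boxes opened in the window, so the fillings are sorted by it
    and each of the three groups is symmetric by itself. One opened box is the case of [swsym_row_a]
    or, if the previous box can be extended, [swsym_row_b]. *)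
Lemma window_flat g0 : swsym (window g0 g0).
Proof.
rewrite /window window_sum /wloc /lvalid /= !addn0 !addn1.
have [le_gh|lt_hg] := leqP g0 h; last first.
  decide_leq; rewrite /= !(addr0, mulr0, mul0r).
  exact: swsym0.
have [/andP[lt_th lt_gh]|no_ext] := boolP ((tops j < h) && (g0 < h))%N.
  decide_leq => /=; norm_wt.
  apply: swsymD; first apply: swsymD.
  - by apply: swsymM => //; apply: swsymM => //; sym_ring.
  - apply: swsymM => //; have := swsym_row_b late_sym early_sym.
    by congr swsym; rewrite /oplus; ring.
  - by apply: swsymM => //; apply: swsymM => //; sym_ring.
decide_leq => /=; norm_wt.
apply: swsymD; first apply: swsymD.
- by apply: swsymM => //; apply: swsymM => //; sym_ring.
- apply: swsymM => //; have := swsym_row_a late_sym early_sym.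
  by congr swsym; rewrite /oplus; ring.
- by apply: swsymM => //; apply: swsymM => //; sym_ring.
Qed.

(** Once the fillings that open too few boxes have been discarded through [R], the right column
    restricts nothing inside the window, and the groups are those of [window_flat]. *)
Lemma window_two g0 :
  (forall d, (h + d < g0.+2)%N -> R d = 0) -> swsym (window g0 g0.+1).
Proof.
move=> R0; rewrite /window window_sum /wloc /lvalid /= !addn0 !addn1.
have [le_gh|lt_hg] := leqP g0 h; last first.
  by decide_leq; rewrite /= !(addr0, mulr0, mul0r); exact: swsym0.
apply: swsymD; first apply: swsymD.
- have [lt_h|ge_h] := ltnP (h + 0) g0.+2.
    by rewrite (R0 _ lt_h) !mul0r; exact: swsym0.
  apply: swsymM => //; apply: swsymM => //.
  decide_leq => /=; have [lt_th|ge_th] := ltnP (tops j) h => /=; norm_wt; by sym_ring.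
- have [lt_h|ge_h] := ltnP (h + 1) g0.+2.
    by rewrite (R0 _ lt_h) !mul0r; exact: swsym0.
  apply: swsymM => //; decide_leq => /=; have [lt_th|ge_th] := ltnP (tops j) h => /=.
    norm_wt; have := swsym_row_b late_sym early_sym.
    by congr swsym; rewrite /oplus; ring.
  norm_wt; have := swsym_row_a late_sym early_sym.
  by congr swsym; rewrite /oplus; ring.
- by decide_leq => /=; norm_wt; apply: swsymM => //; apply: swsymM => //; sym_ring.
Qed.

Lemma window_early_late g0 :
  (forall d, (h + d < g0.+1)%N -> R d = 0) ->
  swsym ((1 + bt * y) * oplus bt x (D (j.+1%:Z - g0%:Z)) * window g0 g0.+1
         + y * window g0 g0).
Proof.
move=> R0; rewrite /window !window_sum /wloc /lvalid /= !addn0 !addn1.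
have [le_gh|lt_hg] := leqP g0 h; last first.
  by decide_leq; rewrite /= !(addr0, mulr0, mul0r); exact: swsym0.
rewrite early_late_regroup; apply: swsymD; first apply: swsymD.
- have [lt_h|ge_h] := ltnP (h + 0) g0.+1.
    by rewrite (R0 _ lt_h) !mul0r; exact: swsym0.
  apply: swsymM => //; apply: swsymM => //.
  have [lt_th|ge_th] := ltnP (tops j) h; last first.
    by decide_leq => /=; rewrite ?andbF /=; sym_ring.
  have [ltg_h|geg_h] := ltnP g0.+1 h; first by decide_leq => /=; norm_wt; sym_ring.
  (* Here [h = g0.+1]: after an early opening on the right, [k1] may no longer extend the current
     box. *)
  have -> : j.+1%:Z - g0%:Z = j%:Z - h%:Z + 1 + 1 by lia.
  by decide_leq => /=; norm_wt; sym_ring.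
- have [lt_h|ge_h] := ltnP (h + 1) g0.+1.
    by rewrite (R0 _ lt_h) !mul0r; exact: swsym0.
  apply: swsymM => //; have [lt_gh|ge_gh] := ltnP g0 h; last first.
    have -> : j.+1%:Z - g0%:Z = j%:Z - h%:Z + 1 by lia.
    decide_leq; rewrite /= ?andbF /=; norm_wt.
    by have := swsym_row_c late_sym early_sym; congr swsym; rewrite /oplus; ring.
  (* When [h] exceeds [g0], both right columns impose the same constraints on these fillings; the
     two windows agree, and their common cofactor is symmetric. *)
  have bxy Q : swsym Q -> swsym ((1 + bt * y) * oplus bt x (D (j.+1%:Z - g0%:Z)) * Q
                                   + y * Q).
    move=> QS; rewrite -mulrDl; apply: swsymM => //; by sym_ring.
  decide_leq => /=; have [lt_th|ge_th] := ltnP (tops j) h; norm_wt => /=; apply: bxy.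
    by have := swsym_row_b late_sym early_sym; congr swsym; rewrite /oplus; ring.
  by have := swsym_row_a late_sym early_sym; congr swsym; rewrite /oplus; ring.
- by decide_leq => /=; norm_wt; apply: swsymM => //; apply: swsymM => //; sym_ring.
Qed.

End Step.

(** The right column opens no box before [k1], or two boxes, or one. In the last case the sum for an
    early opening need not be symmetric; it is controlled only together with the late opening, in
    the combination of [uv_sym], where [J%:Z - (g k)%:Z] is the content of the box being opened. *)
Definition swap_stable J : Prop :=
  [/\ forall g : nat -> nat, g k1 = g k -> swsym (colsum J g),
      forall g : nat -> nat, g k1 = (g k).+1 -> g k1.+1 = (g k).+2 -> swsym (colsum J g) &
      forall g g' : nat -> nat, (forall r : nat, r != k1 :> nat -> g' r = g r) ->
        g k1 = (g k).+1 -> g' k1 = g k -> g k1.+1 = (g k).+1 ->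
        swsym ((1 + bt * y) * oplus bt x (D (J%:Z - (g k)%:Z)) * colsum J g
               + y * colsum J g')].

Lemma swap_stable_wleft j (c : cword n) : swap_stable j -> c k = None -> c k1 = None ->
  [/\ swsym (wleft j c false false), swsym (wleft j c true true),
      swsym (wleft j c false true) &
      swsym ((1 + bt * y) * oplus bt x (D (j%:Z - (height (tops j) c k)%:Z))
               * wleft j c true false + y * wleft j c false true)].
Proof.
case=> IH1 IH2 IH3 ck ck1.
have hk1 : height (tops j) c k1 = height (tops j) c k by rewrite k1E heightS ck addn0.
have hk2 : height (tops j) c k1.+1 = height (tops j) c k.
  by rewrite heightS ck1 addn0.
split.
- by apply: IH1; rewrite /= hk1; lia.
- by apply: IH2; rewrite /= ?hk2 ?hk1; lia.
- by apply: IH1; rewrite /= hk1; lia.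
- have -> : height (tops j) c k =
      ((fun r => height (tops j) c r + ((k < r) && true) + ((k1 < r) && false))%N k).
    by rewrite /= ltnn; lia.
  apply: IH3; rewrite /= ?hk1 ?hk2; by lia.
Qed.

Lemma colsum_swap J : swap_stable J.
Proof.
elim: J => [|j IH].
  split=> /= *; [exact: swsym1|exact: swsym1|].
  by rewrite !mulr1; sym_ring.
split.
- move=> g gk; rewrite colsum_window; apply: swsym_sum => c /andP[/eqP ck /eqP ck1].
  have [? ? ? ?] := swap_stable_wleft IH ck ck1; rewrite gk.
  by apply: window_flat => //; [exact: leq_addr | exact: swsym_wrest].
- move=> g gk gk2; rewrite colsum_window; apply: swsym_sum => c /andP[/eqP ck /eqP ck1].
  have [? ? ? ?] := swap_stable_wleft IH ck ck1; rewrite gk.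
  apply: window_two => //; [exact: leq_addr | exact: swsym_wrest|].
  by rewrite -gk2 => d; exact: wrest_eq0.
move=> g g' eq_g gk g'k gk2; rewrite !colsum_window !mulr_sumr -big_split /=.
apply: swsym_sum => c /andP[/eqP ck /eqP ck1].
have [? ? ? ?] := swap_stable_wleft IH ck ck1.
have eqR d : wrest j g' c d = wrest j g c d.
  rewrite /wrest /wvalid eq_g; last by rewrite neq_ltn (ltn_ord k1) orbT.
  congr (if [&& _, _ & _] then _ else _); apply: eq_forallb => r.
  by case: eqP => //= _; case: (eqVneq r k1) => //= rk1; rewrite eq_g ?val_eqE.
have -> : g' k = g k by apply: eq_g; rewrite val_eqE.
rewrite g'k gk; under [X in _ + y * X]eq_bigr => p _ do
  under eq_bigr => q _ do rewrite eqR.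
apply: window_early_late => //; [exact: leq_addr | exact: swsym_wrest|].
by rewrite -gk2 => d; exact: wrest_eq0.
Qed.

End Window.
End Symmetry.

(** * The antisymmetrizer *)

Section Alternant.

Variables (K : fieldType) (n : nat).
Local Notation P := {mpoly K[n]}.

Definition alt (p : P) : P := \sum_(s : 'S_n) (-1) ^+ s *: msym s p.

Lemma altD p q : alt (p + q) = alt p + alt q.
Proof. by rewrite /alt -big_split; apply: eq_bigr => s _; rewrite rmorphD scalerDr. Qed.

Lemma alt0 : alt 0 = 0.
Proof. by rewrite /alt big1 // => s _; rewrite rmorph0 scaler0. Qed.

Lemma alt_sum I (r : seq I) (Q : pred I) (F : I -> P) :
  alt (\sum_(i <- r | Q i) F i) = \sum_(i <- r | Q i) alt (F i).
Proof. exact: (big_morph _ altD alt0). Qed.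

Lemma altZ a p : alt (a *: p) = a *: alt p.
Proof.
rewrite /alt scaler_sumr; apply: eq_bigr => s _.
by rewrite linearZ /= !scalerA mulrC.
Qed.

Lemma altB p q : alt (p - q) = alt p - alt q.
Proof. by rewrite altD -scaleN1r altZ scaleN1r. Qed.

Lemma alt_symM (q p : P) : (forall s, msym s q = q) -> alt (q * p) = q * alt p.
Proof.
move=> q_sym; rewrite /alt mulr_sumr; apply: eq_bigr => s _.
by rewrite rmorphM /= q_sym scalerAr.
Qed.

Lemma msym_swap (i j : 'I_n) (p : P) s : i != j ->
  msym (tperm i j) p = p -> (-1) ^+ (tperm i j * s)%g *: msym (tperm i j * s)%g p =
    - ((-1) ^+ s *: msym s p).
Proof.
move=> ij pS; rewrite msymMm pS odd_permM odd_tperm ij addTb.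
by case: (odd_perm s); rewrite /= ?expr0 ?expr1 ?scale1r ?scaleN1r ?opprK.
Qed.

(** Even permutations are paired with odd ones; deducing [alt p = - alt p] would fail in
    characteristic 2. *)
Lemma alt_swap (i j : 'I_n) p : i != j -> msym (tperm i j) p = p -> alt p = 0.
Proof.
move=> ij pS; rewrite /alt (bigID (@odd_perm _)) /= addrC.
rewrite [X in _ + X](reindex_inj (mulgI (tperm i j))) /=.
rewrite [X in _ + X](eq_bigl (fun s : 'S_n => ~~ odd_perm s)); last first.
  by move=> s; rewrite odd_permM odd_tperm ij.
rewrite -big_split big1 //= => s _.
by rewrite msym_swap // subrr.
Qed.

Lemma msym_adjacent (p : P) :
  (forall k k1 : 'I_n, k1 = k.+1 :> nat -> swsym k k1 p) ->
  forall s, msym s p = p.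
Proof.
move=> padj.
have ptp (i j : 'I_n) : (i < j)%N -> msym (tperm i j) p = p.
  move: {2}(j : nat) (leqnn j) => m; elim: m i j => [|m IH] i j.
    by rewrite leqn0 => /eqP-> .
  move=> le_jm lt_ij; have [jE|jN] := eqVneq (j : nat) i.+1; first exact: padj.
  have lt_j1 : (j.-1 < n)%N by rewrite (leq_ltn_trans (leq_pred _)).
  pose j1 := Ordinal lt_j1.
  have jj1 : j = j1.+1 :> nat by rewrite /= prednK //; lia.
  have -> : tperm i j = (tperm j1 j * tperm i j1 * tperm j1 j)%g.
    have := tpermJ i j1 (tperm j1 j); rewrite tpermL tpermD; last 2 first.
    - by rewrite -val_eqE /=; lia.
    - by rewrite -val_eqE /=; lia.
    by move=> <-; rewrite conjgE tpermV mulgA.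
  by rewrite !msymMm (padj j1 j) // IH ?(padj j1 j) //=; lia.
move=> s; case: (prod_tpermP s) => ts -> nid.
elim: ts nid => [|t ts IH] /=; first by rewrite big_nil msym1m.
case/andP=> tne /IH{}IH; rewrite big_cons msymMm.
have -> : msym (tperm t.1 t.2) p = p.
  have := tne; rewrite /dpair /= neq_ltn => /orP[|] lt; first exact: ptp.
  by rewrite tpermC; exact: ptp.
exact: IH.
Qed.

End Alternant.

(** * The bialternant formula *)

Section Bialternant.

Variables (K : fieldType) (n : nat) (beta : K) (B : int -> K).

Local Notation P := {mpoly K[n]}.
Local Notation bt := (beta%:MP : P).
Local Notation New := (Some true).
Local Notation Ext := (Some false).

(** For [z = 1] this is the factorial power of ['X_r]; other starting indices occur while columns
    are being stripped. *)
Definition factors (r : 'I_n) (z : int) (m : nat) : P :=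
  \prod_(u < m) oplus bt 'X_r (B (z + u%:Z))%:MP.

Lemma factors0 r z : factors r z 0 = 1. Proof. exact: big_ord0. Qed.

Lemma factorsSl r z m :
  factors r z m.+1 = oplus bt 'X_r (B z)%:MP * factors r (z + 1) m.
Proof.
rewrite /factors big_ord_recl addr0; congr (_ * _); apply: eq_bigr => u _.
by congr (oplus _ _ (B _)%:MP); rewrite /= /bump; lia.
Qed.

Lemma factorsSr r z m :
  factors r z m.+1 = factors r z m * oplus bt 'X_r (B (z + m%:Z))%:MP.
Proof. exact: big_ord_recr. Qed.

Lemma msym_factors s r z m : msym s (factors r z m) = factors (s r) z m.
Proof.
rewrite rmorph_prod; apply: eq_bigr => u _.
by rewrite /oplus /= !(rmorphD, rmorphM) /= !msymC msymXU.
Qed.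

Definition rows (h : 'I_n -> P) : P := \prod_r ((1 + bt * 'X_r) ^+ r * h r).

Lemma msym_shift (s : 'S_n) (r : 'I_n) m :
  msym s ((1 + bt * 'X_r) ^+ m) = (1 + bt * 'X_(s r)) ^+ m.
Proof. by rewrite rmorphXn rmorphD rmorphM rmorph1 /= msymC msymXU. Qed.

Lemma rows_split (k k1 : 'I_n) (h : 'I_n -> P) : k1 = k.+1 :> nat ->
  rows h = \prod_(r | (r != k) && (r != k1)) ((1 + bt * 'X_r) ^+ r * h r)
    * ((1 + bt * 'X_k) ^+ k * (1 + bt * 'X_k1) ^+ k)
    * (h k * (1 + bt * 'X_k1) * h k1).
Proof.
move=> k1E; rewrite /rows (bigD1 k) //= (bigD1 k1) //=; last first.
  by rewrite -val_eqE /= k1E neq_ltn ltnSn orbT.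
rewrite mulrCA [RHS]mulrC -!mulrA; set Q := \prod_(_ | _) _.
by rewrite k1E exprS; ring.
Qed.

(** Rows [k] and [k1] share a symmetric product of [k]-th powers; the single factor [1 + bt * 'X_k1]
    left over is the asymmetry that [h] and [Q] have to absorb. *)
Lemma alt_rows (k k1 : 'I_n) (h : 'I_n -> P) (Q : P) : k1 = k.+1 :> nat ->
  (forall r s, r != k -> r != k1 -> s = tperm k k1 -> msym s (h r) = h r) ->
  swsym k k1 (h k * (1 + bt * 'X_k1) * h k1 * Q) -> alt (rows h * Q) = 0.
Proof.
move=> k1E hS hQ; apply: (@alt_swap _ _ k k1); first by rewrite -val_eqE /=; lia.
rewrite (rows_split _ k1E) -mulrA; apply: swsymM => //.
apply: swsymM; last by rewrite /swsym rmorphM /= !msym_shift tpermL tpermR mulrC.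
apply: swsym_prod => r /andP[rk rk1]; apply: swsymM; last exact: hS.
by rewrite /swsym msym_shift tpermD // eq_sym.
Qed.

(* Rows [r >= i] all carry factors ending with the same index [n + s]; the
   value of such an alternant does not depend on [s]. *)
Definition psi_row (lam : nat -> nat) (J i : nat) (s : int) (r : 'I_n) : P :=
  if (r < i)%N then factors r J.+1%:Z (lam r + (n.-1 - r) - J)
  else factors r (r.+2%:Z + s) (n.-1 - r).

(** Rows are shifted one at a time. In row [k] the last factor is exchanged for a new first one, and
    these two differ by a constant times [1 + bt * 'X_k]. The factors common to both versions of row
    [k] match those of row [k1], so with the leftover [1 + bt * 'X_k1] the difference is symmetric
    and [alt] kills it. *)
Lemma alt_shift (lam : nat -> nat) J i s (Q : P) :
  (forall k k1 : 'I_n, k1 = k.+1 :> nat -> (i <= k)%N -> swsym k k1 Q) ->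
  alt (Q * rows (psi_row lam J i s)) = alt (Q * rows (psi_row lam J i (s - 1))).
Proof.
move=> QS.
pose mix v (r : 'I_n) := psi_row lam J i (if (r < v)%N then s else s - 1) r.
have mixE v : (i <= v < n)%N ->
    alt (Q * rows (mix v.+1)) = alt (Q * rows (mix v)).
  case/andP=> le_iv lt_vn; pose k := Ordinal lt_vn.
  have mixN r : r != k -> mix v.+1 r = mix v r.
    rewrite -val_eqE /= => rk; rewrite /mix; congr psi_row.
    by rewrite ltnS leq_eqVlt (negPf rk).
  have [lt_v1|ge_v1] := ltnP v.+1 n; last first.
    (* The last row has no factors to shift. *)
    suff -> : rows (mix v.+1) = rows (mix v) by [].
    apply: eq_bigr => r _; congr (_ * _); have [->|] := eqVneq r k; last exact: mixN.
    rewrite /mix /psi_row /= ltnNge le_iv /=.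
    have -> : (n.-1 - v = 0)%N by lia.
    by rewrite !factors0.
  pose k1 := Ordinal lt_v1.
  apply/eqP; rewrite -subr_eq0 -altB -mulrBr; apply/eqP.
  pose d r := if r == k then mix v.+1 k - mix v k else mix v r.
  have -> : rows (mix v.+1) - rows (mix v) = rows d.
    rewrite /rows (bigD1 k) //= [X in _ - X](bigD1 k) //= [RHS](bigD1 k) //=.
    rewrite /d eqxx; set S := \prod_(_ | _) _; set S' := \prod_(_ | _) _.
    set S'' := \prod_(_ | _) _.
    have <- : S' = S by apply: eq_bigr => r rk; rewrite mixN.
    have -> : S'' = S' by apply: eq_bigr => r rk; rewrite (negPf rk).
    by rewrite mulrBr mulrBl.
  rewrite mulrC; apply: (@alt_rows k k1) => //.
    move=> r t rk rk1 ->; rewrite /d (negPf rk) /mix /psi_row.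
    by case: ifP; rewrite msym_factors tpermD // eq_sym.
  apply: swsymM; last exact: QS.
  have k1k : k1 == k = false by rewrite -val_eqE /= -(addn1 v) -{2}[v]addn0 eqn_add2l.
  rewrite /d eqxx k1k /mix /psi_row /= ltnSn ltnn !ltnNge le_iv leqnSn (leq_trans le_iv (leqnSn v)) /=.
  have -> : (n.-1 - v = (n.-1 - v.+1).+1)%N by lia.
  set m := (n.-1 - v.+1)%N.
  rewrite [factors k (_ + (s - 1)) _]factorsSl factorsSr.
  have -> : v.+2%:Z + (s - 1) + 1 = v.+2%:Z + s by lia.
    have -> : v.+3%:Z + (s - 1) = v.+2%:Z + s by lia.
  rewrite /swsym !(rmorphM, rmorphB) /= !msym_factors tpermL tpermR /oplus.
  rewrite !(rmorphD, rmorphM, rmorph1) /= !msymC !msymXU tpermL tpermR.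
  by ring.
have -> : rows (psi_row lam J i s) = rows (mix n).
  by apply: eq_bigr => r _; rewrite /mix ltn_ord.
have -> : rows (psi_row lam J i (s - 1)) = rows (mix i).
  by apply: eq_bigr => r _; rewrite /mix /psi_row; case: ifP.
have [le_in|lt_ni] := leqP i n; last first.
  congr (alt (_ * _)); apply: eq_bigr => r _; congr (_ * _).
  by rewrite /mix /psi_row (ltn_trans (ltn_ord r) lt_ni).
suff mixI v : (v <= n)%N -> (i <= v)%N -> alt (Q * rows (mix v)) = alt (Q * rows (mix i)).
  exact: mixI.
elim: v => [|v IH]; first by move=> _; rewrite leqn0 => /eqP->.
move=> lt_vn; rewrite leq_eqVlt => /predU1P[->//|]; rewrite ltnS => le_iv.
rewrite mixE; [exact: IH (ltnW lt_vn) le_iv | by rewrite le_iv].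
Qed.

Variable bots : nat -> nat.
Hypothesis bots_n : forall j, (bots j <= n)%N.

Local Notation G := (colsum n beta B (fun=> 0%N) bots).
Local Notation hgt := (height 0).

Lemma height_le (c : cword n) r : (hgt c r <= r)%N.
Proof.
elim: r => [|r IH]; first by rewrite height0.
have [lt_rn|le_nr] := ltnP r n.
  by have := heightS 0 c (Ordinal lt_rn) => /= ->; case: (_ == _); rewrite ?addn1 ?addn0 // ltnW.
by rewrite height_over // ltnW.
Qed.

Lemma valid_box_le j i (c : cword n) :
  valid 0 (bots j) (minn^~ i) c -> forall r : 'I_n, (minn r i <= hgt c r)%N.
Proof. by case/and3P=> _ _ /forallP lv r; have /andP[] := lv r. Qed.

(* [t] is the largest entry of the box in row [i]. *)
Definition box_max (i : nat) (c : cword n) (t : 'I_n) : bool :=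
  [&& c t != None, hgt c t.+1 == i.+1 &
      [forall r : 'I_n, (t < r)%N && (hgt c r == i.+1) ==> (c r != Ext)]].

Lemma box_max_unique j i (c : cword n) : (i < bots j)%N ->
  valid 0 (bots j) (minn^~ i) c -> exists t, box_max i c =1 pred1 t.
Proof.
move=> lt_i /and3P[_ /eqP hn _].
have [r hr rmin] : exists2 r, (i < hgt c r)%N & forall r', (i < hgt c r')%N -> (r <= r')%N.
  have ex : exists r, (i < hgt c r)%N by exists n; rewrite hn.
  by case: (ex_minnP ex) => r; exists r.
have r_gt0 : (0 < r)%N by case: r hr {rmin}; rewrite // height0.
have le_rn : (r <= n)%N by apply: rmin; rewrite hn.
have lt_rn : (r.-1 < n)%N by rewrite prednK.
pose t1 := Ordinal lt_rn.
pose Pt (t : 'I_n) := (c t != None) && (hgt c t.+1 == i.+1).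
have ht1 : hgt c t1 = i /\ c t1 = New.
  have: (hgt c t1 <= i)%N.
    by rewrite leqNgt; apply/negP => /rmin /=; rewrite leqNgt prednK // leqnn.
  have := heightS 0 c t1; rewrite /= prednK // => hE.
  move: hr; rewrite hE; case: eqP => [-> |_]; last by rewrite addn0; lia.
  by rewrite addn1 => ? ?; split=> //; lia.
have Pt1 : Pt t1 by rewrite /Pt heightS; case: ht1 => -> ->; rewrite eqxx addn1 eqxx.
case: (arg_maxnP (fun t : 'I_n => t : nat) Pt1) => t0 /andP[ct0 /eqP ht0] t0max.
exists t0 => t /=; apply/idP/eqP => [/and3P[ct /eqP ht /forallP tE]|->].
  apply: val_inj; apply/eqP; rewrite eqn_leq /=.
  have -> : (t <= t0)%N by apply: t0max; rewrite /Pt ct ht eqxx.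
  rewrite /= leqNgt; apply/negP => lt_t.
  have le_h : (hgt c t.+1 <= hgt c t0)%N by exact: leq_height.
  have := heightS 0 c t0; rewrite ht0.
  case: eqP => [_|ct0N]; first by move: le_h; rewrite ht; lia.
  rewrite addn0 => ht0'; have := tE t0; rewrite lt_t -ht0' eqxx /=.
  by move: ct0 ct0N; case: (c t0) => [[]|].
rewrite /box_max ct0 ht0 eqxx /=; apply/forallP => r'; apply/implyP.
case/andP=> lt_t /eqP hr'; apply/eqP => cr'.
have := t0max r'; rewrite /Pt cr' heightS hr' cr' addn0 eqxx /= => /(_ isT).
by rewrite leqNgt lt_t.
Qed.

(** The heights [minn^~ i] on the right freeze the first [i] rows: the box in row [r < i] contains
    [r] and nothing else. Going to [i.+1] freezes one more box, which amounts to its largest entry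
    being [i]. *)
Lemma valid_box j (i : 'I_n) (c : cword n) : (i < bots j)%N ->
  valid 0 (bots j) (minn^~ i.+1) c =
  valid 0 (bots j) (minn^~ i) c && box_max i c i.
Proof.
move=> lt_i; apply/idP/andP => [v|[/and3P[_ /eqP hn /forallP lv] /and3P[ci /eqP hi /forallP cE]]].
  have hi1 : hgt c i.+1 = i.+1.
    apply/eqP; rewrite eqn_leq height_le /=.
    have [lt_in|ge_in] := ltnP i.+1 n.
      by have := valid_box_le v (Ordinal lt_in); rewrite /= minnn.
    case/and3P: v => gn _ _; have nE : n = i.+1 by apply/eqP; rewrite eqn_leq ge_in ltn_ord.
    by move: gn; rewrite (congr1 (hgt c) nE); lia.
  have ciN : c i = New.
    have := heightS 0 c i; rewrite hi1; case: eqP => // _; rewrite addn0 => hE.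
    by have := height_le c i; rewrite -hE ltnn.
  case/and3P: v => gn hn /forallP lv; split; last first.
    rewrite /box_max hi1 ciN eqxx /=; apply/forallP => r; apply/implyP.
    case/andP=> lt_ir /eqP hr; apply/eqP => crE.
    by have := lv r; rewrite /lvalid crE eqxx hr /= (minn_idPr lt_ir) ltnn !andbF.
  apply/and3P; split=> //; first by apply: leq_trans gn; rewrite leq_min geq_minl /=; lia.
  apply/forallP => r; have /andP[gr /implyP crE] := lv r.
  rewrite /lvalid (leq_trans _ gr) /=; last by lia.
  by apply/implyP => /crE /andP[-> lt_r] /=; lia.
have hr r : (r <= i.+1)%N -> hgt c r = r.
  move=> le_r; apply/eqP; rewrite eqn_leq height_le /=.
  have {le_r} : (r + (i.+1 - r) = i.+1)%N by rewrite subnKC.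
  move: (i.+1 - r)%N => d rd; have : (hgt c (r + d) = r + d)%N by rewrite rd hi.
  elim: d {rd} => [|d IH]; first by rewrite addn0 => ->.
  rewrite addnS => hE; apply: IH; apply/eqP; rewrite eqn_leq height_le /=.
  have [lt_n|ge_n] := ltnP (r + d) n.
    by have := heightS 0 c (Ordinal lt_n); rewrite /= hE; case: (_ == _); lia.
  by rewrite -(height_over _ _ ge_n) hE.
apply/and3P; split; first by rewrite hn; lia.
  exact/eqP.
apply/forallP => r; have /andP[gr /implyP crE] := lv r; rewrite /lvalid.
have [le_ri|lt_ir] := leqP r i.
  have hrr : hgt c r = r by apply: hr; lia.
  have hrS : hgt c r.+1 = r.+1 by apply: hr; lia.
  have := heightS 0 c r; rewrite hrS hrr; have -> : (minn r i.+1 <= r)%N by lia.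
  by case: eqP => [->|_] //=; lia.
have le_h : (hgt c i.+1 <= hgt c r)%N by exact: leq_height.
have -> /= : (minn r i.+1 <= hgt c r)%N by rewrite hi in le_h; lia.
apply/implyP => /[dup] /eqP crX /crE /andP[-> _] /=.
have := cE r; rewrite lt_ir crX eqxx /= implybF => /eqP.
by rewrite hi in le_h; lia.
Qed.

Local Notation term j c := (cweight beta B (fun=> 0%N) j c * G j (hgt c)).

(** Row [k] of [psi_row] begins with the very parameter that the letter [k1] has in the box
    [(i, j)], so this factor and the weight of [k1] form a symmetric product. The fillings then pair
    up: [k1] opens the box, or [k] opens and [k1] extends it; [k1] alone extends it, or both letters
    do. *)
Lemma alt_box_cancel (lam : nat -> nat) j i (k k1 : 'I_n) : k1 = k.+1 :> nat -> (i <= k)%N ->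
  alt (rows (psi_row lam j.+1 i (j%:Z - i%:Z)) *
       \sum_(c | valid 0 (bots j) (minn^~ i) c && box_max i c k1) term j c) = 0.
Proof.
move=> k1E le_ik; have ne_k : k != k1 by rewrite -val_eqE /=; lia.
pose tail c d := [forall r : 'I_n,
  (k1 < r)%N && (wheight (fun=> 0%N) k1 j c d r == i.+1) ==> (c r != Ext)].
pose T := fun _ : nat => 0%N.
pose sel (c : cword n) (p q : option bool) := [&& q != None,
  (hgt c k + ((p == New) + (q == New)))%N == i.+1 & tail c ((p == New) + (q == New))%N].
rewrite big_mkcond (sum_window _ ne_k) mulr_sumr alt_sum big1 // => c.
case/andP=> /eqP ck /eqP ck1.
set h := hgt c k.
pose W p q : P := if sel c p q then wrest beta B T bots k k1 j (minn^~ i) c ((p == New) + (q == New))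
    * wloc beta B T k k1 j (minn k i) (minn k1 i) h p q
    * wleft beta B T bots k k1 j c (p == New) (q == New) else 0.
have -> : \sum_p \sum_q (if valid 0 (bots j) (minn^~ i) (upd k k1 c p q) &&
    box_max i (upd k k1 c p q) k1 then term j (upd k k1 c p q) else 0) =
    \sum_p \sum_q W p q.
  apply: eq_bigr => p _; apply: eq_bigr => q _; rewrite /W.
  rewrite -(valid_upd beta B T bots k1E j (minn^~ i) p q ck ck1).
  have -> : box_max i (upd k k1 c p q) k1 = sel c p q.
    rewrite /box_max /sel ffunE eqxx (eq_sym k1) (negPf ne_k).
    have hk1 : hgt c k1.+1 = h by rewrite heightS ck1 k1E heightS ck !addn0.
    rewrite height_upd // ltnSn hk1 -addnA; have -> : (k < k1.+1)%N by lia.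
    congr [&& _, _ & _]; apply: eq_forallb => r.
    have [lt_r|] //= := ltnP k1 r; rewrite /wheight lt_r mul1n height_upd // lt_r.
    have -> : (k < r)%N by lia.
    rewrite -addnA ffunE; have -> : r == k = false by rewrite -val_eqE /=; lia.
    by have -> : r == k1 = false by rewrite -val_eqE /=; lia.
  by case: (sel c p q); rewrite ?andbT ?andbF.
(* If [k1] opens row [i], the rows above are frozen, so [k] can neither open nor extend a box
   there. *)
have WE : \sum_p \sum_q W p q = W None New + W New Ext + (W None Ext + W Ext Ext).
  have W0 p : W p None = 0 by rewrite /W /sel.
  have WNN : W New New = 0.
    rewrite /W /wloc /lvalid; case: ifP => //; case/and3P=> _ /eqP hi _.
    suff -> : (minn k i <= h)%N = false by rewrite /= mulr0 mul0r.
    by rewrite -/h /= in hi; lia.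
  have WEN : W Ext New = 0.
    rewrite /W /wloc /lvalid; case: ifP => //; case/and3P=> _ /eqP hi _.
    suff -> : (minn k i < h)%N = false by rewrite /= !andbF mulr0 mul0r.
    by rewrite -/h /= in hi; lia.
  by rewrite !sum_option_bool !W0 WNN WEN; ring.
have [flat _ late early] :=
  swap_stable_wleft k1E (colsum_swap beta B T bots k1E j) ck ck1.
rewrite {}WE mulrDr altD.
have kE : (minn k i = i)%N by lia.
have k1i : (minn k1 i = i)%N by lia.
have hk1 : hgt c k1 = h by rewrite k1E heightS ck addn0.
have hk2 : hgt c k1.+1 = h by rewrite heightS ck1 addn0.
have wS d := swsym_wrest beta B T bots k k1 j (minn^~ i) c d.
have ctS (r : 'I_n) (s : 'S_n) : r != k -> r != k1 -> s = tperm k k1 ->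
    msym s (psi_row lam j.+1 i (j%:Z - i%:Z) r) = psi_row lam j.+1 i (j%:Z - i%:Z) r.
  by move=> rk rk1 ->; rewrite /psi_row; case: ifP; rewrite msym_factors tpermD // eq_sym.
have psk : psi_row lam j.+1 i (j%:Z - i%:Z) k =
    oplus bt 'X_k (B (k1.+1%:Z + (j%:Z - i%:Z)))%:MP *
    factors k (k1.+2%:Z + (j%:Z - i%:Z)) (n.-1 - k1).
  rewrite /psi_row ltnNge le_ik /=.
  have -> : (n.-1 - k)%N = (n.-1 - k1).+1 by have := ltn_ord k1; lia.
  by rewrite factorsSl -k1E; congr (_ * factors _ _ _); lia.
have psk1 : psi_row lam j.+1 i (j%:Z - i%:Z) k1 =
    factors k1 (k1.+2%:Z + (j%:Z - i%:Z)) (n.-1 - k1).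
  by rewrite /psi_row ltnNge k1E (leq_trans le_ik (leqnSn k)).
have -> : alt (rows (psi_row lam j.+1 i (j%:Z - i%:Z)) * (W None New + W New Ext)) = 0.
  rewrite /W /sel /= !addn0 !add0n; case: (_ && _) / andP => [[/eqP hi _]|]; last first.
    by rewrite addr0 mulr0 alt0.
  have {}hi : h = i by rewrite -/h in hi; lia.
  apply: (alt_rows k1E ctS); rewrite psk psk1 /wloc /lvalid kE k1i hi /= !addn0 addn1.
  rewrite leqnn leqnSn ltnS leqnn /=.
  move: early late; rewrite /T -/h hi.
  set e := wleft _ _ _ _ _ _ _ _ true false; set l := wleft _ _ _ _ _ _ _ _ _ _.
  set R := wrest _ _ _ _ _ _ _ _ _ _ => eS lS.
  (* [w] is the combination in [early]; the two fillings add up to symmetric factors times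
     [l + bt * w]. *)
  pose w := (1 + bt * 'X_k1) * oplus bt 'X_k (B (k.+1%:Z + (j%:Z - i%:Z)))%:MP * e
            + 'X_k1 * l.
  set f := factors k _ _; set f1 := factors k1 _ _.
  set b := (B (k1.+1%:Z + (j%:Z - i%:Z)))%:MP.
  have -> : oplus bt 'X_k b * f * (1 + bt * 'X_k1) * f1 *
     (R * (1 * wt beta B k1 (j%:Z - i%:Z)) * l +
      R * (wt beta B k (j%:Z - i%:Z) * (bt * wt beta B k1 (j%:Z - i.+1%:Z + 1))) * e) =
     R * (oplus bt 'X_k b * oplus bt 'X_k1 b) * (f * f1) * (l + bt * w).
    have -> : j%:Z - i.+1%:Z + 1 = j%:Z - i%:Z by lia.
    by rewrite /w /wt /oplus -/b; ring.
  have bS : msym (tperm k k1) b = b by exact: msymC.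
  apply: swsymM; first apply: swsymM; first apply: swsymM; first exact: wS.
  - rewrite /swsym /oplus !(rmorphM, rmorphD) /= !msymC !msymXU tpermL tpermR ?bS.
    by rewrite mulrC.
  - by rewrite /swsym rmorphM /= /f /f1 !msym_factors tpermL tpermR mulrC.
  - by apply: swsymD => //; apply: swsymM => //; exact: swsymC.
rewrite add0r /W /sel /= !addn0; case: (_ && _) / andP => [[/eqP hi _]|]; last first.
  by rewrite addr0 mulr0 alt0.
rewrite -/h in hi; apply: (alt_rows k1E ctS); rewrite psk psk1 /wloc /lvalid kE k1i hi /=.
rewrite !addn0 leqnn leqnSn /= mul1r /T.
have -> : j%:Z - i.+1%:Z + 1 = j%:Z - i%:Z by lia.
set R := wrest _ _ _ _ _ _ _ _ _ _; set fl := wleft _ _ _ _ _ _ _ _ _ _.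
set f := factors k _ _; set f1 := factors k1 _ _.
set b := (B (k1.+1%:Z + (j%:Z - i%:Z)))%:MP.
have -> : oplus bt 'X_k b * f * (1 + bt * 'X_k1) * f1 *
     (R * (bt * wt beta B k1 (j%:Z - i%:Z)) * fl +
      R * (bt * wt beta B k (j%:Z - i%:Z) * (bt * wt beta B k1 (j%:Z - i%:Z))) * fl) =
     R * (oplus bt 'X_k b * oplus bt 'X_k1 b) * (f * f1) * fl * bt
     * ((1 + bt * 'X_k) * (1 + bt * 'X_k1))
     * (1 + bt * (B (k.+1%:Z + (j%:Z - i%:Z)))%:MP).
  by rewrite /wt /oplus -/b; ring.
apply: swsymM; last by rewrite /swsym !(rmorphD, rmorphM, rmorph1) /= !msymC.
apply: swsymM; last first.
  rewrite /swsym !(rmorphD, rmorphM, rmorph1) /= !msymC !msymXU tpermL tpermR.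
  by rewrite mulrC.
apply: swsymM; last exact: swsymC.
apply: swsymM => //; apply: swsymM; last first.
  by rewrite /swsym rmorphM /= /f /f1 !msym_factors tpermL tpermR mulrC.
apply: swsymM; first exact: wS.
by rewrite /swsym /oplus !(rmorphM, rmorphD) /= !msymC !msymXU tpermL tpermR mulrC.
Qed.

Lemma alt_box (lam : nat -> nat) j i : (i < bots j)%N ->
  alt (G j.+1 (minn^~ i) * rows (psi_row lam j.+1 i (j%:Z - i%:Z))) =
  alt (G j.+1 (minn^~ i.+1) * rows (psi_row lam j.+1 i (j%:Z - i%:Z))).
Proof.
move=> lt_i; have lt_in : (i < n)%N by exact: leq_trans lt_i (bots_n j).
pose io := Ordinal lt_in.
have GE : G j.+1 (minn^~ i) =
    \sum_t \sum_(c | valid 0 (bots j) (minn^~ i) c && box_max i c t) term j c.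
  rewrite (exchange_big_dep (valid 0 (bots j) (minn^~ i))) /=; last first.
    by move=> t c _ /andP[].
  apply: eq_bigr => c v; have [t tE] := box_max_unique lt_i v.
  by rewrite (eq_bigl (pred1 t)) ?big_pred1_eq // => t'; rewrite v /= tE.
have GE' : G j.+1 (minn^~ i.+1) =
    \sum_(c | valid 0 (bots j) (minn^~ i) c && box_max i c io) term j c.
  by apply: eq_bigl => c; rewrite (@valid_box j io).
rewrite GE (bigD1 io) //= -GE' mulrDl altD -[RHS]addr0; congr (_ + _).
rewrite mulr_suml alt_sum big1 // => t ti.
have [lt_it|le_ti] := ltnP i t; last first.
  rewrite big_pred0 ?mul0r ?alt0 // => c; rewrite /box_max.
  have := height_le c t.+1; have : t != i :> nat by rewrite -val_eqE in ti.
  case: eqP => [->|]; rewrite ?andbF //; lia.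
have lt_kn : (t.-1 < n)%N by rewrite (leq_ltn_trans (leq_pred t)).
rewrite mulrC; apply: (@alt_box_cancel lam j i (Ordinal lt_kn) t) => /=.
  by rewrite prednK //; lia.
by lia.
Qed.

(** A fully frozen column has one filling, and all its weights use the parameter of index [j + 1],
    just before those that [psi_row] has put into the finished rows. *)
Lemma colsum_full j :
  G j.+1 (minn^~ (bots j)) =
  (\prod_(r < n | (r < bots j)%N) wt beta B r (j%:Z - r%:Z)) * G j (minn^~ (bots j)).
Proof.
pose c0 : cword n := [ffun r : 'I_n => if (r < bots j)%N then New else None].
have h0 r : hgt c0 r = minn r (bots j).
  elim: r => [|r IH]; first by rewrite height0 min0n.
  have [lt_rn|le_nr] := ltnP r n.
    by have := heightS 0 c0 (Ordinal lt_rn); rewrite /= IH ffunE /=; case: ltnP => ? /=; lia.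
  by have := bots_n j; rewrite height_over // IH; lia.
have vE c : valid 0 (bots j) (minn^~ (bots j)) c = (c == c0).
  apply/idP/eqP => [v|->]; last first.
    rewrite /valid h0 (minn_idPr (bots_n j)) leqnn eqxx /=; apply/forallP => r.
    by rewrite /lvalid h0 leqnn ffunE; case: ifP.
  have hle r : (hgt c r <= bots j)%N.
    have [le_rn|lt_nr] := leqP r n.
      by case/and3P: v => _ /eqP <- _; exact: leq_height.
    case/and3P: v => _ /eqP <- _; rewrite /height !add0n.
    rewrite [leqRHS]big_mkcond [leqLHS]big_mkcond leq_sum // => u _.
    by rewrite ltn_ord; case: ifP.
  have hge := valid_box_le v.
  have hgeS (r : 'I_n) : (minn r.+1 (bots j) <= hgt c r.+1)%N.
    have [lt_rn|le_nr] := ltnP r.+1 n; first exact: hge (Ordinal lt_rn).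
    case/and3P: v => gn _ _; have nE : n = r.+1 by apply/eqP; rewrite eqn_leq le_nr ltn_ord.
    by move: gn; rewrite (congr1 (hgt c) nE); lia.
  apply/ffunP => r; rewrite ffunE.
  have := heightS 0 c r; have := hge r; have := hgeS r; have := hle r; have := hle r.+1.
  have := height_le c r; case/and3P: v => _ _ /forallP /(_ r) /andP[_].
  case: (c r) => [[]|] /=; case: (ltnP r (bots j)) => // lt_r; rewrite ?addn0 ?addn1; lia.
rewrite /= (eq_bigl (pred1 c0)) ?big_pred1_eq; last exact: vE.
congr (_ * _); last by apply: eq_colsum => r; rewrite h0.
rewrite /cweight [RHS]big_mkcond; apply: eq_bigr => r _; rewrite /= ffunE h0.
by case: ltnP => // lt_r; rewrite /= (minn_idPl (ltnW lt_r)).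
Qed.

Lemma swsym_colsum_min J i (k k1 : 'I_n) : k1 = k.+1 :> nat -> (i <= k)%N ->
  swsym k k1 (G J (minn^~ i)).
Proof.
move=> k1E le_ik.
have [flat _ _] := colsum_swap beta B (fun=> 0%N) bots k1E J.
by apply: flat; rewrite k1E; lia.
Qed.

(* The diagonal term of the determinant of [(x_r | a)^(rho_i + n - i) (1 + beta x_r)^(i - 1)]. *)
Definition staircase (rho : nat -> nat) : P :=
  rows (fun r => factors r 1 (rho r + (n.-1 - r))).

Section Shape.

Variable lam : nat -> nat.
Hypothesis botsE : forall i j, (i < bots j)%N = (j < lam i)%N.

(** The quantity preserved by the stripping; the shift is the content of the box in row [i] of the
    last column, the next one to be frozen. *)
Let U J i := alt (G J (minn^~ i) * rows (psi_row lam J i (J%:Z - 1 - i%:Z))).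

Lemma psi_row_step J i s : lam i = J -> s = J%:Z - 1 - i%:Z ->
  rows (psi_row lam J i s) = rows (psi_row lam J i.+1 s).
Proof.
move=> lamE ->; apply: eq_bigr => r _; congr (_ * _); rewrite /psi_row ltnS.
case: (ltngtP r i) => // ->; rewrite lamE addKn; congr factors; lia.
Qed.

Lemma colsum_step j i : (i < bots j)%N -> (bots j.+1 <= i)%N -> U j.+1 i = U j.+1 i.+1.
Proof.
move=> lt_i le_i; rewrite /U.
have jE : j.+1%:Z - 1 - i%:Z = j%:Z - i%:Z by lia.
rewrite jE (alt_box _ lt_i) (@psi_row_step j.+1 i); last exact: (esym jE); last first.
  by apply/eqP; rewrite eqn_leq -botsE lt_i andbT leqNgt -botsE -leqNgt.
rewrite alt_shift; last by move=> k k1 k1E lt_k; exact: swsym_colsum_min.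
by have -> : j%:Z - i%:Z - 1 = j.+1%:Z - 1 - i.+1%:Z by lia.
Qed.

Lemma colsum_drop j : U j.+1 (bots j) = U j (bots j).
Proof.
rewrite /U colsum_full; set W := \prod_(_ < n | _) _; set R := rows _.
have -> : W * G j (minn^~ (bots j)) * R = G j (minn^~ (bots j)) * (W * R) by ring.
rewrite {}/W {}/R; set s := _ - _ - _.
have -> : j%:Z - 1 - (bots j)%:Z = s - 1 by rewrite /s; lia.
rewrite -alt_shift; last by move=> k k1 k1E lt_k; exact: swsym_colsum_min.
congr (alt (_ * _)); rewrite /rows big_mkcond -big_split /=.
apply: eq_bigr => r _; rewrite mulrCA; congr (_ * _).
rewrite /psi_row; case: ifP => [lt_r|_]; last by rewrite mul1r.
have -> : (lam r + (n.-1 - r) - j = (lam r + (n.-1 - r) - j.+1).+1)%N.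
  by have := lt_r; rewrite botsE; lia.
rewrite factorsSl /wt; congr (oplus _ _ (B _)%:MP * factors _ _ _); lia.
Qed.

Lemma colsum_empty i : (i < n)%N -> (bots 0 <= i)%N -> U 0 i = U 0 i.+1.
Proof.
move=> lt_i le_i; rewrite /U (@psi_row_step 0 i); last by []; last first.
  by apply/eqP; rewrite -leqn0 leqNgt -botsE -leqNgt.
rewrite alt_shift; last by move=> *; exact: swsym1.
by have -> : 0%:Z - 1 - i%:Z - 1 = 0%:Z - 1 - i.+1%:Z by lia.
Qed.

Lemma alt_colsum_columns J : U J (bots J) = alt (staircase lam).
Proof.
elim: J => [|J IH]; last first.
  rewrite -IH -(colsum_drop J).
  have le_b : (bots J.+1 <= bots J)%N.
    by rewrite leqNgt; apply/negP => lt; have := lt; rewrite botsE => /ltnW;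
       rewrite -botsE ltnn.
  suff Ui i : (bots J.+1 <= i)%N -> (i <= bots J)%N -> U J.+1 (bots J.+1) = U J.+1 i by exact: Ui.
  elim: i => [|i IHi]; first by rewrite leqn0 => /eqP->.
  rewrite leq_eqVlt => /predU1P[-> //|]; rewrite ltnS => le_i lt_i.
  by rewrite (IHi le_i (ltnW lt_i)) colsum_step.
have -> : alt (staircase lam) = U 0 n.
  rewrite /U mul1r; congr alt; apply: eq_bigr => r _.
  by rewrite /psi_row ltn_ord subn0.
suff Ui i : (bots 0 <= i)%N -> (i <= n)%N -> U 0 (bots 0) = U 0 i by exact: Ui.
elim: i => [|i IHi]; first by rewrite leqn0 => /eqP->.
rewrite leq_eqVlt => /predU1P[-> //|]; rewrite ltnS => le_i lt_i.
by rewrite (IHi le_i (ltnW lt_i)) colsum_empty.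
Qed.

End Shape.

End Bialternant.

Section BialternantFormula.

Variables (K : fieldType) (n : nat) (beta : K) (B : int -> K).
Local Notation P := {mpoly K[n]}.

(** [alt_shift] lowers the shift to -1, where row [r] starts at index [r.+1]; the empty shape in
    [alt_colsum_columns] turns this into rows that all start at 1. *)
Lemma alt_rows_top lam J (m : nat) :
  alt (rows beta (psi_row beta B lam J 0 (m%:Z - 1))) =
  alt (staircase n beta B (fun=> 0%N) : P).
Proof.
have -> : rows beta (psi_row beta B lam J 0 (m%:Z - 1)) =
    rows beta (psi_row beta B (fun=> 0%N) 0 0 (m%:Z - 1)) :> P by [].
elim: m => [|m IH].
  rewrite -(@alt_colsum_columns _ n beta B (fun=> 0%N) (fun=> leq0n n) _ _ 0) //.
  by rewrite /= mul1r !subr0.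
rewrite -[rows _ _]mul1r alt_shift ?mul1r; last by move=> *; exact: swsym1.
by have -> : m.+1%:Z - 1 - 1 = m%:Z - 1 by lia.
Qed.

Lemma alt_colsum (lam bots : nat -> nat) (m : nat) :
  (forall j, (bots j <= n)%N) -> (forall i j, (i < bots j)%N = (j < lam i)%N) ->
  bots m = 0%N ->
  alt (colsum n beta B (fun=> 0%N) bots m (fun=> 0%N) * staircase n beta B (fun=> 0%N))
    = alt (staircase n beta B lam).
Proof.
move=> bots_n botsE bm; rewrite -(alt_colsum_columns beta B bots_n botsE m) bm subr0.
rewrite (@eq_colsum _ _ _ _ _ _ _ (minn^~ 0%N) (fun=> 0%N)); last by move=> r; rewrite minn0.
have GS : forall s, msym s (colsum n beta B (fun=> 0%N) bots m (fun=> 0%N)) =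
    colsum n beta B (fun=> 0%N) bots m (fun=> 0%N).
  apply: msym_adjacent => k k1 k1E.
  by have [flat _ _] := colsum_swap beta B (fun=> 0%N) bots k1E m; exact: flat.
by rewrite (alt_symM _ GS) (alt_symM _ GS) alt_rows_top.
Qed.

End BialternantFormula.

(** * Coefficients of alternants *)

Section Newton.

Variables (K : fieldType) (beta : K) (a : nat -> K).
Hypothesis a_unit : forall i, (0 < i)%N -> 1 + beta * a i != 0.

Implicit Types (p : {poly K}).

Definition newton (q : nat) : {poly K} := \prod_(u < q) oplus beta%:P 'X (a u.+1)%:P.

Local Notation y q := (ominus beta (a q.+1)).

(* [ncoefX d q] is the coefficient of [newton q] in the expansion of ['X^d]. *)
Fixpoint ncoefX (d q : nat) : K :=
  if d is d'.+1 then
    y q * ncoefX d' q + (if q is q'.+1 then (1 + beta * y q') * ncoefX d' q' else 0)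
  else (q == 0%N)%:R.

Arguments ncoefX : simpl never.

Lemma ncoefXS d q : ncoefX d.+1 q =
  y q * ncoefX d q + (if q is q'.+1 then (1 + beta * y q') * ncoefX d q' else 0).
Proof. by []. Qed.

Definition ncoef (q : nat) (p : {poly K}) : K := \sum_(d < size p) p`_d * ncoefX d q.

Lemma ncoefE q p N : (size p <= N)%N -> ncoef q p = \sum_(d < N) p`_d * ncoefX d q.
Proof.
move=> le_pN; rewrite /ncoef (big_ord_widen _ (fun d => p`_d * ncoefX d q) le_pN).
rewrite big_mkcond; apply: eq_bigr => d _; case: ltnP => // ge_d.
by rewrite nth_default ?mul0r.
Qed.

Lemma ncoefD q p p' : ncoef q (p + p') = ncoef q p + ncoef q p'.
Proof.
pose N := maxn (size p) (size p').
rewrite !(@ncoefE q _ N) ?leq_maxl ?leq_maxr ?size_polyD //.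
by rewrite -big_split; apply: eq_bigr => d _; rewrite coefD mulrDl.
Qed.

Lemma ncoefZ q c p : ncoef q (c *: p) = c * ncoef q p.
Proof.
rewrite (@ncoefE q _ _ (size_scale_leq c p)) /ncoef mulr_sumr.
by apply: eq_bigr => d _; rewrite coefZ mulrA.
Qed.

Lemma ncoefXM q p : ncoef q ('X * p) =
  y q * ncoef q p + (if q is q'.+1 then (1 + beta * y q') * ncoef q' p else 0).
Proof.
have szX : (size ('X * p)%R <= (size p).+1)%N.
  by rewrite mulrC (leq_trans (size_polyMleq _ _)) // size_polyX addn2.
rewrite (ncoefE _ szX) big_ord_recl coefXM eqxx mul0r add0r.
have -> : (if q is q'.+1 then (1 + beta * y q') * ncoef q' p else 0) =
  \sum_(d < size p) p`_d * (if q is q'.+1 then (1 + beta * y q') * ncoefX d q' else 0).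
  case: q => [|q']; first by rewrite big1 // => d _; rewrite mulr0.
  by rewrite /ncoef mulr_sumr; apply: eq_bigr => d _; rewrite mulrCA.
rewrite /ncoef mulr_sumr -big_split; apply: eq_bigr => d _.
by rewrite coefXM /= ncoefXS mulrDr mulrCA.
Qed.

Lemma ominusK t : (0 < t)%N -> (1 + beta * a t) * ominus beta (a t) + a t = 0.
Proof.
by move=> t_gt0; rewrite /ominus mulrCA mulfV ?a_unit // mulr1 addNr.
Qed.

Lemma one_ominus t : (0 < t)%N -> (1 + beta * a t) * (1 + beta * ominus beta (a t)) = 1.
Proof.
move=> t_gt0; rewrite mulrDr mulr1 mulrCA.
have /eqP := ominusK t_gt0; rewrite addr_eq0 => /eqP ->.
by rewrite mulrN addrK.
Qed.

Lemma ncoef_oplus q t p : ncoef q (oplus beta%:P 'X (a t)%:P * p) =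
  (1 + beta * a t) * ncoef q ('X * p) + a t * ncoef q p.
Proof.
rewrite -!ncoefZ -ncoefD; congr ncoef.
by rewrite /oplus -!mul_polyC !rmorphD !rmorphM /=; ring.
Qed.

Lemma newtonS q : newton q.+1 = oplus beta%:P 'X (a q.+1)%:P * newton q.
Proof. by rewrite /newton big_ord_recr mulrC. Qed.

(** The last factor of [newton T.+1] has root [ominus beta (a T.+1)] and so kills the coefficient at
    [T]; the lower ones are zero by induction. *)
Lemma ncoef_newtonM_lt q T p : (q < T)%N -> ncoef q (newton T * p) = 0.
Proof.
elim: T q => // T IH q; rewrite ltnS newtonS -mulrA ncoef_oplus leq_eqVlt.
case/predU1P=> [->|lt_q]; rewrite ncoefXM.
  rewrite mulrDr mulrA -addrA [_ * (if _ is _.+1 then _ else _) + _]addrC addrA -mulrDl.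
  rewrite ominusK // mul0r add0r.
  by case: T IH => [|T] IH; rewrite ?mulr0 // IH // mulr0 mulr0.
rewrite IH // !mulr0 add0r addr0; case: q lt_q => [|q] lt_q; rewrite ?mulr0 //.
by rewrite IH ?mulr0 // ltnW.
Qed.

Lemma ncoefX_gt d q : (d < q)%N -> ncoefX d q = 0.
Proof.
elim: d q => [|d IH] [|q] // lt_dq.
by rewrite ncoefXS !IH ?mulr0 ?addr0 // ltnW.
Qed.

Lemma ncoef_gt q p : (size p <= q)%N -> ncoef q p = 0.
Proof.
move=> le_pq; rewrite /ncoef big1 // => d _.
by rewrite ncoefX_gt ?mulr0 // (leq_trans (ltn_ord d)).
Qed.

Lemma size_newton q : (size (newton q) <= q.+1)%N.
Proof.
elim: q => [|q IH]; first by rewrite /newton big_ord0 size_poly1.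
rewrite newtonS (leq_trans (size_polyMleq _ _)) //.
have : (size (oplus beta%:P 'X (a q.+1)%:P) <= 2)%N.
  rewrite /oplus; apply/leq_sizeP => j lt_j.
  rewrite !coefD coefX -mulrA coefCM coefMC coefX coefC.
  by case: j lt_j => [|[|j]] //= _; rewrite !mul0r mulr0 !addr0.
by move: (size _) (size _) IH => s1 s2; lia.
Qed.

Lemma ncoef_newton q : ncoef q (newton q) = 1.
Proof.
elim: q => [|q IH].
  by rewrite /newton big_ord0 /ncoef size_poly1 big_ord_recl big_ord0 coef1 /= mulr1 addr0.
rewrite newtonS ncoef_oplus ncoefXM IH (ncoef_gt (size_newton q)).
by rewrite !mulr0 add0r addr0 mulr1 one_ominus.
Qed.

(** Multiplication by ['X] is triangular in the Newton basis with diagonal entry [y q], and nothing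
    below [newton q] is present to contribute. *)
Lemma ncoef_shift q i : ncoef q ((1 + beta%:P * 'X) ^+ i * newton q) = (1 + beta * y q) ^+ i.
Proof.
elim: i => [|i IH]; first by rewrite !expr0 mul1r ncoef_newton.
have low : (if q is q'.+1 then (1 + beta * y q') *
    ncoef q' ((1 + beta%:P * 'X) ^+ i * newton q) else 0) = 0.
  by case: q {IH} => // q; rewrite [_ * newton _]mulrC ncoef_newtonM_lt ?mulr0.
rewrite !exprS -mulrA; move: IH low; set S := _ * newton q => IH low.
rewrite mulrDl mul1r ncoefD -mulrA mul_polyC ncoefZ ncoefXM IH low.
by rewrite addr0; ring.
Qed.

Lemma Xn_newton d N : (d < N)%N -> 'X^d = \sum_(q < N) ncoefX d q *: newton q.
Proof.
elim: d N => [|d IH] [|N] //.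
  move=> _; rewrite big_ord_recl /= big1 ?addr0 => [|i _]; last by rewrite scale0r.
  by rewrite scale1r expr0 /newton big_ord0.
rewrite ltnS => lt_d; rewrite exprS (IH N lt_d) mulr_sumr.
have Xf q : 'X * newton q = y q *: newton q + (1 + beta * y q) *: newton q.+1.
  have := ominusK (ltn0Sn q); have := one_ominus (ltn0Sn q); rewrite newtonS.
  set Y := ominus _ _; set A := a q.+1; move: Y A (newton q) => Y A f.
  move=> /(congr1 polyC) e1 /(congr1 polyC) e2.
  move: e1 e2; rewrite scalerAl -!mul_polyC !(rmorphD, rmorphM, rmorph1, rmorph0) /= /oplus.
  move: Y%:P A%:P => {}Y {}A e1 e2; rewrite -mulrDl; congr (_ * _).
  have -> : Y + (1 + beta%:P * Y) * ('X + A + beta%:P * 'X * A) =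
    'X * ((1 + beta%:P * A) * (1 + beta%:P * Y)) + ((1 + beta%:P * A) * Y + A) by ring.
  by rewrite e1 e2 mulr1 addr0.
under eq_bigr => q _ do rewrite -scalerAr Xf scalerDr !scalerA.
under [RHS]eq_bigr => q _ do rewrite ncoefXS scalerDl.
rewrite !big_split /= [X in _ = X + _]big_ord_recr /= ncoefX_gt // mulr0 scale0r addr0.
rewrite [X in _ = _ + X]big_ord_recl /= scale0r add0r.
by congr (_ + _); apply: eq_bigr => q _; rewrite mulrC.
Qed.

Lemma poly_newton p N : (size p <= N)%N -> p = \sum_(q < N) ncoef q p *: newton q.
Proof.
move=> le_pN; rewrite -{1}[p]coefK poly_def.
under eq_bigr => d _ do rewrite (Xn_newton (leq_trans (ltn_ord d) le_pN)) scaler_sumr.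
rewrite exchange_big; apply: eq_bigr => q _; rewrite /ncoef scaler_suml.
by apply: eq_bigr => d _; rewrite scalerA.
Qed.

End Newton.

(** * Newton coefficients in several variables *)

Section Evaluation.

Variables (K : fieldType) (n : nat) (beta : K) (a : nat -> K).
Hypothesis a_unit : forall i, (0 < i)%N -> 1 + beta * a i != 0.
Local Notation P := {mpoly K[n]}.
Local Notation ncoef := (ncoef beta a).
Local Notation newton := (newton beta a).
Implicit Types (p : {poly K}) (Q : 'I_n -> nat).

Definition ev (i : 'I_n) (p : {poly K}) : P := (map_poly (@mpolyC n K) p).['X_i].

Lemma evM i p q : ev i (p * q) = ev i p * ev i q.
Proof. by rewrite /ev rmorphM hornerM. Qed.
Lemma evD i p q : ev i (p + q) = ev i p + ev i q.
Proof. by rewrite /ev rmorphD hornerD. Qed.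
Lemma evC i c : ev i c%:P = c%:MP.
Proof. by rewrite /ev map_polyC hornerC. Qed.
Lemma ev1 i : ev i 1 = 1. Proof. by rewrite -polyC1 evC. Qed.
Lemma evX i : ev i 'X = 'X_i. Proof. by rewrite /ev map_polyX hornerX. Qed.
Lemma evXn i m p : ev i (p ^+ m) = ev i p ^+ m.
Proof. by elim: m => [|m IH]; rewrite ?expr0 ?ev1 // !exprS evM IH. Qed.
Lemma evZ i c p : ev i (c *: p) = c *: ev i p.
Proof. by rewrite -mul_polyC evM evC mul_mpolyC. Qed.
Lemma ev_sum i I (r : seq I) (C : pred I) (F : I -> {poly K}) :
  ev i (\sum_(j <- r | C j) F j) = \sum_(j <- r | C j) ev i (F j).
Proof. by apply: (big_morph _ (evD i)); rewrite -polyC0 evC. Qed.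
Lemma ev_prod i I (r : seq I) (C : pred I) (F : I -> {poly K}) :
  ev i (\prod_(j <- r | C j) F j) = \prod_(j <- r | C j) ev i (F j).
Proof. exact: (big_morph _ (evM i) (ev1 i)). Qed.

Lemma evE i p N : (size p <= N)%N -> ev i p = \sum_(d < N) p`_d *: 'X_i ^+ d.
Proof.
move=> le_pN; rewrite -{1}[p]coefK poly_def ev_sum.
rewrite (big_ord_widen _ (fun d => ev i (p`_d *: 'X^d)) le_pN) big_mkcond.
apply: eq_bigr => d _; rewrite evZ evXn evX; case: ltnP => // ge_d.
by rewrite nth_default ?scale0r.
Qed.

Lemma msym_ev s i p : msym s (ev i p) = ev (s i) p.
Proof.
rewrite !(evE _ (leqnn _)) linear_sum; apply: eq_bigr => d _.
by rewrite linearZ /= rmorphXn /= msymXU.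
Qed.

(** The coefficient of the product of the [newton (Q i)] at ['X_i], read off linearly from the
    monomials so that no expansion has to be chosen. *)
Definition mcoefN (Q : 'I_n -> nat) (p : P) : K :=
  \sum_(m <- msupp p) p@_m * \prod_i ncoefX beta a (m i) (Q i).

Lemma mcoefNE Q (p : P) k : (msize p <= k)%N ->
  mcoefN Q p = \sum_(m : 'X_{1..n < k}) p@_m * \prod_i ncoefX beta a (m i) (Q i).
Proof.
move=> le_pk; pose I : subFinType _ := 'X_{1..n < k}.
rewrite /mcoefN (big_mksub I) ?msupp_uniq //=; last first.
  by move=> x /msize_mdeg_lt /leq_trans; apply.
by rewrite big_rmcond //= => m /memN_msupp_eq0 ->; rewrite mul0r.
Qed.

Lemma mcoefND Q (p q : P) : mcoefN Q (p + q) = mcoefN Q p + mcoefN Q q.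
Proof.
pose k := maxn (msize (p + q)) (maxn (msize p) (msize q)).
rewrite !(@mcoefNE Q _ k) /k; try by lia.
by rewrite -big_split; apply: eq_bigr => m _; rewrite mcoeffD mulrDl.
Qed.

Lemma mcoefNZ Q c (p : P) : mcoefN Q (c *: p) = c * mcoefN Q p.
Proof.
rewrite (@mcoefNE Q _ (msize p)) ?msizeZ_le // (@mcoefNE Q p (msize p)) //.
by rewrite mulr_sumr; apply: eq_bigr => m _; rewrite mcoeffZ mulrA.
Qed.

Lemma mcoefN_sum Q I (r : seq I) (C : pred I) (F : I -> P) :
  mcoefN Q (\sum_(j <- r | C j) F j) = \sum_(j <- r | C j) mcoefN Q (F j).
Proof. by apply: (big_morph _ (mcoefND Q)); rewrite /mcoefN msupp0 big_nil. Qed.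

Lemma mcoefN_prod Q (p : 'I_n -> {poly K}) :
  mcoefN Q (\prod_i ev i (p i)) = \prod_i ncoef (Q i) (p i).
Proof.
pose N := \max_i size (p i).
have le_N i : (size (p i) <= N)%N by exact: leq_bigmax.
have -> : \prod_i ev i (p i) = \prod_i \sum_(d < N) (p i)`_d *: 'X_i ^+ d.
  by apply: eq_bigr => i _; rewrite (evE _ (le_N i)).
have -> : \prod_i ncoef (Q i) (p i) =
    \prod_i \sum_(d < N) (p i)`_d * ncoefX beta a d (Q i).
  by apply: eq_bigr => i _; rewrite (ncoefE _ _ _ (le_N i)).
rewrite !bigA_distr_bigA mcoefN_sum; apply: eq_bigr => f _ /=.
rewrite scaler_prod mcoefNZ big_split /=; congr (_ * _).
pose m := [multinom (f i : nat) | i < n].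
have -> : \prod_i 'X_i ^+ f i = 'X_[m] :> P.
  by rewrite mpolyXE_id; apply: eq_bigr => i _; rewrite mnmE.
rewrite /mcoefN msuppX big_seq1 mcoeffX eqxx mul1r.
by apply: eq_bigr => i _; rewrite mnmE.
Qed.

Definition acoef (Q : 'I_n -> nat) (p : P) : K := mcoefN Q (alt p).

Lemma msym_prod_ev s (p : 'I_n -> {poly K}) :
  msym s (\prod_i ev i (p i)) = \prod_i ev i (p ((s^-1)%g i)).
Proof.
rewrite rmorph_prod [RHS](reindex_inj (@perm_inj _ s)) /=.
by apply: eq_bigr => i _; rewrite msym_ev permK.
Qed.

Lemma acoef_prod Q (p : 'I_n -> {poly K}) :
  acoef Q (\prod_i ev i (p i)) =
  \sum_(s : 'S_n) (-1) ^+ s * \prod_i ncoef (Q (s i)) (p i).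
Proof.
rewrite /acoef /alt mcoefN_sum; apply: eq_bigr => s _.
rewrite mcoefNZ msym_prod_ev mcoefN_prod; congr (_ * _).
rewrite (reindex_inj (@perm_inj _ s)) /=.
by apply: eq_bigr => i _; rewrite permK.
Qed.

Lemma acoefD Q (p q : P) : acoef Q (p + q) = acoef Q p + acoef Q q.
Proof. by rewrite /acoef altD mcoefND. Qed.
Lemma acoefZ Q c (p : P) : acoef Q (c *: p) = c * acoef Q p.
Proof. by rewrite /acoef altZ mcoefNZ. Qed.
Lemma acoef_alt0 Q (p : P) : alt p = 0 -> acoef Q p = 0.
Proof. by rewrite /acoef => ->; rewrite /mcoefN msupp0 big_nil. Qed.
Lemma acoef_sum Q I (r : seq I) (C : pred I) (F : I -> P) :
  acoef Q (\sum_(j <- r | C j) F j) = \sum_(j <- r | C j) acoef Q (F j).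
Proof. by apply: (big_morph _ (acoefD Q)); rewrite acoef_alt0 ?alt0. Qed.

Lemma perm_ge (s : 'S_n) (i : 'I_n) : exists2 i' : 'I_n, (i' <= i)%N & (i <= s i')%N.
Proof.
apply/exists_inP; apply: contraT; rewrite negb_exists_in => /forall_inP lt_s.
pose A := [set x : 'I_n | (x < i)%N].
have : #|[set s x | x in i |: A]| = #|A|.+1.
  by rewrite card_imset ?cardsU1 ?inE ?ltnn //; exact: perm_inj.
suff /subset_leq_card : [set s x | x in i |: A] \subset A by move=> h1 h2; move: h1; rewrite h2 ltnn.
apply/subsetP => _ /imsetP[x xA ->]; rewrite inE ltnNge; apply: lt_s.
by move: xA; rewrite !inE => /orP[/eqP->|/ltnW].
Qed.

Definition decreasing Q := forall i j : 'I_n, (i < j)%N -> (Q j < Q i)%N.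

(** By pigeonhole each term of the determinant has a row [i' <= i] with [i <= s i'], hence
    [Q (s i') <= Q i < T <= q i']; the Newton coefficient there is zero whatever the cofactor [R]
    is. *)
Lemma acoef_low Q (q : 'I_n -> nat) (R : 'I_n -> {poly K}) (i : 'I_n) T :
  decreasing Q -> (forall i' : 'I_n, (i' <= i)%N -> (T <= q i')%N) -> (Q i < T)%N ->
  acoef Q (\prod_r ev r (newton (q r) * R r)) = 0.
Proof.
move=> decQ le_T lt_T; rewrite acoef_prod big1 // => s _.
have [i' le_i' le_i] := perm_ge s i.
rewrite (bigD1 i') //= ncoef_newtonM_lt ?mul0r ?mulr0 //.
apply: leq_trans (le_T _ le_i'); apply: leq_ltn_trans lt_T.
by move: le_i; rewrite leq_eqVlt => /predU1P[/val_inj->|/decQ /ltnW].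
Qed.

(* Indices [r + c] of [a] are kept in [int] so that shifts are invertible; the
   negative ones are sent to [0], as truncated subtraction does in [Groth]. *)
Definition nat_int (z : int) : nat := if z is Posz t then t else 0%N.

Local Notation B := (fun z => a (nat_int z)).
Local Notation stair := (staircase n beta B).

Definition row_poly (q r : nat) : {poly K} := newton q * (1 + beta%:P * 'X) ^+ r.

Lemma ev_newton r q : ev r (newton q) = factors beta B r 1 q.
Proof.
rewrite /newton /factors ev_prod; apply: eq_bigr => u _.
by rewrite /oplus !(evD, evM, evC, evX).
Qed.

Lemma staircase_ev (rho : nat -> nat) :
  stair rho = \prod_(r < n) ev r (row_poly (rho r + (n.-1 - r)) r).
Proof.
apply: eq_bigr => r _; rewrite /row_poly evM ev_newton mulrC; congr (_ * _).
by rewrite evXn evD ev1 evM evC evX.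
Qed.

Lemma acoef_staircase_low Q (G : P) (rho : nat -> nat) (i : 'I_n) T :
  decreasing Q -> (forall i' : 'I_n, (i' <= i)%N -> (T <= rho i' + (n.-1 - i'))%N) ->
  (Q i < T)%N -> acoef Q (G * stair rho) = 0.
Proof.
move=> decQ le_T lt_T; rewrite [G]mpolyE mulr_suml acoef_sum big1 // => m _.
rewrite -scalerAl acoefZ staircase_ev mpolyXE_id -big_split /=.
rewrite (eq_bigr (fun r : 'I_n => ev r (newton (rho r + (n.-1 - r))
   * ((1 + beta%:P * 'X) ^+ r * 'X ^+ m r)))); last first.
  by move=> r _; rewrite /row_poly mulrA mulrC [RHS]evM evXn evX.
by rewrite (acoef_low _ decQ le_T) ?mulr0.
Qed.

Lemma ncoef_row_poly q r :
  ncoef q (row_poly q r) = (1 + beta * ominus beta (a q.+1)) ^+ r.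
Proof. by rewrite /row_poly mulrC ncoef_shift. Qed.

Lemma shift_unit q : 1 + beta * ominus beta (a q.+1) != 0.
Proof.
apply: contra_eq_neq (one_ominus a_unit (ltn0Sn q)) => ->.
by rewrite mulr0 eq_sym oner_neq0.
Qed.

Lemma sum_leq_eq (f g : 'I_n -> nat) : (forall i, f i <= g i)%N ->
  (\sum_i g i <= \sum_i f i)%N -> f =1 g.
Proof.
move=> le_fg le_gf i; apply/eqP; rewrite eqn_leq le_fg leqNgt; apply/negP => lt_fg.
suff : (\sum_i f i < \sum_i g i)%N by rewrite ltnNge le_gf.
rewrite (bigD1 i) //= [X in (_ < X)%N](bigD1 i) //= -addSn leq_add //.
by apply: leq_sum.
Qed.

Lemma decreasing_inj Q : decreasing Q -> injective Q.
Proof.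
move=> decQ i j eqQ; apply: val_inj; case: (ltngtP i j) => // /decQ; rewrite eqQ ltnn //.
Qed.

(** Every permutation but the identity lowers some exponent and contributes zero; the diagonal is a
    product of powers of the nonzero [1 + beta * ominus beta (a _)]. *)
Lemma acoef_staircase_unit (rho : nat -> nat) :
  decreasing (fun r => rho r + (n.-1 - r))%N ->
  acoef (fun r => rho r + (n.-1 - r))%N (stair rho) != 0.
Proof.
set Q := fun r => _ => decQ; rewrite staircase_ev acoef_prod (bigD1 1%g) //=.
rewrite [X in _ + X]big1 ?addr0 => [|s s1].
  rewrite odd_perm1 expr0 mul1r; apply/prodf_neq0 => r _.
  by rewrite perm1 ncoef_row_poly expf_neq0 // shift_unit.
have [i lt_i|ge_s] := pickP (fun i => Q (s i) < Q i)%N.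
  by rewrite (bigD1 i) //= ncoef_newtonM_lt ?mul0r ?mulr0.
have le_s i : (Q i <= Q (s i))%N by rewrite leqNgt ge_s.
case/eqP: s1; apply/permP => i; rewrite perm1; apply: (decreasing_inj decQ).
apply/esym/(sum_leq_eq le_s); rewrite [X in (_ <= X)%N](reindex_inj (@perm_inj _ s)) //.
Qed.

End Evaluation.

(** * Functionals dual to the alternants *)

Section Coefficient.

Variables (K : fieldType) (n : nat) (beta : K) (a : nat -> K).
Hypothesis a_unit : forall i, (0 < i)%N -> 1 + beta * a i != 0.
Local Notation P := {mpoly K[n]}.
Local Notation stair := (staircase n beta (fun z => a (nat_int z))).

Definition noninc (rho : nat -> nat) := forall i j, (i <= j)%N -> (rho j <= rho i)%N.

Lemma noninc_decreasing rho : noninc rho ->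
  decreasing (fun r : 'I_n => rho r + (n.-1 - r))%N.
Proof. by move=> rhoN i j lt_ij; have := rhoN i j (ltnW lt_ij); have := ltn_ord j; lia. Qed.

(* [phi] reads off a coefficient of an alternant; the last property makes it vanish
   on everything that does not fit into [nu]. *)
Definition coef_functional (nu : nat -> nat) (phi : P -> K) : Prop :=
  [/\ forall p q, phi (p + q) = phi p + phi q,
      forall c p, phi (c *: p) = c * phi p,
      forall p, alt p = 0 -> phi p = 0 &
      forall (G : P) (rho : nat -> nat) (i : 'I_n) T,
        (forall i' : 'I_n, (i' <= i)%N -> (T <= rho i' + (n.-1 - i'))%N) ->
        (nu i + (n.-1 - i) < T)%N -> phi (G * stair rho) = 0].

Let sz (rho : nat -> nat) := (\sum_(r < n) rho r)%N.

Lemma acoef_functional (sigma nu : nat -> nat) : noninc sigma ->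
  (forall r : 'I_n, (sigma r <= nu r)%N) ->
  coef_functional nu (acoef beta a (fun r : 'I_n => sigma r + (n.-1 - r))%N).
Proof.
move=> sigmaN le_nu; split=> [p q|c p|p|G rho i T le_T lt_T].
- exact: acoefD.
- exact: acoefZ.
- exact: acoef_alt0.
- apply: (acoef_staircase_low a_unit G (noninc_decreasing sigmaN) le_T).
  by apply: leq_ltn_trans lt_T; rewrite leq_add2r.
Qed.

Lemma acoef_eq0 (sigma lam : nat -> nat) : noninc sigma -> noninc lam ->
  (sz sigma <= sz lam)%N -> (exists r : 'I_n, lam r != sigma r) ->
  acoef beta a (fun r : 'I_n => sigma r + (n.-1 - r))%N (stair lam) = 0.
Proof.
move=> sigmaN lamN le_sz [r0 ne_r0].
have [i lt_i|ge_s] := pickP (fun i : 'I_n => sigma i < lam i)%N.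
  rewrite -[stair lam]mul1r.
  apply: (acoef_staircase_low a_unit (T := lam i + (n.-1 - i)) _ (noninc_decreasing sigmaN) (i := i)).
    by move=> i' le_i; have := lamN _ _ le_i; lia.
  by rewrite ltn_add2r.
have le_s (i : 'I_n) : (lam i <= sigma i)%N by rewrite leqNgt ge_s.
by have := sum_leq_eq le_s le_sz r0; move/eqP: ne_r0.
Qed.

Lemma coef_functional_lin nu phi I (r : seq I) (C : pred I) (c : I -> K) (psi : I -> P -> K) :
  coef_functional nu phi -> (forall i, C i -> coef_functional nu (psi i)) ->
  coef_functional nu (fun p => phi p - \sum_(i <- r | C i) c i * psi i p).
Proof.
move=> [phiD phiZ phi0 phiT] psiP; split.
- move=> p q; rewrite phiD (eq_bigr (fun i => c i * psi i p + c i * psi i q)).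
    by rewrite big_split opprD addrACA.
  by move=> i /psiP[-> _ _ _]; rewrite mulrDr.
- move=> d p; rewrite phiZ mulrBr mulr_sumr; congr (_ - _).
  by apply: eq_bigr => i /psiP[_ -> _ _]; rewrite mulrCA.
- move=> p p0; rewrite phi0 // big1 ?subr0 // => i /psiP[_ _ psi0 _].
  by rewrite psi0 ?mulr0.
- move=> G rho i T le_T lt_T; rewrite (phiT _ _ _ _ le_T) // big1 ?subr0 // => j /psiP[_ _ _ psiT].
  by rewrite (psiT _ _ _ _ le_T) ?mulr0.
Qed.

(** The powers of [1 + beta x] make [acoef] only triangular on the staircases, so [phi] is corrected
    in stages: stage [e] vanishes on the other shapes of size at least [sz nu - e], and the next
    stage subtracts multiples of [acoef] at the shapes one box smaller. Only shapes inside [nu] are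
    used, as the last property of [coef_functional] deals with the others and must survive the
    correction. *)
Lemma exists_coef (nu : nat -> nat) : noninc nu ->
  exists phi, [/\ coef_functional nu phi, phi (stair nu) = 1 &
    forall lam, noninc lam -> (exists r : 'I_n, lam r != nu r) -> phi (stair lam) = 0].
Proof.
move=> nuN.
suff [phi [phiP phi1 phi0]] : exists phi, [/\ coef_functional nu phi, phi (stair nu) = 1 &
    forall lam, noninc lam -> (exists r : 'I_n, lam r != nu r) ->
      (sz nu <= sz lam + sz nu)%N -> phi (stair lam) = 0].
  by exists phi; split=> // lam lamN ne; apply: phi0; rewrite ?leq_addl.
elim: {2}(sz nu) => [|e [phi [phiP phi1 phi0]]].
  pose ac := acoef beta a (fun r : 'I_n => nu r + (n.-1 - r))%N.
  have ac_neq0 : ac (stair nu) != 0.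
    exact: acoef_staircase_unit (noninc_decreasing nuN).
  have [acD acZ ac0 acT] := acoef_functional nuN (fun r => leqnn (nu r)).
  exists (fun p => (ac (stair nu))^-1 * ac p); split; last 2 first.
  - by rewrite mulVf.
  - move=> lam lamN ne; rewrite addn0 => le_sz.
    by rewrite [ac (stair lam)]acoef_eq0 ?mulr0.
  split=> [p q|c p|p p0|G rho i T le_T lt_T].
  - by rewrite [ac (_ + _)]acD mulrDr.
  - by rewrite [ac (_ *: _)]acZ mulrCA.
  - by rewrite [ac p]ac0 ?mulr0.
  - by rewrite [ac (_ * _)](acT _ _ _ _ le_T) ?mulr0.
(* All parts of a shape inside [nu] are at most [nu 0], so such shapes form a finite type over which
   the corrections can be summed. *)
pose ext (f : {ffun 'I_n -> 'I_(nu 0).+1}) (r : nat) : nat :=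
  if insub r is Some i then f i else 0%N.
have extE f (r : 'I_n) : ext f r = f r by rewrite /ext valK.
pose C (f : {ffun 'I_n -> 'I_(nu 0).+1}) :=
  [&& [forall i, f i <= nu i], [forall i : 'I_n, forall j : 'I_n, (i <= j) ==> (f j <= f i)]
    & sz (ext f) + e.+1 == sz nu]%N.
have CN f : C f -> noninc (ext f).
  case/and3P=> _ /forallP fN _ i j le_ij; rewrite /ext.
  case: (insubP _ j) => //= j' lt_j jE.
  case: (insubP _ i) => [i' lt_i iE|]; last by rewrite (leq_ltn_trans le_ij).
  by have /forallP/(_ j')/implyP := fN i'; apply; rewrite iE jE.
have Cnu f : C f -> forall r : 'I_n, (ext f r <= nu r)%N.
  by case/and3P=> /forallP fN _ _ r; rewrite extE.
pose ac f := acoef beta a (fun r : 'I_n => ext f r + (n.-1 - r))%N.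
have ac_neq0 f : C f -> ac f (stair (ext f)) != 0.
  by move=> Cf; apply: acoef_staircase_unit (noninc_decreasing (CN f Cf)).
exists (fun p => phi p - \sum_(f | C f) (phi (stair (ext f)) / ac f (stair (ext f))) * ac f p).
split.
- apply: coef_functional_lin => // f Cf; apply: acoef_functional; [exact: CN|exact: Cnu].
- rewrite phi1 big1 ?subr0 // => f Cf; rewrite [ac f (stair nu)]acoef_eq0 ?mulr0 //; first exact: CN.
    by case/and3P: Cf => _ _ /eqP; lia.
  have [/existsP//|] := boolP [exists r : 'I_n, nu r != ext f r].
  rewrite negb_exists => /forallP eq_nu; case/and3P: Cf => _ _ /eqP.
  suff -> : sz (ext f) = sz nu by lia.
  by apply: eq_bigr => r _; apply/eqP; rewrite eq_sym; have := eq_nu r; rewrite negbK.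
move=> lam lamN ne_nu le_sz.
have [lt_sz|ge_sz] := leqP (sz nu) (sz lam + e).
  rewrite phi0 // big1 ?subr0 // => f Cf.
  rewrite [ac f (stair lam)]acoef_eq0 ?mulr0 //; first exact: CN.
    by case/and3P: Cf => _ _ /eqP; lia.
  have [/existsP//|] := boolP [exists r : 'I_n, lam r != ext f r].
  rewrite negb_exists => /forallP eq_nu; case/and3P: Cf => _ _ /eqP.
  suff -> : sz (ext f) = sz lam by lia.
  by apply: eq_bigr => r _; apply/eqP; rewrite eq_sym; have := eq_nu r; rewrite negbK.
have {le_sz ge_sz} szE : (sz lam + e.+1 = sz nu)%N by lia.
have neC f : C f -> [exists r : 'I_n, lam r != ext f r] -> ac f (stair lam) = 0.
  move=> Cf /existsP ne; apply: acoef_eq0 => //; first exact: CN.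
  by case/and3P: Cf => _ _ /eqP; lia.
have [i lt_i|ge_nu] := pickP (fun i : 'I_n => nu i < lam i)%N.
  have [_ _ _ phiT] := phiP; rewrite -{1}[stair lam]mul1r.
  rewrite (phiT _ _ i (lam i + (n.-1 - i))%N) ?ltn_add2r //; last first.
    by move=> i' le_i; have := lamN _ _ le_i; lia.
  rewrite big1 ?subr0 // => f Cf; rewrite neC ?mulr0 //.
  apply/existsP; exists i; apply/eqP => eq_i.
  by have := Cnu f Cf i; rewrite -eq_i leqNgt lt_i.
have le_nu (i : 'I_n) : (lam i <= nu i)%N by rewrite leqNgt ge_nu.
(* A shape of the current size inside [nu] is one of the [f]; only its own correction is nonzero on
   it, and that one was chosen to cancel [phi]. *)
pose f0 : {ffun 'I_n -> 'I_(nu 0).+1} := [ffun i : 'I_n => inord (lam i)].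
have f0E (r : 'I_n) : f0 r = lam r :> nat.
  by rewrite ffunE inordK // ltnS (leq_trans (le_nu r)) // nuN.
have ext0 (r : 'I_n) : ext f0 r = lam r by rewrite extE f0E.
have stairE : stair (ext f0) = stair lam by apply: eq_bigr => r _; rewrite ext0.
have Cf0 : C f0.
  apply/and3P; split; first by apply/forallP => i; rewrite f0E.
    apply/forallP => i; apply/forallP => j; apply/implyP => le_ij.
    by rewrite !f0E lamN.
  by apply/eqP; rewrite -szE; congr (_ + _)%N; apply: eq_bigr => r _; rewrite ext0.
rewrite (bigD1 f0) //= big1 ?addr0; last first.
  move=> f /andP[Cf ff0]; rewrite neC ?mulr0 //; apply: contraR ff0.
  rewrite negb_exists => /forallP eq_f; apply/eqP/ffunP => r; apply: val_inj => /=.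
  by have := eq_f r; rewrite negbK extE f0E => /eqP.
by rewrite stairE divfK ?subrr // -stairE ac_neq0.
Qed.

End Coefficient.

(** * Partitions and weakly decreasing functions *)

Lemma geq_trans : transitive geq.
Proof. by move=> y x z xy yz; exact: leq_trans yz xy. Qed.

Lemma part_noninc (s : intpart) : noninc (nth 0%N s).
Proof.
case: s => s /= /andP[s_sorted _] i j le_ij.
have [lt_j|ge_j] := ltnP j (size s); last by rewrite [X in (X <= _)%N]nth_default.
apply: (sorted_leq_nth geq_trans leqnn 0%N s_sorted) => //.
by rewrite inE (leq_ltn_trans le_ij).
Qed.

Lemma nth_filter_neq0 (s : seq nat) i : sorted geq s ->
  nth 0%N [seq x <- s | x != 0%N] i = nth 0%N s i.
Proof.
elim: s i => // x s IH i s_sorted /=; have [x0|x_gt0] := posnP x; last first.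
  by case: i => // i; rewrite /= IH //; exact: path_sorted s_sorted.
have s0 : all (pred1 0%N) s.
  apply/allP => y ys; move: s_sorted; rewrite x0 /= path_sortedE.
    by case/andP=> /allP/(_ y ys); rewrite /= leqn0.
  exact: geq_trans.
have -> : [seq x <- s | x != 0%N] = [::].
  by apply/eqP; rewrite -(negbK (_ == _)) -has_filter -all_predC; apply/allP => y /(allP s0) /= ->.
rewrite nth_nil; case: i => [|i] /=; first by rewrite x0.
have [lt_i|ge_i] := ltnP i (size s); last by rewrite nth_default.
by apply/esym/eqP; exact: (allP s0) (mem_nth _ lt_i).
Qed.

Lemma exists_part (lam : nat -> nat) N : noninc lam ->
  exists2 s : intpart, (size s <= N)%N & forall i, (i < N)%N -> nth 0%N s i = lam i.
Proof.
move=> lamN; have lam_sorted : sorted geq (mkseq lam N).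
  by apply/(sortedP 0%N) => i; rewrite size_mkseq => lt_i; rewrite !nth_mkseq ?(ltnW lt_i) //; exact: lamN.
have sP : is_partition [seq x <- mkseq lam N | x != 0%N].
  rewrite /is_partition mem_filter eqxx andbT sorted_filter //; exact: geq_trans.
exists (IntPart sP) => [|i lt_i] /=.
  by rewrite size_filter (leq_trans (count_size _ _)) // size_mkseq.
by rewrite nth_filter_neq0 // nth_mkseq.
Qed.

(** * Spanning the alternating polynomials *)

Section Span.

Variables (K : fieldType) (n : nat) (beta : K) (a : nat -> K).
Hypothesis n_gt0 : (0 < n)%N.
Hypothesis a_unit : forall i, (0 < i)%N -> 1 + beta * a i != 0.
Local Notation P := {mpoly K[n]}.
Local Notation stair := (staircase n beta (fun z => a (nat_int z))).
Local Notation newton := (newton beta a).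
Local Notation ncoef := (ncoef beta a).

Definition alt_span (p : P) : Prop :=
  exists2 s : seq (K * intpart), forall z, z \in s -> (size z.2 <= n)%N &
    p = \sum_(z <- s) z.1 *: alt (stair (nth 0%N z.2)).

Lemma alt_span0 : alt_span 0.
Proof. by exists [::]; rewrite ?big_nil. Qed.

Lemma alt_spanD p q : alt_span p -> alt_span q -> alt_span (p + q).
Proof.
move=> [s sn ->] [t tn ->]; exists (s ++ t); last by rewrite big_cat.
by move=> z; rewrite mem_cat => /orP[/sn|/tn].
Qed.

Lemma alt_spanZ c p : alt_span p -> alt_span (c *: p).
Proof.
move=> [s sn ->]; exists [seq (c * z.1, z.2) | z <- s].
  by move=> _ /mapP[z /sn zn ->].
by rewrite scaler_sumr big_map; apply: eq_bigr => z _; rewrite scalerA.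
Qed.

Lemma alt_span_sum I (r : seq I) (C : pred I) (F : I -> P) :
  (forall i, C i -> alt_span (F i)) -> alt_span (\sum_(i <- r | C i) F i).
Proof.
move=> FS; elim/big_ind: _ => //; [exact: alt_span0|exact: alt_spanD].
Qed.

Lemma prod_ev_newton N (p : 'I_n -> {poly K}) : (forall i, size (p i) <= N)%N ->
  \prod_i ev i (p i) = \sum_(f : {ffun 'I_n -> 'I_N})
    (\prod_i ncoef (f i) (p i)) *: \prod_i ev i (newton (f i)).
Proof.
move=> le_N.
have -> : \prod_i ev i (p i) =
    \prod_i \sum_(q < N) ncoef q (p i) *: ev i (newton q).
  apply: eq_bigr => i _; rewrite {1}(poly_newton a_unit (le_N i)) ev_sum.
  by apply: eq_bigr => q _; rewrite evZ.
by rewrite bigA_distr_bigA; apply: eq_bigr => f _; rewrite scaler_prod.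
Qed.

Lemma alt_msym (s : 'S_n) (p : P) : alt (msym s p) = (-1) ^+ s *: alt p.
Proof.
rewrite /alt (reindex_inj (mulgI s^-1%g)) /= scaler_sumr; apply: eq_bigr => t _.
by rewrite -msymMm mulKVg odd_permM odd_permV signr_addb scalerA.
Qed.

Lemma exists_sorting N (f : {ffun 'I_n -> 'I_N}) : injective f ->
  exists s : 'S_n, decreasing (fun i => f (s i) : nat).
Proof.
move=> f_inj; pose t := [tuple (f i : nat) | i < n].
have /tuple_permP[s sE] : perm_eq (sort geq t) t by rewrite perm_sort.
exists s => i j lt_ij.
have nthE (k : 'I_n) : nth 0%N (sort geq t) k = f (s k).
  by rewrite sE -tnth_nth !tnth_mktuple.
have ge_sort : sorted geq (sort geq t).
  by apply: sort_sorted => x y; exact: leq_total.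
have sz : size (sort geq t) = n by rewrite size_sort size_tuple.
rewrite ltn_neqAle; apply/andP; split.
  apply/eqP => /val_inj /f_inj /perm_inj ji; by rewrite ji ltnn in lt_ij.
rewrite -!nthE; apply: (sorted_leq_nth geq_trans leqnn 0%N ge_sort); rewrite ?inE ?sz //.
exact: ltnW.
Qed.

(** For decreasing exponents [g], the alternant of a staircase is a nonzero multiple of this
    alternant plus others with a larger sum of exponents. The induction ends because [N] is never
    exceeded: strict decrease gives [g r + r < N], and [g r + r] bounds the degree of row [r]. *)
Lemma alt_span_newton N (f : {ffun 'I_n -> 'I_N}) :
  alt_span (alt (\prod_i ev i (newton (f i)))).
Proof.
(* [e] bounds the distance to the sum [n * N], which exponents below [N] cannot attain since [n] is
   positive. *)
have [e le_e] : exists e, (n * N <= \sum_i f i + e)%N by exists (n * N)%N; exact: leq_addl.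
elim: e f le_e => [|e IH] f le_e.
  exfalso; move: le_e; rewrite addn0 leqNgt => /negP; apply.
  have -> : (n * N = \sum_(i < n) N)%N by rewrite sum_nat_const card_ord.
  rewrite (bigD1 (Ordinal n_gt0)) //= [X in (_ < X)%N](bigD1 (Ordinal n_gt0)) //= -addSn.
  by rewrite leq_add ?ltn_ord //; apply: leq_sum => i _; exact: ltnW.
have [/injectiveP f_inj|/injectivePn[i [j ij fij]]] := boolP (injectiveb f); last first.
  rewrite (@alt_swap _ _ i j) //; first exact: alt_span0.
  rewrite msym_prod_ev tpermV; apply: eq_bigr => k _; congr (ev k (newton _)).
  by case: tpermP => [->|->|//]; rewrite fij.
have [s decs] := exists_sorting f_inj.
pose g := [ffun i => f (s i)].
have -> : \prod_i ev i (newton (f i)) = msym s (\prod_i ev i (newton (g i))).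
  by rewrite msym_prod_ev; apply: eq_bigr => i _; rewrite ffunE permKV.
rewrite alt_msym; apply: alt_spanZ.
have {decs} decg : decreasing (fun i => g i : nat).
  by move=> i j lt_ij; rewrite !ffunE; exact: decs.
have sumg : (\sum_i g i = \sum_i f i)%N.
  by rewrite [RHS](reindex_inj (@perm_inj _ s)); apply: eq_bigr => i _; rewrite ffunE.
rewrite -{}sumg in le_e; move: g decg le_e => {s f_inj f} g decg le_e.
have g_ge (i : 'I_n) : (n.-1 - i <= g i)%N.
  suff g_ge d (j : 'I_n) : (n.-1 - j = d)%N -> (d <= g j)%N by exact: g_ge.
  elim: d j => // d IHd j jd.
  have lt_j : (j.+1 < n)%N by lia.
  have dE : (n.-1 - Ordinal lt_j)%N = d by rewrite /=; lia.
  by apply: leq_ltn_trans (IHd _ dE) (decg _ _ _).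
have g_le (i : 'I_n) : (g i + i < N)%N.
  case: i => i lt_i; elim: i lt_i => [|i IHi] lt_i; first by rewrite addn0.
  have lt_i' : (i < n)%N by exact: ltnW.
  have lt_g : (g (Ordinal lt_i) < g (Ordinal lt_i'))%N by exact: decg.
  by apply: leq_ltn_trans (IHi lt_i'); rewrite /= addnS -addSn leq_add2r.
have g_step d (i j : 'I_n) : (j = i + d :> nat)%N -> (g j + j <= g i + i)%N.
  elim: d j => [|d IHd] j jE; first by rewrite (_ : j = i) //; apply: val_inj; rewrite /= jE addn0.
  have lt_j : (j.-1 < n)%N by rewrite (leq_ltn_trans (leq_pred j)).
  have jE' : Ordinal lt_j = (i + d)%N :> nat by rewrite /= jE addnS.
  apply: leq_trans (IHd _ jE'); have jS : j = (Ordinal lt_j).+1 :> nat by rewrite jE' jE addnS.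
  have := decg (Ordinal lt_j) j; move: (Ordinal lt_j) jS => j' jS.
  by rewrite jS addnS -addSn leq_add2r; apply.
pose lam0 (r : nat) := if insub r is Some i then (g i - (n.-1 - i))%N else 0%N.
have lam0E (r : 'I_n) : lam0 r = (g r - (n.-1 - r))%N by rewrite /lam0 valK.
have sub_le (x y : 'I_n) : (g y + y <= g x + x)%N ->
    (g y - (n.-1 - y) <= g x - (n.-1 - x))%N.
  by have := g_ge x; have := g_ge y; have := ltn_ord x; have := ltn_ord y; lia.
have lam0N : noninc lam0.
  move=> i j le_ij; rewrite /lam0; case: (insubP _ j) => //= j' lt_j jE.
  case: (insubP _ i) => [i' lt_i iE|]; last by rewrite (leq_ltn_trans le_ij).
  move: le_ij; rewrite -iE -jE leq_eqVlt => /predU1P[/val_inj->//|lt_ij].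
  have := g_step (j' - i')%N i' j'; rewrite subnKC ?(ltnW lt_ij) // => /(_ erefl).
  exact: sub_le.
have [lam lam_n lamE] := exists_part n lam0N.
have topE (r : 'I_n) : (nth 0 lam r + (n.-1 - r))%N = g r.
  by rewrite lamE // lam0E subnK.
have stairE : stair (nth 0%N lam) = \prod_r ev r (row_poly beta a (g r) r).
  by rewrite staircase_ev; apply: eq_bigr => r _; rewrite topE.
have sz_row (r : 'I_n) : (size (row_poly beta a (g r) r) <= N)%N.
  rewrite /row_poly (leq_trans (size_polyMleq _ _)) //.
  have := size_newton beta a (g r); have := size_poly_exp_leq (1 + beta%:P * 'X : {poly K}) r.
  have : (size (1 + beta%:P * 'X : {poly K})%R <= 2)%N.
    apply/leq_sizeP => j lt_j; rewrite coefD coef1 coefCM coefX.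
    by case: j lt_j => [|[|j]] //= _; rewrite mulr0 addr0.
  have := g_le r; move: (size _) (size _) (size _) => s1 s2 s3; nia.
have altE := congr1 (@alt K n) (prod_ev_newton sz_row).
rewrite -stairE alt_sum (bigD1 g) //= in altE.
set u := \prod_i ncoef (g i) _ in altE.
have u_neq0 : u != 0.
  by apply/prodf_neq0 => r _; rewrite ncoef_row_poly // expf_neq0 // shift_unit.
have -> : alt (\prod_i ev i (newton (g i))) = u^-1 *: (alt (stair (nth 0%N lam)) +
   - 1 *: \sum_(f : {ffun 'I_n -> 'I_N} | f != g)
    alt ((\prod_i ncoef (f i) (row_poly beta a (g i) i)) *: \prod_i ev i (newton (f i)))).
  by rewrite altE altZ scaleN1r addrK scalerA mulVf // scale1r.
apply: alt_spanZ; apply: alt_spanD.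
  exists [:: (1, lam)]; first by move=> z; rewrite inE => /eqP->.
  by rewrite big_seq1 scale1r.
apply: alt_spanZ; apply: alt_span_sum => f fg; rewrite altZ.
have [i lt_i|ge_g] := pickP (fun i => f i < g i)%N.
  by rewrite (bigD1 i) //= ncoef_newtonM_lt // mul0r scale0r; exact: alt_span0.
apply: alt_spanZ; apply: IH.
have le_g i : (g i <= f i)%N by rewrite leqNgt ge_g.
suff lt_gf : (\sum_i g i < \sum_i f i)%N.
  by apply: leq_trans le_e _; rewrite addnS -addSn leq_add2r.
rewrite ltnNge; apply: contra fg => le_f; apply/eqP/ffunP => i; apply: val_inj.
by rewrite /= -(sum_leq_eq le_g le_f).
Qed.

Lemma alt_spanP (p : P) : alt_span (alt p).
Proof.
rewrite [p]mpolyE alt_sum; apply: alt_span_sum => m _; rewrite altZ; apply: alt_spanZ.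
have -> : 'X_[m] = \prod_i ev i ('X^(m i)) :> P.
  by rewrite mpolyXE_id; apply: eq_bigr => i _; rewrite evXn evX.
rewrite (@prod_ev_newton (\max_i m i).+1); last first.
  by move=> i; rewrite size_polyXn ltnS leq_bigmax.
rewrite alt_sum; apply: alt_span_sum => f _; rewrite altZ; apply: alt_spanZ.
exact: alt_span_newton.
Qed.

End Span.

(** * Reading words and cancelling in pairs *)

Section Reading.

Variable n : nat.
Local Notation New := (Some true).
Local Notation Ext := (Some false).

(* The state of the reading consists of the boxes already read and the current
   box; entries of a box are read in decreasing order. *)
Definition read_step (c : cword n) (st : seq 'I_n * seq 'I_n) (r : 'I_n) :=
  match c r with
  | None => st
  | Some true => (st.1 ++ st.2, [:: r])
  | Some false => (st.1, r :: st.2)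
  end.

Definition reading (c : cword n) : seq 'I_n :=
  let st := foldl (read_step c) ([::], [::]) (enum 'I_n) in st.1 ++ st.2.

(** Later letters treat the box in progress as a block [C]: those that still extend it are read
    before it, in [s], and the boxes opened afterwards follow in [t]. *)
Lemma foldl_read_tail (c : cword n) es : exists s t : seq 'I_n,
  {subset s ++ t <= es} /\
  forall D C, let st := foldl (read_step c) (D, C) es in st.1 ++ st.2 = D ++ s ++ C ++ t.
Proof.
elim: es => [|r es [s [t [sub IH]]]]; first by exists [::], [::]; split=> // D C; rewrite /= cats0.
case cr: (c r) => [[]|].
- exists [::], (s ++ r :: t); split=> [x|D C].
    rewrite /= mem_cat inE in_cons orbCA => /orP[->//|xst].
    by rewrite (sub x) ?orbT // mem_cat.
  by rewrite /= /read_step cr /= IH -!catA.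
- exists (rcons s r), t; split=> [x|D C].
    rewrite cat_rcons mem_cat !in_cons orbCA => /orP[->//|xst].
    by rewrite (sub x) ?orbT // mem_cat.
  by rewrite /= /read_step cr /= IH cat_rcons.
exists s, t; split=> [x /sub|D C]; first by rewrite in_cons => ->; rewrite orbT.
by rewrite /= /read_step cr IH.
Qed.

Lemma foldl_read_sub (c : cword n) es D C :
  {subset (foldl (read_step c) (D, C) es).1 ++ (foldl (read_step c) (D, C) es).2
     <= D ++ C ++ es}.
Proof.
have [s [t [sub ->]]] := foldl_read_tail c es => x.
rewrite !mem_cat => /or4P[->|xs|->|xt]; rewrite ?orbT //.
  by rewrite (sub x) ?orbT // mem_cat xs.
by rewrite (sub x) ?orbT // mem_cat xt orbT.
Qed.

Lemma eq_foldl_read (c c' : cword n) es st : {in es, c =1 c'} ->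
  foldl (read_step c) st es = foldl (read_step c') st es.
Proof.
elim: es st => //= r es IH st eq_c.
have -> : read_step c' st r = read_step c st r by rewrite /read_step eq_c ?mem_head.
by rewrite -IH // => x xs; rewrite eq_c // in_cons xs orbT.
Qed.

Section ReadWindow.

Variables (k k1 : 'I_n).
Hypothesis k1E : k1 = k.+1 :> nat.

Lemma enum_split : exists es1 es2 : seq 'I_n,
  [/\ enum 'I_n = es1 ++ k :: k1 :: es2,
      {in es1, forall x, (x != k) && (x != k1)} & {in es2, forall x, (x != k) && (x != k1)}].
Proof.
have sz : size (enum 'I_n) = n by rewrite size_enum_ord.
have eE : enum 'I_n = take k (enum 'I_n) ++ k :: k1 :: drop k.+2 (enum 'I_n).
  have d2 : drop k.+1 (enum 'I_n) = k1 :: drop k.+2 (enum 'I_n).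
    by rewrite -k1E (drop_nth k) ?sz ?ltn_ord // nth_ord_enum.
  rewrite -{1}(cat_take_drop k (enum 'I_n)) (drop_nth k) ?sz ?ltn_ord //.
  by rewrite nth_ord_enum d2.
move: (take _ _) (drop _ _) eE => es1 es2 eE; exists es1, es2; split=> //.
all: have := enum_uniq 'I_n; rewrite eE cat_uniq !cons_uniq.
all: case/and3P=> _ /hasPn h1 /and3P[k_2 k1_2 _] x xs.
all: apply/andP; split; apply/eqP => xE; subst x.
- by have := h1 k; rewrite mem_head xs => /(_ isT).
- by have := h1 k1; rewrite in_cons mem_head orbT xs => /(_ isT).
- by rewrite in_cons xs orbT in k_2.
- by rewrite xs in k1_2.
Qed.

Definition avoids (w : seq 'I_n) : bool := all (fun x => (x != k) && (x != k1)) w.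

Lemma reading_window (c : cword n) : c k = None -> c k1 = None ->
  exists D C s t, [/\ avoids (D ++ C ++ s ++ t) &
    let rd p q := reading (upd k k1 c p q) in
    [/\ rd None New = D ++ C ++ s ++ k1 :: t,
        rd New Ext = D ++ C ++ s ++ k1 :: k :: t,
        rd None Ext = D ++ s ++ k1 :: C ++ t &
        [/\ rd Ext Ext = D ++ s ++ k1 :: k :: C ++ t,
        rd New New = D ++ C ++ k :: s ++ k1 :: t,
        rd Ext New = D ++ k :: C ++ s ++ k1 :: t &
        forall p, k1 \notin rd p None]]].
Proof.
move=> ck ck1.
have ne_k : k != k1 by rewrite -val_eqE /= k1E neq_ltn ltnSn.
have [es1 [es2 [eE av1 av2]]] := enum_split.
have upd1 p q : {in es1, upd k k1 c p q =1 c}.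
  by move=> x /av1 /andP[xk xk1]; rewrite ffunE (negPf xk) (negPf xk1).
have upd2 p q : {in es2, upd k k1 c p q =1 c}.
  by move=> x /av2 /andP[xk xk1]; rewrite ffunE (negPf xk) (negPf xk1).
have rdE p q : reading (upd k k1 c p q) = let st :=
    foldl (read_step c) (read_step (upd k k1 c p q) (read_step (upd k k1 c p q)
      (foldl (read_step c) ([::], [::]) es1) k) k1) es2 in st.1 ++ st.2.
  by rewrite /reading eE foldl_cat /= (eq_foldl_read _ (@upd1 p q)) (eq_foldl_read _ (@upd2 p q)).
have uk p q : upd k k1 c p q k = p by rewrite ffunE eqxx.
have uk1 p q : upd k k1 c p q k1 = q by rewrite ffunE eqxx (eq_sym k1) (negPf ne_k).
have avDC := @foldl_read_sub c es1 [::] [::].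
case: (foldl _ _ es1) rdE avDC => D C /= rdE avDC.
have [s [t [sub tailE]]] := foldl_read_tail c es2.
have av : avoids (D ++ C ++ s ++ t).
  apply/allP => x; rewrite catA mem_cat => /orP[/avDC|/sub]; [exact: av1|exact: av2].
exists D, C, s, t; split=> //=.
split; try by rewrite rdE /read_step uk uk1 /= tailE -?catA.
split; try by rewrite rdE /read_step uk uk1 /= tailE -?catA.
move=> p; rewrite rdE.
have k1av w : avoids w -> k1 \notin w.
  by move=> /allP aw; apply/negP => /aw; rewrite eqxx andbF.
move: av; rewrite /avoids !all_cat => /and4P[aD aC as_ at_].
have [kD kC ks kt] := And4 (k1av _ aD) (k1av _ aC) (k1av _ as_) (k1av _ at_).
rewrite /read_step uk uk1; case: p => [[]|] /=; rewrite tailE !mem_cat ?in_cons;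
  by rewrite ?(eq_sym k1) ?(negPf ne_k) (negPf kD) (negPf kC) (negPf ks) (negPf kt) ?in_nil.
Qed.

End ReadWindow.

Definition extras (c : cword n) : nat := \sum_(r < n) (c r == Ext).

Lemma extras_upd (k k1 : 'I_n) (c : cword n) p q : k != k1 -> c k = None -> c k1 = None ->
  extras (upd k k1 c p q) = (extras c + (p == Ext) + (q == Ext))%N.
Proof.
move=> ne_k ck ck1; rewrite /extras (bigD1 k) //= (bigD1 k1) //= 1?eq_sym //.
rewrite [in RHS](bigD1 k) //= [in RHS](bigD1 k1) //= 1?eq_sym // ck ck1 /=.
rewrite !ffunE !eqxx (eq_sym k1) (negPf ne_k) !add0n.
rewrite (eq_bigr (fun i => c i == Ext : nat)); first by rewrite addnA addnC addnA.
by move=> i /andP[ik ik1]; rewrite ffunE (negPf ik) (negPf ik1).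
Qed.

End Reading.

Lemma incr_nth_partition (rho : seq nat) k : is_partition rho ->
  ((0 < k)%N -> (nth 0 rho k < nth 0 rho k.-1)%N) -> is_partition (incr_nth rho k).
Proof.
move=> rhoP lt_k; have rhoN := part_noninc (IntPart rhoP).
have /andP[_ rho0] := rhoP.
apply/andP; split.
  apply/(sortedP 0%N) => i _; rewrite !nth_incr_nth /=.
  have := rhoN i i.+1 (leqnSn i); rewrite /= => le_i.
  case: (eqVneq k i.+1) => [ki|_]; last by case: (k == i); lia.
  by have := lt_k; rewrite ki /= => /(_ isT); case: (i.+1 == i); lia.
apply/negP => /(nthP 0%N)[i]; rewrite size_incr_nth nth_incr_nth => lt_i /eqP.
rewrite addn_eq0 eqb0 => /andP[ki /eqP i0].
have lt_is : (i < size rho)%N.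
  rewrite ltnNge; apply/negP => ge_i; move: lt_i; case: ifP => [_|_].
    by rewrite ltnNge ge_i.
  rewrite ltnS leq_eqVlt eq_sym (negPf ki) /= => lt_ik.
  have := lt_k (leq_ltn_trans (leq0n i) lt_ik).
  by rewrite [X in (_ < X)%N]nth_default ?ltn0 //; lia.
by case/negP: rho0; rewrite -i0 mem_nth.
Qed.

(** * Multiplying a staircase by one letter *)

Section Transition.

Variables (K : fieldType) (n : nat) (beta : K) (a : nat -> K).
Hypothesis a_unit : forall i, (0 < i)%N -> 1 + beta * a i != 0.

Local Notation P := {mpoly K[n]}.
Local Notation bt := (beta%:MP : P).
Local Notation New := (Some true).
Local Notation Ext := (Some false).
Local Notation stair rho := (staircase n beta (fun z => a (nat_int z)) (nth 0%N rho)).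
Local Notation y := (a_part beta a).

(* The sum over all choices of barred letters in [u] along which [rho] stays a partition. *)
Fixpoint run (u : seq 'I_n) (rho : seq nat) (kap : seq nat -> K) : K :=
  if u is r :: u' then
    y rho r * run u' rho kap +
    (if is_partition (incr_nth rho r) then
       (1 + beta * y rho r) * run u' (incr_nth rho r) kap else 0)
  else kap rho.

Lemma run_cat u v rho kap : run (u ++ v) rho kap = run u rho (fun rho' => run v rho' kap).
Proof. by elim: u rho => //= r u IH rho; rewrite !IH. Qed.

Lemma run_lin u rho kap kap' c :
  run u rho (fun rho' => kap rho' + c * kap' rho') = run u rho kap + c * run u rho kap'.
Proof.
elim: u rho => //= r u IH rho; rewrite !IH; case: ifP => _; ring.
Qed.

Lemma run_eq (Inv : seq nat -> Prop) (u : seq 'I_n) rho kap kap' :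
  (forall rho (r : 'I_n), r \in u -> Inv rho -> is_partition (incr_nth rho r) -> Inv (incr_nth rho r)) ->
  (forall rho, Inv rho -> kap rho = kap' rho) -> Inv rho ->
  run u rho kap = run u rho kap'.
Proof.
elim: u rho => [|r u IH] rho InvS Invk Inv0 /=; first exact: Invk.
have InvS' rho' r' : r' \in u -> Inv rho' -> is_partition (incr_nth rho' r') ->
    Inv (incr_nth rho' r').
  by move=> ru; apply: InvS; rewrite in_cons ru orbT.
rewrite IH //; case: ifP => // part_r; congr (_ + _ * _); apply: IH => //.
by apply: InvS; rewrite ?mem_head.
Qed.

Lemma run0 u rho : run u rho (fun=> 0) = 0.
Proof. by elim: u rho => //= r u IH rho; rewrite !IH !mulr0 add0r; case: ifP. Qed.

Definition mono (u : seq 'I_n) : P := \prod_(r <- u) 'X_r.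

(** If [a t] is the parameter of the next factor of row [r], this is the identity x = (⊖ a_t) ⊕ (x ⊕
    a_t). It holds for shapes that are not partitions as well. *)
Lemma staircase_mulX (rho : seq nat) (r : 'I_n) :
  'X_r * stair rho = y rho r *: stair rho + (1 + beta * y rho r) *: stair (incr_nth rho r).
Proof.
rewrite /staircase /rows (bigD1 r) //= [in X in _ = _ + X](bigD1 r) //=.
set S := \prod_(_ | _) _; set S' := \prod_(_ | _) _.
have -> : S' = S.
  by apply: eq_bigr => i ir; rewrite nth_incr_nth val_eqE eq_sym (negPf ir).
rewrite nth_incr_nth eqxx add1n addSn factorsSr /nat_int /=.
have -> : (1 + (nth 0 rho r + (n.-1 - r)) = n - r + nth 0 rho r)%N by have := ltn_ord r; lia.
rewrite /y; set t := (n - r + _)%N; have t_gt0 : (0 < t)%N by have := ltn_ord r; rewrite /t; lia.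
have e1 := congr1 (@mpolyC n K) (ominusK a_unit t_gt0).
have e2 := congr1 (@mpolyC n K) (one_ominus a_unit t_gt0).
move: (ominus _ _) e1 e2 => Y; rewrite -!mul_mpolyC !(rmorphD, rmorphM, rmorph1, rmorph0) /=.
move: Y%:MP (a t)%:MP => {}Y A e1 e2; rewrite /oplus.
set f := factors _ _ _ _ _; set g := _ ^+ r.
have -> : Y * (g * f * S) + (1 + bt * Y) * (g * (f * ('X_r + A + bt * 'X_r * A)) * S) =
  ('X_r * ((1 + bt * A) * (1 + bt * Y)) + ((1 + bt * A) * Y + A)) * (g * f * S) by ring.
by rewrite e1 e2 mulr1 addr0.
Qed.

Section Functional.

Variable phi : P -> K.
Hypothesis phiD : forall p q, phi (p + q) = phi p + phi q.
Hypothesis phiZ : forall c p, phi (c *: p) = c * phi p.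

(* The contribution of the words whose barred letter [t] is the first one that
   does not lead to a partition. *)
Fixpoint stray (t : 'I_n) (u : seq 'I_n) (rho : seq nat) (Q : P) : K :=
  if u is r :: u' then
    y rho r * stray t u' rho Q +
    (if is_partition (incr_nth rho r) then
       (1 + beta * y rho r) * stray t u' (incr_nth rho r) Q
     else if r == t then
       (1 + beta * y rho r) * phi (Q * mono u' * stair (incr_nth rho r))
     else 0)
  else 0.

Lemma phi_mono u rho Q : phi (Q * mono u * stair rho) =
  run u rho (fun rho' => phi (Q * stair rho')) + \sum_t stray t u rho Q.
Proof.
elim: u rho => [|r u IH] rho /=.
  by rewrite /mono big_nil mulr1 big1 ?addr0.
rewrite /mono big_cons -/(mono u).
have -> : Q * ('X_r * mono u) * stair rho = Q * mono u * ('X_r * stair rho) by ring.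
rewrite staircase_mulX mulrDr phiD -!scalerAr !phiZ (IH rho) big_split /= -mulr_sumr.
case: ifP => part_r; first by rewrite IH -mulr_sumr; ring.
rewrite [X in _ = _ + (_ + X)](bigD1 r) //= eqxx [X in _ = _ + (_ + (_ + X))]big1; first by ring.
by move=> t tr; rewrite eq_sym (negPf tr).
Qed.

Lemma stray_notin t u rho Q : t \notin u -> stray t u rho Q = 0.
Proof.
elim: u rho => //= r u IH rho; rewrite in_cons negb_or => /andP[tr tu].
by rewrite !IH // !mulr0 add0r eq_sym (negPf tr); case: ifP.
Qed.

Definition exits (t : 'I_n) (Q : P) (rho : seq nat) : K :=
  if is_partition (incr_nth rho t) then 0
  else (1 + beta * y rho t) * phi (Q * stair (incr_nth rho t)).

(** A column contains [t] at most once, so there is only one place where it can go stray. *)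
Lemma stray_split t u v rho Q : t \notin u -> t \notin v ->
  stray t (u ++ t :: v) rho Q = run u rho (exits t (Q * mono v)).
Proof.
move=> tu tv; elim: u rho tu => [|r u IH] rho /=.
  by rewrite /exits eqxx !stray_notin // !mulr0 add0r.
rewrite in_cons negb_or => /andP[tr tu]; rewrite !IH //.
by rewrite eq_sym (negPf tr).
Qed.

End Functional.

(** * Cancellation of the stray terms *)

Section Cancellation.

Variables (tops bots : nat -> nat) (mu nu : intpart) (phi : P -> K).
Hypothesis phiP : coef_functional beta a (nth 0%N nu) phi.
Hypothesis mu_n : (size mu <= n)%N.
Hypothesis nu_n : (size nu <= n)%N.
Hypothesis a_zero : forall (rho : seq nat) (k k1 : 'I_n), k1 = k.+1 :> nat ->
  is_partition rho -> included mu rho -> included rho nu ->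
  nth 0%N rho k = nth 0%N rho k1 -> (nth 0%N rho k1 < nth 0%N nu k1)%N ->
  a (n - k + nth 0 rho k)%N = 0.

Local Notation G := (colsum n beta (fun=> 0) tops bots).

Definition fits (rho : seq nat) : Prop :=
  [/\ is_partition rho, (size rho <= n)%N & included mu rho].

Lemma fits_incr rho (r : 'I_n) : fits rho -> is_partition (incr_nth rho r) ->
  fits (incr_nth rho r).
Proof.
move=> [_ rho_n mu_rho] part; split=> // [|i].
  by rewrite size_incr_nth; case: ifP.
by rewrite nth_incr_nth (leq_trans (mu_rho i)) // leq_addl.
Qed.

Let phiD := let: And4 h _ _ _ := phiP in h.
Let phiZ := let: And4 _ h _ _ := phiP in h.
Let phi_alt := let: And4 _ _ h _ := phiP in h.
Let phi_out := let: And4 _ _ _ h := phiP in h.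

Section Pair.

Variables (k k1 : 'I_n).
Hypothesis k1E : k1 = k.+1 :> nat.

Lemma exits_row rho : fits rho -> ~~ is_partition (incr_nth rho k1) ->
  nth 0%N rho k = nth 0%N rho k1.
Proof.
move=> [part _ _] npart; apply/eqP; rewrite eqn_leq.
rewrite (part_noninc (IntPart part) (i := k) (j := k1)) ?k1E //= andbT leqNgt.
by apply: contra npart => lt_k; apply: incr_nth_partition; rewrite ?k1E.
Qed.

(** Rows [k] and [k1] of [rho] being equally long, the stray box gives row [k1] as many factors as
    row [k]; only the leftover [1 + bt * 'X_k1] of [alt_rows] remains asymmetric. *)
Lemma exits_sym rho (Q : P) : fits rho -> swsym k k1 ((1 + bt * 'X_k1) * Q) ->
  exits phi k1 Q rho = 0.
Proof.
move=> fits_rho QS; rewrite /exits; case: ifPn => // /(exits_row fits_rho) eq_k.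
rewrite phi_alt ?mulr0 // mulrC; apply: (@alt_rows _ _ beta k k1) => //.
  by move=> r s rk rk1 ->; rewrite msym_factors tpermD // eq_sym.
rewrite !nth_incr_nth eqxx add1n.
have -> : (k1 == k :> nat) = false by rewrite k1E; apply/eqP; lia.
have -> : (0 + nth 0 rho k + (n.-1 - k) = (nth 0 rho k1).+1 + (n.-1 - k1))%N.
  by rewrite -eq_k; have := ltn_ord k1; lia.
set f := factors _ _ k _ _; set f1 := factors _ _ k1 _ _.
have -> : f * (1 + bt * 'X_k1) * f1 * Q = f * f1 * ((1 + bt * 'X_k1) * Q) by ring.
apply: swsymM => //.
by rewrite /swsym rmorphM /= /f /f1 !msym_factors tpermL tpermR mulrC.
Qed.

Lemma swsym_mono w : avoids k k1 w -> swsym k k1 (mono w).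
Proof.
move=> /allP av; rewrite /mono big_seq; apply: swsym_prod => r /av /andP[rk rk1].
exact: swsymX.
Qed.

Lemma avoids_notin w : avoids k k1 w -> (k \notin w) && (k1 \notin w).
Proof.
by move=> /allP av; apply/andP; split; apply/negP => /av; rewrite eqxx ?andbF.
Qed.

(** The stray shape is not a partition, which is why [coef_functional] asks for vanishing at
    arbitrary row lengths. If row [k1] of [nu] is full, the equality of rows [k] and [k1] still
    makes every row above long enough. *)
Lemma exits_out w rho Q : fits rho ->
  (exists2 i : 'I_n, nth 0 nu i < nth 0 rho i & true)%N \/ (nth 0 nu k1 <= nth 0 rho k1)%N ->
  exits phi k1 (Q * mono w) rho = 0.
Proof.
move=> fits_rho out; rewrite /exits; case: ifPn => // npart.
have [part rho_n _] := fits_rho; have rhoN := part_noninc (IntPart part).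
case: out => [[i lt_i _]|le_k1].
  rewrite (@phi_out _ _ i (nth 0 rho i + (n.-1 - i))%N) ?mulr0 ?ltn_add2r //.
  by move=> i' le_i; have := rhoN _ _ le_i; rewrite /= nth_incr_nth; lia.
rewrite (@phi_out _ _ k1 ((nth 0 rho k1).+1 + (n.-1 - k1))%N) ?mulr0 //.
  move=> i' le_i; rewrite nth_incr_nth; have [->|ne_i] := eqVneq (k1 : nat) i'; first by lia.
  have le_ik : (i' <= k)%N by rewrite k1E in le_i ne_i; lia.
  have := rhoN _ _ le_ik; rewrite /= (exits_row fits_rho npart) add0n.
  by have := ltn_ord k1; rewrite k1E; lia.
by rewrite addSn ltnS leq_add2r.
Qed.

(** As [w2] avoids both letters, rows [k] and [k1] do not change between the reading of [k] and the
    stray [k1]. The weight of an unbarred [k] can therefore be evaluated at the later shape, where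
    [a_zero] applies. *)
Lemma stray_late w1 w2 w3 rho Q : fits rho ->
  avoids k k1 (w1 ++ w2 ++ w3) ->
  stray phi k1 (w1 ++ k :: w2 ++ k1 :: w3) rho Q = 0.
Proof.
move=> fits_rho; rewrite /avoids !all_cat => /and3P[av1 av2 av3].
have [/andP[k_1 k1_1] /andP[k_2 k1_2]] := (avoids_notin av1, avoids_notin av2).
have /andP[k_3 k1_3] := avoids_notin av3.
have ne_k : k1 == k = false by rewrite -val_eqE /= k1E gtn_eqF.
rewrite -cat_cons catA stray_split //; last first.
  by rewrite mem_cat in_cons ne_k !negb_or k1_1 k1_2.
rewrite run_cat -(run0 w1 rho); apply: (run_eq (Inv := fits)) => // [rho' r _|rho1 fits1].
  exact: fits_incr.
(* The weight [c] of the letter [k] is carried into the run, so that the product need only vanish at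
   each final shape. *)
have runk rho2 c : fits rho2 ->
    (forall rho', fits rho' -> nth 0%N rho' k = nth 0%N rho2 k ->
       nth 0%N rho' k1 = nth 0%N rho2 k1 -> c * exits phi k1 (Q * mono w3) rho' = 0) ->
    c * run w2 rho2 (exits phi k1 (Q * mono w3)) = 0.
  move=> fits2 kap0; have [->|c0] := eqVneq c 0; first by rewrite mul0r.
  apply/eqP; rewrite mulf_eq0 (negPf c0) -(run0 w2 rho2); apply/eqP.
  apply: (run_eq (Inv := fun rho' => [/\ fits rho', nth 0%N rho' k = nth 0%N rho2 k &
       nth 0%N rho' k1 = nth 0%N rho2 k1])) => //.
    move=> rho' r rw [f' ek ek1] part; split; first exact: fits_incr.
      rewrite nth_incr_nth val_eqE; case: eqP => [rk|_]; last by rewrite ek.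
      by rewrite rk (negPf k_2) in rw.
    rewrite nth_incr_nth val_eqE; case: eqP => [rk|_]; last by rewrite ek1.
    by rewrite rk (negPf k1_2) in rw.
  move=> rho' [f' ek ek1]; apply/eqP; have /eqP := kap0 _ f' ek ek1.
  by rewrite mulf_eq0 (negPf c0).
rewrite /= runk // => [|rho' f' ek ek1].
  case: ifP => [part|_]; last by rewrite addr0.
  rewrite runk ?addr0 // => [|rho' f' ek ek1]; first exact: fits_incr.
  rewrite /exits; case: ifPn; rewrite ?mulr0 // => /(exits_row f').
  rewrite ek ek1 !nth_incr_nth eqxx; have -> : (k == k1 :> nat) = false by rewrite k1E ltn_eqF.
  have [part1 _ _] := fits1; have := part_noninc (IntPart part1) (leqnSn k).
  rewrite /= -k1E add1n add0n => le1 eq1.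
  by move: le1; rewrite -eq1 ltnn.
have [part|npart] := boolP (is_partition (incr_nth rho' k1)).
  by rewrite /exits part mulr0.
have eqk := exits_row f' npart.
have [/existsP[i lt_i]|] := boolP [exists i : 'I_n, nth 0 nu i < nth 0 rho' i]%N.
  by rewrite exits_out ?mulr0 //; left; exists i.
rewrite negb_exists => /forallP le_nu.
have [le_k1|lt_k1] := leqP (nth 0 nu k1) (nth 0 rho' k1).
  by rewrite exits_out ?mulr0 //; right.
have [part' rho_n mu_rho] := f'.
rewrite /a_part -ek (a_zero k1E part') ?/ominus ?oppr0 ?mul0r //.
move=> i; have [lt_i|ge_i] := ltnP i n.
  by have := le_nu (Ordinal lt_i); rewrite -leqNgt.
by rewrite nth_default // (leq_trans rho_n).
Qed.

(** Both words start with the same run over [w1], and a [k] read after the stray [k1] is merely a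
    variable; so the two terms merge under one [phi] with multiplier [Q + bt * ('X_k * Q')]. *)
Lemma stray_pair w1 w2 e rho Q Q' : fits rho -> avoids k k1 w1 -> avoids k k1 w2 ->
  swsym k k1 ((1 + bt * 'X_k1) * (Q + bt * ('X_k * Q'))) ->
  beta ^+ e * stray phi k1 (w1 ++ k1 :: w2) rho Q
    + beta ^+ e.+1 * stray phi k1 (w1 ++ k1 :: k :: w2) rho Q' = 0.
Proof.
move=> fits_rho av1 av2 QS.
have [/andP[_ k1_1] /andP[_ k1_2]] := (avoids_notin av1, avoids_notin av2).
have ne_k : k1 == k = false by rewrite -val_eqE /= k1E gtn_eqF.
rewrite !stray_split ?in_cons ?ne_k // exprSr -mulrA -mulrDr -run_lin.
rewrite -(run0 w1 rho) (run_eq (Inv := fits) (kap' := fun=> 0)) ?run0 ?mulr0 //.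
  by move=> rho' r _; exact: fits_incr.
move=> rho' f'; rewrite -(exits_sym (Q := (Q + bt * ('X_k * Q')) * mono w2) f'); last first.
  by rewrite mulrA; apply: swsymM => //; exact: swsym_mono.
rewrite /exits; case: ifP => _; first by rewrite mulr0 addr0.
rewrite [X in _ + X = _]mulrCA -mulrDr -phiZ -phiD; congr (_ * phi _).
by rewrite /mono big_cons -mul_mpolyC; ring.
Qed.

End Pair.

Lemma stray_first (t : 'I_n) u rho Q : fits rho -> t = 0%N :> nat -> stray phi t u rho Q = 0.
Proof.
move=> f t0; elim: u rho f => //= r u IH rho f; rewrite IH // mulr0 add0r.
case: ifPn => [part|npart]; first by rewrite IH ?mulr0 //; exact: fits_incr.
case: eqP => // rt; case/negP: npart; case: f => part _ _.
by apply: incr_nth_partition => //; rewrite rt t0.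
Qed.

(** The fillings in which [t] goes stray before [k] is read are paired: [t] opens a box, or [k]
    opens and [t] extends it; [t] extends a box, or both do. The multipliers are the sums over the
    columns to the left, and the symmetry wanted by [stray_pair] is, for the first pair, the early
    and late invariant at zero parameters. *)
Lemma stray_cancel J (g : nat -> nat) rho (t : 'I_n) :
  (forall i j, (i <= j)%N -> (g i <= g j)%N) -> fits rho ->
  \sum_(c | valid (tops J) (bots J) g c)
    beta ^+ extras c * stray phi t (reading c) rho (G J (height (tops J) c)) = 0.
Proof.
move=> g_mono f; have [t0|t_gt0] := posnP t.
  by rewrite big1 // => c _; rewrite stray_first ?mulr0.
have lt_k : (t.-1 < n)%N by rewrite (leq_ltn_trans (leq_pred t)).
pose k := Ordinal lt_k; have k1E : t = k.+1 :> nat by rewrite /= prednK.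
have ne_k : k != t by rewrite -val_eqE /= -{2}(prednK t_gt0) neq_ltn ltnSn.
rewrite big_mkcond (sum_window _ ne_k) big1 // => c /andP[/eqP ck /eqP ct].
have [D [C [s [w [av [rd0N rdNE rd0E [rdEE rdNN rdEN rdN0]]]]]]] := reading_window k1E ck ct.
have cat_av : avoids k t D && avoids k t C && avoids k t s && avoids k t w.
  by move: av; rewrite /avoids !all_cat -!andbA.
case/andP: cat_av => /andP[/andP[avD avC] avs] avw.
have [flat _ late early] := swap_stable_wleft k1E
  (colsum_swap beta (fun=> 0) tops bots k1E J) ck ct.
rewrite !sum_option_bool !valid_updE // !colsum_upd // !extras_upd // /lvalid.
rewrite rd0N rdNE rd0E rdEE rdNN rdEN !(stray_notin _ _ _ (rdN0 _)).
have av3 : avoids k t ((D ++ C) ++ s ++ w).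
  by rewrite /avoids !all_cat; apply/and3P; split=> //; rewrite ?avD //; apply/andP.
have av4 : avoids k t (D ++ (C ++ s) ++ w).
  by rewrite /avoids !all_cat; apply/and3P; split=> //; apply/andP.
have -> : D ++ C ++ k :: s ++ t :: w = (D ++ C) ++ k :: s ++ t :: w by rewrite -catA.
have -> : D ++ k :: C ++ s ++ t :: w = D ++ k :: (C ++ s) ++ t :: w by rewrite -catA.
rewrite (stray_late k1E _ f av3) (stray_late k1E _ f av4) !mulr0 !if_same /= !addn0 !addn1 !addr0.
set h := height _ c k; have le_top : (tops J <= h)%N by exact: leq_addr.
have le_g : (g k <= g t)%N by apply: g_mono; rewrite k1E.
rewrite !add0r; set v1 := wvalid _ _ _ _ _ _ _ 1; set v0 := wvalid _ _ _ _ _ _ _ 0.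
(* Paired words are valid under the same conditions; for the second pair this uses that [g] is
   monotone. *)
have -> : [&& v1, (g t.-1 <= h) && true, g t <= h.+1, tops J < h.+1 & g t < h.+1]%N =
    [&& v1, (g t.-1 <= h) && true, g t <= h & true]%N.
  case: v1 => //=; rewrite !ltnS le_top !andbT; case: (g t.-1 <= h)%N => //=.
  by apply: andb_idl => le_h; exact: leqW.
have -> : [&& v0, [&& g t.-1 <= h, tops J < h & g t.-1 < h], g t <= h, tops J < h & g t < h]%N
   = [&& v0, (g t.-1 <= h) && true, g t <= h, tops J < h & g t < h]%N.
  case: v0 => //=; case: (tops J < h)%N; rewrite ?andbF //=.
  move: le_g; rewrite /= => le1.
  have [lt_h|_] := ltnP (g t) h; last by rewrite !andbF.
  by rewrite (leq_ltn_trans le1 lt_h).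
rewrite -addrA addrACA addrC.
set e := wleft _ _ _ _ _ _ _ _ (New == New) (Ext == New).
set fl := wleft _ _ _ _ _ _ _ _ (Ext == New) (Ext == New).
set l := wleft _ _ _ _ _ _ _ _ _ _.
have symE : swsym k t ((1 + bt * 'X_t) * (l + bt * ('X_k * e))).
  have -> : (1 + bt * 'X_t) * (l + bt * ('X_k * e)) =
      l + bt * ((1 + bt * 'X_t) * oplus bt 'X_k 0%:MP * e + 'X_t * l).
    by rewrite /oplus mpolyC0; ring.
  by apply: swsymD => //; apply: swsymM => //; exact: swsymC.
have symF : swsym k t ((1 + bt * 'X_t) * (fl + bt * ('X_k * fl))).
  have -> : (1 + bt * 'X_t) * (fl + bt * ('X_k * fl)) =
      (1 + bt * 'X_t) * (1 + bt * 'X_k) * fl by ring.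
  apply: swsymM => //; rewrite /swsym !(rmorphM, rmorphD, rmorph1) /=.
  by rewrite !msymC !msymXU tpermL tpermR mulrC.
have avNE : avoids k t (D ++ C ++ s) by rewrite /avoids !all_cat; apply/and3P.
have avEE : avoids k t (D ++ s) by rewrite /avoids !all_cat; apply/andP.
have avEE' : avoids k t (C ++ w) by rewrite /avoids !all_cat; apply/andP.
have pairN := stray_pair k1E (extras c) f avNE avw symE.
have pairE := stray_pair k1E (extras c).+1 f avEE avEE' symF.
rewrite -!catA in pairN pairE.
case: ifP => _; case: ifP => _; rewrite ?add0r ?addr0 //.
by rewrite pairN pairE addr0.
Qed.

Lemma mono_reading (c : cword n) : mono (reading c) = \prod_(r | c r != None) 'X_r :> P.
Proof.
have foldE es D C : mono ((foldl (read_step c) (D, C) es).1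
      ++ (foldl (read_step c) (D, C) es).2) =
    mono (D ++ C) * \prod_(r <- es | c r != None) 'X_r :> P.
  elim: es D C => [|r es IH] D C /=; first by rewrite big_nil mulr1.
  rewrite big_cons /read_step; case: (c r) => [[]|] //=; rewrite IH.
    by rewrite /mono !big_cat !big_cons big_nil /=; ring.
  by rewrite /mono !big_cat !big_cons /=; ring.
by rewrite foldE /mono big_nil mul1r big_enum_cond.
Qed.

Lemma cweight0 j (c : cword n) :
  cweight beta (fun=> 0) tops j c = beta ^+ extras c *: mono (reading c).
Proof.
rewrite mono_reading -mul_mpolyC rmorphXn /= /extras -prodrXr [X in _ * X]big_mkcond -big_split.
apply: eq_bigr => r _; case: (c r) => [[]|] /=; rewrite /lweight /wt /oplus ?mpolyC0.
- by ring.
- by ring.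
by ring.
Qed.

(** The analogue of [colsum] in which the monomial of each column is replaced by its barred
    readings. *)
Fixpoint csum (J : nat) (g : nat -> nat) (rho : seq nat) : K :=
  if J is j.+1 then
    \sum_(c : cword n | valid (tops j) (bots j) g c)
      beta ^+ extras c * run (reading c) rho (csum j (height (tops j) c))
  else (rho == parts nu)%:R.

Hypothesis phi_nu : phi (stair nu) = 1.
Hypothesis phi_ne : forall lam, noninc lam -> (exists r : 'I_n, lam r != nth 0%N nu r) ->
  phi (staircase n beta (fun z => a (nat_int z)) lam) = 0.

Lemma phi_sum I (r : seq I) (C : pred I) (F : I -> P) :
  phi (\sum_(i <- r | C i) F i) = \sum_(i <- r | C i) phi (F i).
Proof.
apply: (big_morph _ phiD); have := phiZ 0 0; rewrite scale0r mul0r //.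
Qed.

Lemma phi_colsum J (g : nat -> nat) rho : (forall i j, (i <= j)%N -> (g i <= g j)%N) ->
  fits rho -> phi (G J g * stair rho) = csum J g rho.
Proof.
elim: J g rho => [|J IH] g rho g_mono f /=.
  rewrite mul1r; case: eqP => [->//|ne_nu]; apply: phi_ne.
    by case: f => part _ _; exact: (part_noninc (IntPart part)).
  apply/existsP; rewrite -[[exists _, _]]negbK negb_exists; apply/negP => /forallP eq_nu.
  case: f => part rho_n _; case: ne_nu.
  have eqn (i : nat) : nth 0%N rho i = nth 0%N nu i.
    have [lt_i|ge_i] := ltnP i n; first by have := eq_nu (Ordinal lt_i); rewrite negbK => /eqP.
    by rewrite !nth_default // (leq_trans _ ge_i).
  have nu_part : is_partition nu by case: (nu).
  have szE (s t : seq nat) : is_partition s -> (forall i, nth 0 s i = nth 0 t i)%N ->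
      (size s <= size t)%N.
    move=> /andP[_ s0] st; rewrite leqNgt; apply/negP => lt_t.
    case/negP: s0; rewrite -(nth_default 0%N (leqnn (size t))) -st; exact: mem_nth.
  have sz_eq : size rho = size nu by apply/eqP; rewrite eqn_leq !szE.
  by apply: (eq_from_nth (x0 := 0%N) sz_eq) => i _; exact: eqn.
rewrite mulr_suml phi_sum.
have termE (c : cword n) : phi (cweight beta (fun=> 0) tops J c * G J (height (tops J) c) * stair rho) =
    beta ^+ extras c * run (reading c) rho (fun rho' => phi (G J (height (tops J) c) * stair rho'))
    + \sum_t beta ^+ extras c * stray phi t (reading c) rho (G J (height (tops J) c)).
  rewrite cweight0 -!scalerAl phiZ [mono _ * _]mulrC phi_mono //.
  by rewrite mulrDr mulr_sumr.
rewrite (eq_bigr _ (fun c _ => termE c)).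
rewrite big_split /= [X in _ + X]exchange_big /= [X in _ + X]big1 ?addr0; last first.
  by move=> t _; exact: stray_cancel.
apply: eq_bigr => c _; congr (_ * _); apply: (run_eq (Inv := fits)) => //.
  by move=> rho' r _; exact: fits_incr.
by move=> rho' f'; apply: IH => // i j; exact: leq_height.
Qed.

End Cancellation.

End Transition.

(** * Chains of partitions and barred entries *)

Lemma partition_eq (s t : seq nat) : is_partition s -> is_partition t ->
  (forall i, nth 0%N s i = nth 0%N t i) -> s = t.
Proof.
move=> sP tP st.
have szE (s' t' : seq nat) : is_partition s' -> (forall i, nth 0 s' i = nth 0 t' i)%N ->
    (size s' <= size t')%N.
  move=> /andP[_ s0] st'; rewrite leqNgt; apply/negP => lt_t.
  case/negP: s0; rewrite -(nth_default 0%N (leqnn (size t'))) -st'; exact: mem_nth.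
have sz_eq : size s = size t by apply/eqP; rewrite eqn_leq !szE.
by apply: (eq_from_nth (x0 := 0%N) sz_eq) => i _.
Qed.

Fixpoint growth (s : seq nat) (u : seq nat) : bool :=
  is_partition s && (if u is i :: u' then growth (incr_nth s i) u' else true).

Lemma growth_cat s u v : growth s (u ++ v) = growth s u && growth (foldl incr_nth s u) v.
Proof.
elim: u s => [|i u IH] s /=; last by rewrite IH andbA.
by rewrite andbT; case: v => [|i v] /=; [rewrite andbT andbb | rewrite andbA andbb].
Qed.

Lemma growthP s u : reflect (forall m, (m <= size u)%N -> is_partition (foldl incr_nth s (take m u)))
  (growth s u).
Proof.
elim: u s => [|i u IH] s /=.
  by rewrite andbT; apply: (iffP idP) => [sP [|m] //|/(_ 0%N)]; apply.
apply: (iffP andP) => [[sP /IH uP] [|m] //= |uP]; first exact: uP.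
split; first exact: (uP 0%N).
by apply/IH => m le_m; exact: (uP m.+1).
Qed.

Lemma growth_exists n (s t : seq nat) : is_partition s -> is_partition t ->
  (size t <= n)%N -> included s t ->
  exists u : seq 'I_n, growth s [seq val i | i <- u] /\ foldl incr_nth s [seq val i | i <- u] = t.
Proof.
move=> sP tP t_n st.
have [d le_d] : exists d, (\sum_(i < n) nth 0 t i <= \sum_(i < n) nth 0 s i + d)%N.
  by exists (\sum_(i < n) nth 0 t i)%N; exact: leq_addl.
elim: d s sP st le_d => [|d IH] s sP st le_d.
all: have [/existsP[i0 lt_i0]|] := boolP [exists i : 'I_n, nth 0 s i < nth 0 t i]%N; last first.
1,3: rewrite negb_exists => /forallP ge_s; exists [::]; rewrite /= sP; split=> //.
1,2: apply: partition_eq => // i; apply/eqP; rewrite eqn_leq st /=.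
1,2: have [lt_i|ge_i] := ltnP i n; first by have := ge_s (Ordinal lt_i); rewrite -leqNgt.
1,2: by rewrite nth_default // (leq_trans t_n).
  exfalso; move: le_d; rewrite addn0 leqNgt => /negP; apply.
  rewrite (bigD1 i0) //= [X in (_ < X)%N](bigD1 i0) //= -addSn leq_add //.
  by apply: leq_sum => i _; exact: st.
(* The first row that is too short can grow, since the rows above already have their final
   lengths. *)
have [i lt_i imin] : exists2 i : 'I_n, (nth 0 s i < nth 0 t i)%N &
    forall j, (j < i)%N -> nth 0%N s j = nth 0%N t j.
  case: (arg_minnP (fun i : 'I_n => i : nat) (P := fun i : 'I_n => nth 0 s i < nth 0 t i)%N lt_i0).
  move=> i lt_i imin; exists i => // j lt_j; apply/eqP; rewrite eqn_leq st /= leqNgt.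
  apply/negP => lt_jt; have := imin (Ordinal (ltn_trans lt_j (ltn_ord i))) lt_jt.
  by rewrite /= leqNgt lt_j.
have siP : is_partition (incr_nth s i).
  apply: incr_nth_partition => // i_gt0; rewrite [X in (_ < X)%N]imin; last by rewrite prednK.
  by apply: leq_trans lt_i (part_noninc (IntPart tP) (leq_pred i)).
have [||u [uP uE]] := IH _ siP.
- by move=> j; rewrite nth_incr_nth; case: eqP => [<-|_] //; rewrite add0n st.
- apply: (leq_trans le_d); rewrite addnS -addSn leq_add2r.
  rewrite (bigD1 i) //= [X in (_ < X)%N](bigD1 i) //= nth_incr_nth eqxx add1n addSn ltnS.
  rewrite leq_add2l; apply: leq_sum => j _; rewrite nth_incr_nth; exact: leq_addl.
by exists (i :: u); rewrite /= sP.
Qed.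

Lemma sumn_incr_nth s i : sumn (incr_nth s i) = (sumn s).+1.
Proof.
elim: s i => [|x s IH] [|i] //=; last by rewrite IH addnS.
by elim: i => //= i ->.
Qed.

Lemma sumn_growth s u : sumn (foldl incr_nth s u) = (sumn s + size u)%N.
Proof. by elim: u s => [|i u IH] s /=; rewrite ?addn0 // IH sumn_incr_nth addSnnS. Qed.

(** * The parameters that vanish *)

Section Zeroed.

Variables (n : nat) (mu nu : intpart).
Hypothesis nu_n : (size nu <= n)%N.

(** [rho] itself may not admit a box in row [k], so the rows above are first raised to at least
    [m.+1]; this stays inside [nu], whose row [k1] exceeds [m]. Rows [k] and [k1] keep their length
    [m], so the vertical step from the raised shape names the same index. *)
Lemma zeroed_step (rho : seq nat) (k k1 : 'I_n) : k1 = k.+1 :> nat ->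
  is_partition rho -> included mu rho -> included rho nu ->
  nth 0%N rho k = nth 0%N rho k1 -> (nth 0%N rho k1 < nth 0%N nu k1)%N ->
  zeroed n mu nu (n - k + nth 0 rho k).
Proof.
move=> k1E rhoP mu_rho rho_nu eq_k lt_k1.
have [muP nuP] : is_partition mu /\ is_partition nu by split; [case: (mu)|case: (nu)].
have rhoN := part_noninc (IntPart rhoP); have nuN := part_noninc nu.
set m := nth 0%N rho k in eq_k *.
pose h i := if (i < k)%N then maxn (nth 0%N rho i) m.+1 else nth 0%N rho i.
have hN : noninc h.
  move=> i j le_ij; rewrite /h; have := rhoN _ _ le_ij => /= le_r.
  have [lt_j|ge_j] := ltnP j k; first by rewrite (leq_ltn_trans le_ij lt_j); lia.
  have : (nth 0 rho j <= m)%N := rhoN _ _ ge_j.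
  by case: ifP; lia.
have [sg sg_n sgE] := exists_part n hN.
have sgE' i : nth 0%N sg i = h i.
  have [lt_i|ge_i] := ltnP i n; first exact: sgE.
  rewrite nth_default ?(leq_trans sg_n) // /h ltnNge (leq_trans _ ge_i) ?[(k <= n)%N]ltnW //=.
  have le_i : (nth 0 rho i <= nth 0 nu i)%N := rho_nu i.
  by move: le_i; rewrite (@nth_default _ _ nu) ?(leq_trans nu_n) //; case: (nth _ _ _).
have sgP : is_partition sg by case: (sg).
pose sg1 := incr_nth sg k; pose sg2 := incr_nth sg1 k1.
have hk : h k = m by rewrite /h ltnn.
have hk1 : h k1 = m by rewrite /h k1E ltnNge leqnSn /= -k1E -eq_k.
have kk1 : (k == k1 :> nat) = false by rewrite k1E; apply/eqP; lia.
have k1k : (k1 == k :> nat) = false by rewrite k1E; apply/eqP; lia.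
have sg1P : is_partition sg1.
  apply: incr_nth_partition => // k_gt0; rewrite !sgE' hk /h prednK // leqnn.
  by rewrite leq_max ltnSn orbT.
have sg2P : is_partition sg2.
  apply: incr_nth_partition => // _.
  have -> : k1.-1 = k by rewrite k1E.
  by rewrite !nth_incr_nth !sgE' kk1 eqxx hk hk1 add0n add1n.
have mu_sg : included mu sg.
  by move=> i; rewrite sgE' /h; have := mu_rho i; case: ifP; lia.
have sg2_nu : included sg2 nu.
  move=> i; rewrite !nth_incr_nth sgE'; have le_i := rho_nu i.
  have [<-|ik1] := eqVneq (k1 : nat) i; first by rewrite kk1 hk1 eq_k add0n add1n.
  have [<-|ik] := eqVneq (k : nat) i.
    rewrite hk eq_k add0n add1n; apply: leq_trans lt_k1 (nuN _ _ _).
    by rewrite k1E.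
  rewrite !add0n /h; case: ifP => // lt_ik; rewrite geq_max le_i /=.
  rewrite eq_k; apply: leq_trans lt_k1 (nuN _ _ _); rewrite k1E; lia.
have [u1 [u1P u1E]] := growth_exists muP sgP sg_n mu_sg.
have [u2 [u2P u2E]] := growth_exists sg2P nuP nu_n sg2_nu.
pose u := u1 ++ k :: k1 :: u2; pose vu := [seq val i | i <- u].
have vuE : vu = [seq val i | i <- u1] ++ (k : nat) :: (k1 : nat) :: [seq val i | i <- u2].
  by rewrite /vu map_cat.
have uP : growth mu vu by rewrite vuE growth_cat u1P u1E /= sgP -/sg1 sg1P -/sg2 u2P.
have uE : foldl incr_nth mu vu = nu by rewrite vuE foldl_cat u1E /= -/sg1 -/sg2 u2E.
have szu : size u == chain_length mu nu.
  apply/eqP; rewrite /chain_length -[in RHS]uE sumn_growth size_map.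
  by rewrite addKn.
pose R : labels n mu nu := Tuple szu.
have chainE j : chain R j = foldl incr_nth mu (take j vu) by [].
have sz_u : ((size u1).+1 < size u)%N by rewrite size_cat /= !addnS !ltnS leq_addr.
have lt_l : (size u1 < chain_length mu nu)%N by rewrite -(eqP szu) ltnW.
have take1 : take (size u1) vu = [seq val i | i <- u1].
  by rewrite vuE -{1}(size_map val u1) take_size_cat.
have take3 : take (size u1).+2 vu = [seq val i | i <- u1] ++ [:: (k : nat); (k1 : nat)].
  rewrite vuE take_cat size_map ltnNge -addn2 leq_addr /= addKn /=; congr (_ ++ [:: _, _ & _]).
  by case: (map _ _).
have tnR : tnth R (Ordinal lt_l) = k.
  by rewrite (tnth_nth k) /= /u nth_cat ltnn subnn.
apply/existsP; exists R; apply/andP; split.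
  apply/andP; split; last first.
    by rewrite chainE take_oversize ?uE // size_map (eqP szu).
  by apply/forallP => j; rewrite chainE; apply/growthP => //; rewrite size_map (eqP szu) -ltnS.
apply/existsP; exists (Ordinal lt_l); apply/and3P; split.
- by rewrite /= -(eqP szu).
- rewrite /same_column !chainE take1 take3 foldl_cat u1E /= -/sg1 -/sg2.
  suff allm : all (pred1 m) [seq p.2 | p <- boxes sg2 sg].
    case: [seq p.2 | p <- boxes sg2 sg] allm => //= x s /andP[/eqP -> ]; exact.
  apply/allP => _ /mapP[[i j] /allpairsPdep[i' [j' [_ j'P [-> ->]]]] ->] /=.
  move: j'P; rewrite mem_iota !nth_incr_nth sgE'.
  have [<-|ik1] := eqVneq (k1 : nat) i'; first by rewrite kk1 hk1; lia.
  have [<-|ik] := eqVneq (k : nat) i'; first by rewrite hk; lia.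
  by lia.
by rewrite tnR chainE take1 u1E sgE' hk.
Qed.

End Zeroed.

(** * Invertibility of [1 + beta * a i] *)

Section Units.

Variables (F K : fieldType) (iota : {rmorphism F -> K}) (n : nat) (beta : K) (a : nat -> K).
Variables (mu nu : intpart).
Hypothesis a_zero : forall i, zeroed n mu nu i -> a i = 0.
Hypothesis K_rational :
  rational_function_field iota (indeterminate n mu nu) (variable beta a).

(** If [a i] is not set to 0, it is independent of [beta], and [1 + X_0 X_1] is not the zero
    polynomial, its constant term being 1. *)
Lemma one_beta_neq0 i : (0 < i)%N -> 1 + beta * a i != 0.
Proof.
move=> i_gt0; have [/a_zero ->|i_free] := boolP (zeroed n mu nu i).
  by rewrite mulr0 addr0 oner_neq0.
have [indep _] := K_rational.
pose u (j : 'I_2) : option nat := if j == ord0 then None else Some i.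
have u_inj : injective u.
  by move=> [[|[|j]] hj] [[|[|j']] hj'] //= _; apply: val_inj.
have u_free j : indeterminate n mu nu (u j).
  by rewrite /u; case: ifP => //= _; rewrite i_gt0.
pose j1 : 'I_2 := lift ord0 ord0.
pose p : {mpoly F[2]} := 1 + 'X_ord0 * 'X_j1.
apply/eqP => beta0; have := indep 2 u p u_inj u_free.
have -> : mmap iota (variable beta a \o u) p = 0.
  rewrite /p !(rmorphD, rmorphM, rmorph1) /= !mmapX !mmap1U /= /u /=.
  by [].
move=> /(_ erefl) /(congr1 (meval (fun=> 0))); rewrite meval0 /p mevalD meval1 mevalM.
by rewrite !mevalXU mul0r addr0 => /eqP; rewrite oner_eq0.
Qed.

End Units.

(** * Barred entries as subsequences of the list of entries *)

Section Bars.

Variables (K : fieldType) (n : nat) (beta : K) (a : nat -> K).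
Variables (theta : seq (nat * nat)) (mu nu : intpart).
Local Notation entry := (entry n theta).
Local Notation prec := (@prec n theta).
Local Notation y := (a_part beta a).

Lemma prec_trans : transitive prec.
Proof.
move=> f e g; rewrite /prec; case: (val e.2) (val f.2) (val g.2) => [i j] [i' j'] [i'' j''].
move: (e.1 : nat) (f.1 : nat) (g.1 : nat) => r r' r''.
by move=> /or3P[h1|/andP[h1 h2]|/and3P[h1 h2 h3]] /or3P[g1|/andP[g1 g2]|/and3P[g1 g2 g3]]; lia.
Qed.

Lemma prec_irr : irreflexive prec.
Proof. by move=> e; rewrite /prec; case: (val e.2) => i j; lia. Qed.

Definition row_labels (bs : seq entry) : seq nat := [seq val b.1 | b <- bs].

Fixpoint subseqs (es : seq entry) : seq (seq entry) :=
  if es is e :: es' then [seq e :: bs | bs <- subseqs es'] ++ subseqs es' else [:: [::]].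

Lemma mem_subseqs es bs : uniq es -> (bs \in subseqs es) = subseq bs es.
Proof.
elim: es bs => [|e es IH] bs /=; first by rewrite inE; case: bs.
case/andP=> e_es es_uniq; rewrite mem_cat IH //; case: bs => [|b bs] /=.
  by rewrite sub0seq orbT.
case: eqP => [->|ne_be].
  rewrite mem_map ?IH //; last by move=> ? ? [].
  by apply/orb_idr; exact: (subseq_trans (subseq_cons bs e)).
apply/orb_idl => /mapP[bs' _ [be _]].
by rewrite be in ne_be.
Qed.

Lemma subseqs_uniq es : uniq es -> uniq (subseqs es).
Proof.
elim: es => //= e es IH /andP[e_es es_uniq]; rewrite cat_uniq map_inj_uniq ?IH //=; last first.
  by move=> ? ? [].
rewrite andbT; apply/hasPn => bs; rewrite mem_subseqs // => sub_bs; apply/negP => /mapP[bs' _ bsE].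
by case/negP: e_es; rewrite (mem_subseq sub_bs) // bsE mem_head.
Qed.

Definition unbarred_weight (rho : seq nat) (es bs : seq entry) : K :=
  \prod_(e <- es | e \notin bs)
    y (foldl incr_nth rho (row_labels [seq b <- bs | prec b e])) e.1.

Fixpoint barred_weight (rho : seq nat) (bs : seq entry) : K :=
  if bs is b :: bs' then (1 + beta * y rho b.1) * barred_weight (incr_nth rho b.1) bs' else 1.

Definition reaches (rho : seq nat) (bs : seq entry) : bool :=
  growth rho (row_labels bs) && (foldl incr_nth rho (row_labels bs) == nu).

(** The two terms of a step of [run] are the subsequences without and with the head; as the list is
    sorted, the bars preceding an entry are those chosen before it. *)
Lemma run_subseqs es rho : pairwise prec es -> is_partition rho ->
  run beta a [seq e.1 | e <- es] rho (fun rho' => (rho' == parts nu)%:R) =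
  \sum_(bs <- subseqs es | reaches rho bs) unbarred_weight rho es bs * barred_weight rho bs.
Proof.
elim: es rho => [|e es IH] rho /=.
  move=> _ rhoP; rewrite big_cons big_nil /reaches /= rhoP /=.
  by rewrite /unbarred_weight big_nil; case: ifP; rewrite ?mulr1 ?addr0.
case/andP=> /allP e_es es_prec rhoP; rewrite big_cat big_map /= addrC.
have es_uniq : uniq es.
  exact: (sorted_uniq prec_trans prec_irr) (pairwise_sorted es_prec).
have sub_es bs : bs \in subseqs es -> {subset bs <= es}.
  by rewrite mem_subseqs // => /mem_subseq.
have e_notin : e \notin es by apply/negP => /e_es; rewrite prec_irr.
congr (_ + _).
  rewrite IH // mulr_sumr big_seq_cond [RHS]big_seq_cond; apply: eq_bigr => bs /andP[/sub_es bs_es _].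
  rewrite mulrA; congr (_ * _); rewrite /unbarred_weight big_cons.
  have -> /= : e \notin bs by apply: contra e_notin => /bs_es.
  congr (y _ _ * _); rewrite (eq_in_filter (a2 := pred0)) ?filter_pred0 // => b /bs_es /e_es eb.
  by apply/negP => be; have := prec_trans eb be; rewrite prec_irr.
case: ifP => part_e; last first.
  rewrite big1 // => bs; rewrite /reaches /= rhoP /=.
  by case: bs => [|b bs] /=; rewrite part_e.
rewrite IH // mulr_sumr /reaches /= rhoP /= big_seq_cond [RHS]big_seq_cond.
apply: eq_bigr => bs /andP[/sub_es bs_es _].
rewrite mulrCA; congr (_ * _); rewrite /unbarred_weight big_cons mem_head /=.
rewrite big_seq_cond [RHS]big_seq_cond; apply: eq_big => [e'|e' /andP[e'_es _]].
  rewrite in_cons negb_or; have [e'_es|] //= := boolP (e' \in es).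
  by case: eqP => // ee; rewrite -ee e'_es in e_notin.
by rewrite /= e_es.
Qed.

Lemma filter_prec (bs : seq entry) e : pairwise prec bs ->
  [seq b <- bs | prec b e] = take (count (fun b => prec b e) bs) bs.
Proof.
elim: bs => //= b bs IH /andP[/allP b_bs bs_prec]; case: ifP => [_|b_e].
  by rewrite IH.
have none : {in bs, forall b', prec b' e = false}.
  move=> b' /b_bs bb'; apply/negP => b'e.
  by have := prec_trans bb' b'e; rewrite b_e.
rewrite (eq_in_filter (a2 := pred0)) ?filter_pred0 //.
by rewrite (eq_in_count (a2 := pred0)) // count_pred0.
Qed.

Lemma barred_weightE rho bs (b0 : entry) :
  barred_weight rho bs = \prod_(i < size bs)
    (1 + beta * y (foldl incr_nth rho (take i (row_labels bs))) (nth b0 bs i).1).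
Proof.
elim: bs rho => [|b bs IH] rho /=; first by rewrite big_ord0.
by rewrite big_ord_recl /= IH; congr (_ * _); apply: eq_bigr.
Qed.

Local Notation l := (chain_length mu nu).

(** The bars determine [R], so the double sum is a sum over subsequences of [es]. Those that reach
    [nu] have length [l] automatically, each bar adding one box. *)
Lemma sum_bars (T : filling n theta) (es : seq entry) :
  pairwise prec es -> es =i entries T ->
  \sum_(R : labels n mu nu | is_chain R)
    \sum_(bs : l.-tuple entry | related R T bs) weight beta a R T bs =
  run beta a [seq e.1 | e <- es] mu (fun rho' => (rho' == parts nu)%:R).
Proof.
move=> es_prec esE.
have muP : is_partition mu by case: (mu).
have es_uniq : uniq es.
  exact: (sorted_uniq prec_trans prec_irr) (pairwise_sorted es_prec).
rewrite run_subseqs //.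
pose lab (bs : l.-tuple entry) : labels n mu nu := [tuple of [seq b.1 | b <- bs]].
pose ok (bs : l.-tuple entry) := subseq bs es && reaches mu bs.
pose wgt (bs : seq entry) := unbarred_weight mu es bs * barred_weight mu bs.
have labE (bs : l.-tuple entry) m : chain (lab bs) m = foldl incr_nth mu (take m (row_labels bs)).
  by rewrite /chain /row_labels /= -map_comp.
have relE (R : labels n mu nu) (bs : l.-tuple entry) :
    is_chain R && related R T bs = (R == lab bs) && ok bs.
  rewrite /related /ok andbC -!andbA [RHS]andbC -!andbA.
  have -> : ([seq b.1 | b <- bs] == R :> seq 'I_n) = (R == lab bs).
    by rewrite -val_eqE eq_sym.
  have [->|neR] := eqVneq R (lab bs); last by rewrite !andbF.
  rewrite andTb andbT andbA.
  have -> : all (mem (entries T)) bs && sorted prec bs = subseq bs es.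
    apply/andP/idP => [[/allP bsT bs_sorted]|sub_bs].
      suff -> : tval bs = [seq e <- es | e \in bs] by exact: filter_subseq.
      apply: (irr_sorted_eq prec_trans prec_irr) => // [|e].
        by apply: sorted_filter; [exact: prec_trans | exact: pairwise_sorted].
      rewrite mem_filter; have [e_bs|] //= := boolP (e \in bs).
      by rewrite esE; exact/esym/bsT.
    split; first by apply/allP => e /(mem_subseq sub_bs); rewrite esE.
    exact: subseq_sorted prec_trans _ _ sub_bs (pairwise_sorted es_prec).
  congr (_ && _); rewrite /is_chain /reaches labE take_oversize ?size_map ?size_tuple //.
  congr (_ && _); apply/forallP/growthP => [gr m|gr m].
    rewrite size_map size_tuple => le_m.
    by have := gr (Ordinal (n:=l.+1) (m:=m) le_m); rewrite labE.
  by rewrite labE; apply: gr; rewrite size_map size_tuple -ltnS.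
rewrite (eq_bigr (fun R => \sum_(bs : l.-tuple entry) (if related R T bs then weight beta a R T bs else 0)));
  last by move=> R _; rewrite big_mkcond.
rewrite exchange_big /=.
have wE (bs : l.-tuple entry) : ok bs -> weight beta a (lab bs) T bs = wgt bs.
  case/andP=> sub_bs _; have bs_prec : pairwise prec bs by exact: subseq_pairwise sub_bs es_prec.
  rewrite /weight /wgt; congr (_ * _).
    rewrite /unbarred_weight big_mkcondr [RHS]big_mkcond [RHS]big_uniq //=.
    apply: eq_big => [e|e _]; first by rewrite esE.
    by case: ifP => // _; rewrite labE filter_prec // /row_labels map_take.
  have [l0|l_gt0] := posnP l.
    have -> : tval bs = [::] by apply: size0nil; rewrite size_tuple.
    by rewrite big1 // => i; have := ltn_ord i; rewrite {2}l0.
  have b0 : entry by case: (tval bs) (size_tuple bs) => [/esym|b //]; rewrite /= => l0; rewrite l0 in l_gt0.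
  rewrite (barred_weightE _ _ b0) size_tuple; apply: eq_bigr => i _.
  by rewrite labE (tnth_nth b0.1) /= (nth_map b0) ?size_tuple.
rewrite (eq_bigr (fun bs : l.-tuple entry => if ok bs then wgt bs else 0)) => [|bs _]; last first.
  rewrite -big_mkcondr (eq_bigl (fun R => (R == lab bs) && ok bs)); last by move=> R; exact: relE.
  have [okbs|_] := boolP (ok bs); last by rewrite big_pred0 // => R; rewrite andbF.
  by rewrite (eq_bigl (pred1 (lab bs))) ?big_pred1_eq ?wE // => R; rewrite andbT.
rewrite -big_mkcond -[RHS]big_filter -[LHS]big_filter.
rewrite -(big_map (fun bs : l.-tuple entry => tval bs) xpredT wgt).
apply: perm_big; apply: uniq_perm.
- by rewrite map_inj_uniq ?filter_uniq ?index_enum_uniq //; exact: val_inj.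
- by rewrite filter_uniq // subseqs_uniq.
move=> s; rewrite mem_filter mem_subseqs //; apply/mapP/andP => [[bs]|[reach sub_s]].
  by rewrite mem_filter => /andP[/andP[? ?] _] ->.
have sz_s : size s == l.
  case/andP: reach => _ /eqP /(congr1 sumn); rewrite sumn_growth size_map /chain_length => <-.
  by rewrite addKn.
by exists (Tuple sz_s); rewrite // mem_filter mem_index_enum /ok /= sub_s reach.
Qed.

End Bars.

(** * Tableaux as lists of words *)

Section Columns.

Variables (n : nat) (tops bots : nat -> nat).
Hypothesis tops_noninc : forall j, (tops j.+1 <= tops j)%N.
Hypothesis bots_noninc : forall j, (bots j.+1 <= bots j)%N.
Hypothesis tops_bots : forall j, (tops j <= bots j)%N.
Local Notation New := (Some true).
Local Notation Ext := (Some false).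

(* [t i j r] says that the box in row [i] and column [j] contains [r]. *)
Definition tableau_pred (t : nat -> nat -> 'I_n -> bool) : Prop :=
  [/\ forall i j r, t i j r -> (tops j <= i < bots j)%N,
      forall i j, (tops j <= i < bots j)%N -> exists r, t i j r,
      forall i j r s, t i j r -> t i j.+1 s -> (r <= s)%N &
      forall i j r s, t i j r -> t i.+1 j s -> (r < s)%N].

(** In a tableau a letter occurs in at most one row of a column, so the choice made by [pick] does
    not matter. *)
Definition column_word (t : nat -> nat -> 'I_n -> bool) (j : nat) : cword n :=
  [ffun r => if [pick i : 'I_(bots j) | t i j r] is Some i
     then Some [forall r' : 'I_n, t i j r' ==> (r <= r')%N] else None].

Section FromTableau.

Variable t : nat -> nat -> 'I_n -> bool.
Hypothesis tP : tableau_pred t.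
Local Notation hgt j := (height (tops j) (column_word t j)).

Let t_in i j r : t i j r -> (tops j <= i < bots j)%N. Proof. by case: tP => h _ _ _; exact: h. Qed.
Let t_ne i j : (tops j <= i < bots j)%N -> exists r, t i j r.
Proof. by case: tP => _ h _ _; exact: h. Qed.

Lemma column_strict i i' j r s : (i < i')%N -> t i j r -> t i' j s -> (r < s)%N.
Proof.
case: tP => _ _ _ col; elim: i' s => // i' IH s; rewrite ltnS leq_eqVlt.
case/predU1P=> [<-|lt_i] tr ts; first exact: col tr ts.
have [|q tq] := @t_ne i' j; last exact: ltn_trans (IH _ lt_i tr tq) (col _ _ _ _ tq ts).
by have := t_in tr; have := t_in ts; lia.
Qed.

Lemma column_row i i' j r : t i j r -> t i' j r -> i = i'.
Proof.
move=> tr tr'; have [lt_i|lt_i|//] := ltngtP i i'.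
  by have := column_strict lt_i tr tr'; rewrite ltnn.
by have := column_strict lt_i tr' tr; rewrite ltnn.
Qed.

Lemma column_wordE i j r : t i j r ->
  column_word t j r = Some [forall r' : 'I_n, t i j r' ==> (r <= r')%N].
Proof.
move=> tr; rewrite ffunE; case: pickP => [i' tr'|none].
  by rewrite (column_row tr tr').
have /andP[_ lt_i] := t_in tr; by have := none (Ordinal lt_i); rewrite /= tr.
Qed.

Lemma column_word_row j r : column_word t j r != None -> exists i, t i j r.
Proof. by rewrite ffunE; case: pickP => // i tr _; exists i. Qed.

Lemma height_filled j m i : (i < hgt j m)%N =
  (i < tops j)%N || [exists r : 'I_n, (r < m)%N && t i j r].
Proof.
elim: m i => [|m IH] i.
  rewrite height0; case: ltnP => //= _; apply/esym/negbTE.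
  by rewrite negb_exists; apply/forallP.
have [lt_mn|le_nm] := ltnP m n; last first.
  rewrite height_over //.
  rewrite IH; congr (_ || _); apply: eq_existsb => r.
  by rewrite !(leq_trans (ltn_ord r)) // (leq_trans le_nm).
pose r := Ordinal lt_mn.
have filledS i' : [exists r' : 'I_n, (r' < m.+1)%N && t i' j r'] =
    [exists r' : 'I_n, (r' < m)%N && t i' j r'] || t i' j r.
  apply/existsP/orP => [[r' /andP[]]|[/existsP[r' /andP[lt_r' tr']]|tr]].
  - rewrite ltnS leq_eqVlt => /predU1P[r'E|lt_r'] tr'; last by left; apply/existsP; exists r'; rewrite lt_r'.
    by right; have <- : r' = r by apply: val_inj.
  - by exists r'; rewrite tr' ltnS ltnW.
  by exists r; rewrite /= ltnSn.
have := heightS (tops j) (column_word t j) r; rewrite /= => ->.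
rewrite filledS orbA -IH.
case cr: (column_word t j r) => [b|]; last first.
  rewrite addn0 orb_idr // => tr; by rewrite (column_wordE tr) in cr.
have [|i0 tr0] := @column_word_row j r; first by rewrite cr.
have [ti0 bi0] := andP (t_in tr0).
have tE i' : t i' j r = (i' == i0).
  by apply/idP/eqP => [tr|->//]; exact: column_row tr tr0.
move: cr; rewrite (column_wordE tr0) => -[bE]; rewrite tE.
case: b bE => [/forallP minr|/forallPn[r'' ]]; last first.
  rewrite negb_imply -ltnNge => /andP[tr'' lt_r]; rewrite addn0 orb_idr // => /eqP->.
  by rewrite IH; apply/orP; right; apply/existsP; exists r''; rewrite tr'' andbT.
(* [r] is the least entry of its box, so no smaller letter reaches row [i0], whereas the box above,
   if there is one, already has a smaller entry. *)
have -> : hgt j m = i0.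
  apply/eqP; rewrite eqn_leq; apply/andP; split.
    rewrite leqNgt IH negb_or -leqNgt ti0 negb_exists; apply/forallP => r'.
    by rewrite negb_and -leqNgt orbC -implybE; exact: minr.
  case: i0 tr0 ti0 bi0 tE minr => // i0 tr0 ti0 bi0 tE minr.
  rewrite IH; have [//|ge_t] := ltnP i0 (tops j).
  have [|q tq] := @t_ne i0 j; first by rewrite ge_t ltnW.
  apply/existsP; exists q; rewrite tq andbT.
  exact: (column_strict (ltnSn i0) tq tr0).
by rewrite addn1 ltnS leq_eqVlt orbC.
Qed.

Lemma height_entry i j r : t i j r -> hgt j r.+1 = i.+1.
Proof.
move=> tr; have /andP[ti bi] := t_in tr; apply/eqP; rewrite eqn_leq; apply/andP; split; last first.
  by rewrite height_filled; apply/orP; right; apply/existsP; exists r; rewrite ltnSn.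
rewrite leqNgt height_filled negb_or -leqNgt (leq_trans ti) //= negb_exists.
apply/forallP => r'; rewrite negb_and -leqNgt orbC -implybE; apply/implyP => tr'.
exact: column_strict tr tr'.
Qed.

Lemma height_full j : hgt j n = bots j.
Proof.
have hE i : (i < hgt j n)%N = (i < bots j)%N.
  rewrite height_filled; have [lt_t|ge_t] /= := ltnP i (tops j).
    by rewrite (leq_trans lt_t).
  apply/existsP/idP => [[r /andP[_ /t_in /andP[]]] //|lt_b].
  by have [|r tr] := @t_ne i j; [rewrite ge_t | exists r; rewrite ltn_ord].
apply/eqP; rewrite eqn_leq [(bots j <= _)%N]leqNgt -hE ltnn andbT.
by rewrite leqNgt hE ltnn.
Qed.

Lemma column_valid j : valid (tops j) (bots j) (hgt j.+1) (column_word t j).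
Proof.
have [_ _ t_row _] := tP.
have le_h m : (m <= n)%N -> (hgt j.+1 m <= hgt j m)%N.
  move=> _; rewrite leqNgt; apply/negP => lt_h.
  have := lt_h; rewrite height_filled => /orP[lt_t|/existsP[r /andP[lt_r tr]]].
    have := leq_trans lt_t (tops_noninc j); rewrite ltnNge => /negP; apply.
    by rewrite -[X in (X <= _)%N](height0 (tops j) (column_word t j)) leq_height.
  have [lt_t|ge_t] := ltnP (hgt j m) (tops j).
    by have := ltnn (hgt j m); rewrite height_filled lt_t.
  have /andP[_ lt_b] := t_in tr.
  have [|q tq] := @t_ne (hgt j m) j; first by rewrite ge_t (leq_trans lt_b).
  have := ltnn (hgt j m); rewrite height_filled => /negbT; rewrite negb_or => /andP[_ /existsP[]].
  by exists q; rewrite tq andbT (leq_ltn_trans (t_row _ _ _ _ tq tr)).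
apply/and3P; split; first exact: le_h.
  by rewrite height_full.
apply/forallP => r; rewrite /lvalid le_h ?(ltnW (ltn_ord r)) //=.
apply/implyP => /eqP cr; have [|i tr] := @column_word_row j r; first by rewrite cr.
have hr : hgt j r = i.+1.
  by rewrite -(height_entry tr) heightS cr addn0.
rewrite hr; have /andP[ti _] := t_in tr; rewrite ltnS ti /= ltnNge.
rewrite [(i.+1 <= _)%N]height_filled negb_or -leqNgt (leq_trans (tops_noninc j) ti) negb_exists.
apply/forallP => s; rewrite negb_and -leqNgt orbC -implybE; apply/implyP => ts.
exact: t_row tr ts.
Qed.

End FromTableau.

Section FromWords.

Variable c : nat -> cword n.
Hypothesis cP : forall j, valid (tops j) (bots j) (height (tops j.+1) (c j.+1)) (c j).
Local Notation hgt j := (height (tops j) (c j)).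

(** Once [r] has been read, the height is one more than its row, whether it opened the box or
    extended it. *)
Definition word_tableau (i j : nat) (r : 'I_n) : bool :=
  (c j r != None) && (hgt j r.+1 == i.+1).

Let c_full j : hgt j n = bots j. Proof. by have /and3P[_ /eqP]:= cP j. Qed.
Let c_le j m : (m <= n)%N -> (hgt j.+1 m <= hgt j m)%N.
Proof.
rewrite leq_eqVlt => /predU1P[->|lt_m]; first by have /and3P[] := cP j.
by have /and3P[_ _ /forallP/(_ (Ordinal lt_m))/andP[]] := cP j.
Qed.
Let c_ext j r : c j r = Ext -> (tops j < hgt j r)%N && (hgt j.+1 r < hgt j r)%N.
Proof.
by move=> cr; have /and3P[_ _ /forallP/(_ r)/andP[_]] := cP j; rewrite cr.
Qed.

(** The height grows by at most one per letter, so some letter takes it from [i] to [i.+1]. *)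
Lemma exists_new j i : (tops j <= i)%N -> forall m, (i < hgt j m)%N ->
  exists r : 'I_n, [/\ (r < m)%N, c j r = New & hgt j r = i].
Proof.
move=> le_t; elim=> [|m IH]; first by rewrite height0 ltnNge le_t.
have [lt_mn|le_nm] := ltnP m n; last first.
  rewrite height_over //.
  by case/IH => r [lt_r ? ?]; exists r; split=> //; exact: ltnW.
have := heightS (tops j) (c j) (Ordinal lt_mn); rewrite /= => hE.
have [/IH[r [lt_r ? ?]]|ge_i] := ltnP i (hgt j m); first by exists r; split=> //; exact: ltnW.
rewrite hE; case: eqP => [cN|_]; last by rewrite addn0 ltnNge ge_i.
rewrite addn1 ltnS => le_i; exists (Ordinal lt_mn); split=> //=.
by apply/eqP; rewrite eqn_leq ge_i.
Qed.

Lemma word_new j r : c j r = New -> word_tableau (hgt j r) j r.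
Proof. by move=> cr; rewrite /word_tableau cr heightS cr addn1 eqxx. Qed.

Lemma word_row j r : c j r != None -> exists2 i, word_tableau i j r & (tops j <= i < bots j)%N.
Proof.
move=> cr; have h_gt : (tops j < hgt j r.+1)%N.
  have := heightS (tops j) (c j) r; case cE: (c j r) cr => [[]|] // _ ->.
    by rewrite addn1 ltnS; have := leq_height (tops j) (c j) (leq0n r); rewrite height0.
  by rewrite addn0; case/andP: (c_ext cE).
exists (hgt j r.+1).-1; first by rewrite /word_tableau cr (ltn_predK h_gt) eqxx.
have := leq_height (tops j) (c j) (ltn_ord r); rewrite c_full.
by move: h_gt; lia.
Qed.

Lemma word_tableauP : tableau_pred word_tableau.
Proof.
split=> [i j r|i j /andP[ti bi]|i j r s|i j r s].
- move=> tr; have [|i' tr' ii'] := @word_row j r; first by case/andP: tr.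
  suff -> : i = i' by [].
  by case/andP: tr => _ /eqP hi; case/andP: tr' => _ /eqP; rewrite hi => -[].
- have [|r [_ cr hr]] := exists_new ti (m := n); first by rewrite c_full.
  by exists r; rewrite -hr; exact: word_new.
- move=> /andP[cr /eqP hr] /andP[cs /eqP hs]; rewrite leqNgt; apply/negP => lt_s.
  have le_h : (i.+1 <= hgt j.+1 r)%N by rewrite -hs; exact: leq_height.
  have := heightS (tops j) (c j) r; rewrite hr; case cE: (c j r) cr => [[]|] // _.
    by have := c_le j (ltnW (ltn_ord r)); rewrite addn1; lia.
  by have := c_ext cE; rewrite addn0; lia.
move=> /andP[_ /eqP hr] /andP[_ /eqP hs]; rewrite ltnNge; apply/negP => le_s.
have : (hgt j s.+1 <= hgt j r.+1)%N by apply: leq_height.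
by rewrite hr hs ltnn.
Qed.

Lemma column_word_tableau j : column_word word_tableau j = c j.
Proof.
apply/ffunP => r; have [cr|/word_row[i tr ij]] := eqVneq (c j r) None.
  rewrite ffunE cr; case: pickP => // i; by rewrite /word_tableau cr.
rewrite (column_wordE word_tableauP tr); case/andP: (tr) => cr /eqP hr.
have := heightS (tops j) (c j) r; rewrite hr; case cE: (c j r) cr => [[]|] // _.
  rewrite addn1 => -[hi]; congr Some; apply/forallP => r'; apply/implyP => /andP[_ /eqP hr'].
  rewrite leqNgt; apply/negP => lt_r; have := leq_height (tops j) (c j) lt_r.
  by rewrite hr' -hi ltnn.
rewrite addn0 => hi; congr Some; apply/negbTE/forallPn.
have ti : (tops j <= i)%N by case/andP: ij.
have [|r' [lt_r cr' hr']] := exists_new ti (m := r); first by rewrite -hi.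
exists r'; rewrite negb_imply -ltnNge lt_r andbT -hr'; exact: word_new.
Qed.

End FromWords.

End Columns.


(** * Column sums as sums over lists of words *)

Section WordLists.

Variables (n : nat) (tops bots : nat -> nat).
Local Notation New := (Some true).
Local Notation Ext := (Some false).
Local Notation hgt t j := (height (tops j) (column_word bots t j)).

(* A list of column words starts with the rightmost column. *)
Fixpoint word_lists (J : nat) (g : nat -> nat) : seq (seq (cword n)) :=
  if J is j.+1 then
    flatten [seq [seq c :: s | s <- word_lists j (height (tops j) c)] |
             c <- enum (valid (tops j) (bots j) g)]
  else [:: [::]].

Fixpoint columns (c : nat -> cword n) (J : nat) : seq (cword n) :=
  if J is j.+1 then c j :: columns c j else [::].

Lemma word_listsS j g c s : (c :: s \in word_lists j.+1 g) =
  valid (tops j) (bots j) g c && (s \in word_lists j (height (tops j) c)).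
Proof.
apply/flatten_mapP/andP => [[c' ]|[cg s_in]].
  by rewrite mem_enum => c'g /mapP[s' s'_in [-> ->]].
by exists c; [rewrite mem_enum | exact: map_f].
Qed.

Lemma word_lists_nil j g : [::] \in word_lists j.+1 g = false.
Proof. by apply/negP => /flatten_mapP[c _ /mapP[]]. Qed.

Lemma word_lists_size J g s : s \in word_lists J g -> size s = J.
Proof.
elim: J g s => [|j IH] g [|c s] //=; first by rewrite word_lists_nil.
by rewrite word_listsS => /andP[_ /IH->].
Qed.

Lemma word_lists_uniq J g : uniq (word_lists J g).
Proof.
elim: J g => [//|j IH] g /=; have := enum_uniq (valid (tops j) (bots j) g : pred (cword n)).
elim: (enum _) => //= c cs IHc; case/andP=> c_cs cs_uniq; rewrite cat_uniq map_inj_uniq ?IH ?IHc //; last by move=> ? ? [].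
rewrite andbT; apply/hasPn => s /flatten_mapP[c' c'_cs /mapP[s' _ ->]].
by apply/negP => /mapP[s'' _ [cc _]]; rewrite -cc c'_cs in c_cs.
Qed.

Lemma eq_valid (top bot : nat) (g g' : nat -> nat) (c : cword n) : g =1 g' ->
  valid top bot g c = valid top bot g' c.
Proof.
move=> eq_g; rewrite /valid eq_g; congr [&& _, _ & _].
by apply: eq_forallb => r; rewrite eq_g.
Qed.

Lemma columns_in (c : nat -> cword n) J g :
  (forall j, valid (tops j) (bots j) (height (tops j.+1) (c j.+1)) (c j)) ->
  g =1 height (tops J) (c J) -> columns c J \in word_lists J g.
Proof.
move=> cP; elim: J g => [|j IH] g eq_g; first by rewrite /= inE.
by rewrite [columns _ _]/= word_listsS (eq_valid _ _ _ eq_g) cP IH.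
Qed.

Definition none_word : cword n := [ffun=> None].

Lemma height_none t r : height t none_word r = t.
Proof. by rewrite /height big1 ?addn0 // => i _; rewrite ffunE. Qed.

Lemma columnsE s : columns (nth none_word (rev s)) (size s) = s.
Proof.
elim: s => //= c s IH; rewrite rev_cons nth_rcons size_rev ltnn eqxx; congr cons.
rewrite -[RHS]IH; have : (size s <= size s)%N by [].
move: {1 3 4}(size s) => J; elim: J => //= j IHj lt_j.
by rewrite nth_rcons size_rev lt_j IHj // ltnW.
Qed.

Lemma word_lists_valid J g s j : s \in word_lists J g -> (j < J)%N ->
  valid (tops j) (bots j)
    (if j.+1 == J then g else height (tops j.+1) (nth none_word (rev s) j.+1))
    (nth none_word (rev s) j).
Proof.
elim: J g s j => // J IH g [|c s] j; first by rewrite word_lists_nil.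
rewrite word_listsS => /andP[cg s_in]; rewrite rev_cons !nth_rcons size_rev.
rewrite (word_lists_size s_in) ltnS leq_eqVlt eqSS => /predU1P[->|lt_j].
  by rewrite ltnn eqxx.
have := IH _ _ _ s_in lt_j; rewrite lt_j (ltn_eqF lt_j).
have [->|ne_J] := eqVneq j.+1 J; first by rewrite ltnn.
by rewrite [(j.+1 < J)%N]ltn_neqAle ne_J lt_j.
Qed.

Fixpoint lists_weight (K : fieldType) (beta : K) (B : int -> K) (s : seq (cword n)) :=
  if s is c :: s' then cweight beta B tops (size s') c * lists_weight beta B s' else 1.

Lemma lists_weight_columns (K : fieldType) (beta : K) B (c : nat -> cword n) J :
  lists_weight beta B (columns c J) = \prod_(j < J) cweight beta B tops j (c j) :> {mpoly K[n]}.
Proof.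
elim: J => [|j IH]; first by rewrite big_ord0.
have szE : size (columns c j) = j by elim: (j) => //= i ->.
by rewrite big_ord_recr /= IH szE; exact: mulrC.
Qed.

Lemma colsum_lists (K : fieldType) (beta : K) (B : int -> K) J g :
  colsum n beta B tops bots J g = \sum_(s <- word_lists J g) lists_weight beta B s.
Proof.
elim: J g => [|j IH] g; first by rewrite big_seq1.
rewrite /= big_flatten big_map big_enum_cond /=; apply: eq_big => [c|c cg]; first by rewrite andbT.
rewrite IH mulr_sumr big_map big_seq [RHS]big_seq; apply: eq_bigr => s s_in.
by rewrite /= (word_lists_size s_in).
Qed.

Lemma csum_lists (K : fieldType) (beta : K) (a : nat -> K) (nu : intpart) J g rho :
  csum n beta a tops bots nu J g rho =
  \sum_(s <- word_lists J g) beta ^+ (\sum_(c <- s) extras c) *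
    run beta a (flatten (map (@reading n) s)) rho (fun rho' => (rho' == parts nu)%:R).
Proof.
elim: J g rho => [|j IH] g rho; first by rewrite big_seq1 big_nil mul1r.
rewrite /= big_flatten big_map big_enum_cond /=; apply: eq_big => [c|c cg]; first by rewrite andbT.
have eq_run (u : seq 'I_n) rho1 kap kap' : kap =1 kap' -> run beta a u rho1 kap = run beta a u rho1 kap'.
  by move=> eq_kap; apply: (run_eq beta a (Inv := fun=> True)).
rewrite (eq_run _ _ _ _ (IH _)) big_map; elim: (word_lists _ _) => [|s ss IHs].
  by rewrite big_nil (eq_run _ _ _ (fun=> 0)) ?run0 ?mulr0 // => rho'; rewrite big_nil.
rewrite big_cons -IHs /= run_cat big_cons exprD -mulrA -mulrDr; congr (_ * _).
rewrite addrC -run_lin; apply: eq_run => rho'.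
by rewrite big_cons addrC.
Qed.

End WordLists.


(** The parts of the conjugate partition. *)
Definition col_length (s : seq nat) (j : nat) : nat := count (fun v => (j < v)%N) s.

Lemma ltn_col_length (s : intpart) i j : (i < col_length s j)%N = (j < nth 0 s i)%N.
Proof.
have /andP[sP _] : is_partition s by case: (s).
rewrite /col_length; elim: {s sP}(parts s) sP i => [_ i|v s IH sP i] /=; first by rewrite nth_nil.
have sP' := path_sorted sP; have vs : all (fun w => w <= v)%N s.
  by move: sP => /=; rewrite (path_sortedE geq_trans) => /andP[].
have [lt_j|ge_j] := ltnP j v; first by case: i => [|i] /=; rewrite ?lt_j // add1n ltnS IH.
have cs w : w \in s -> (j < w)%N = false.
  by move=> /(allP vs) le_w; apply/negbTE; rewrite -leqNgt (leq_trans le_w).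
rewrite (eq_in_count (a2 := pred0)) // count_pred0 addn0 ltn0; apply/esym/negbTE; rewrite -leqNgt.
case: i => //= i; have [lt_i|ge_i] := ltnP i (size s); last by rewrite nth_default.
exact: leq_trans (allP vs _ (mem_nth 0%N lt_i)) ge_j.
Qed.

Lemma col_length_noninc (s : intpart) j : (col_length s j.+1 <= col_length s j)%N.
Proof. by apply: sub_count => v /=; exact: ltnW. Qed.

Lemma col_length_over (s : intpart) j : (nth 0 s 0 <= j)%N -> col_length s j = 0%N.
Proof. by move=> le_j; apply/eqP; rewrite -leqn0 leqNgt ltn_col_length -leqNgt. Qed.

(** * Tableaux of skew shape *)

Section Skew.

Variables (n : nat) (lam eta : intpart).
Hypothesis eta_lam : included eta lam.

Local Notation theta := (boxes lam eta).
Local Notation tops := (col_length eta).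
Local Notation bots := (col_length lam).
Local Notation m := (nth 0%N lam 0).

Lemma col_length_le j : (tops j <= bots j)%N.
Proof.
rewrite leqNgt; apply/negP; rewrite ltn_col_length => lt_j.
by have := leq_trans lt_j (eta_lam _); rewrite -ltn_col_length ltnn.
Qed.

Lemma mem_boxes i j : ((i, j) \in theta) = (tops j <= i < bots j)%N.
Proof.
rewrite ltn_col_length [(_ <= i)%N]leqNgt ltn_col_length -leqNgt.
apply/allpairsPdep/idP => [[i' [j' [_ + [-> ->]]]]|/andP[ge_j lt_j]].
  by rewrite mem_iota; have := eta_lam i'; lia.
exists i, j; split=> //; rewrite mem_iota /=; last by move: ge_j lt_j; lia.
rewrite ltnNge; apply/negP => ge_i; by rewrite nth_default in lt_j.
Qed.

Definition holds_at (T : filling n theta) (i j : nat) (r : 'I_n) : bool :=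
  [exists p, (val p == (i, j)) && (r \in T p)].

Lemma holds_atE (T : filling n theta) (p : box theta) r :
  holds_at T (val p).1 (val p).2 r = (r \in T p).
Proof.
apply/existsP/idP => [[q /andP[/eqP qp rq]]|rp].
  by have <- : q = p by apply: val_inj; rewrite qp -surjective_pairing.
by exists p; rewrite rp -surjective_pairing eqxx.
Qed.

Lemma box_at i j : (tops j <= i < bots j)%N -> exists p : box theta, val p = (i, j).
Proof. by rewrite -mem_boxes => ij; exists (SeqSub ij). Qed.

Lemma tableauP (T : filling n theta) : set_valued_tableau T -> tableau_pred tops bots (holds_at T).
Proof.
case/and3P=> /forallP T0 /forallP Trow /forallP Tcol; split=> [i j r|i j ij|i j r s|i j r s].
- by case/existsP=> p /andP[/eqP pE _]; rewrite -mem_boxes -pE; exact: valP.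
- have [p pE] := box_at ij; have /set0Pn[r rp] := T0 p; exists r.
  by apply/existsP; exists p; rewrite pE eqxx.
- case/existsP=> p /andP[/eqP pE rp] /existsP[q /andP[/eqP qE sq]].
  move/forallP/(_ q)/implyP: (Trow p); rewrite /left_of pE qE /= !eqxx => /(_ isT).
  by move/'forall_implyP/(_ _ rp)/'forall_implyP/(_ _ sq).
case/existsP=> p /andP[/eqP pE rp] /existsP[q /andP[/eqP qE sq]].
move/forallP/(_ q)/implyP: (Tcol p); rewrite /above pE qE /= !eqxx => /(_ isT).
by move/'forall_implyP/(_ _ rp)/'forall_implyP/(_ _ sq).
Qed.

Definition tableau_of (t : nat -> nat -> 'I_n -> bool) : filling n theta :=
  [ffun p => [set r | t (val p).1 (val p).2 r]].

Lemma tableau_ofP t : tableau_pred tops bots t -> set_valued_tableau (tableau_of t).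
Proof.
case=> _ t0 trow tcol; apply/and3P; split; apply/forallP => p.
- have := valP p; rewrite [val p]surjective_pairing mem_boxes => /t0[r tr].
  by apply/set0Pn; exists r; rewrite ffunE inE.
- apply/forallP => q; apply/implyP => /andP[/eqP pq1 /eqP pq2].
  apply/'forall_implyP => r; rewrite ffunE inE => tr; apply/'forall_implyP => s.
  by rewrite ffunE inE -pq1 -pq2; exact: trow.
apply/forallP => q; apply/implyP => /andP[/eqP pq1 /eqP pq2].
apply/'forall_implyP => r; rewrite ffunE inE => tr; apply/'forall_implyP => s.
by rewrite ffunE inE -pq1 -pq2; exact: tcol.
Qed.

Lemma tableau_ofE t i j r : tableau_pred tops bots t -> holds_at (tableau_of t) i j r = t i j r.
Proof.
move=> [t_in _ _ _]; apply/existsP/idP => [[p /andP[/eqP pE]]|tr]; first by rewrite ffunE inE pE.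
by have [p pE] := box_at (t_in _ _ _ tr); exists p; rewrite pE eqxx ffunE inE pE.
Qed.

Definition word_of (T : filling n theta) : nat -> cword n := column_word bots (holds_at T).

Lemma eq_column_word (t t' : nat -> nat -> 'I_n -> bool) j : (forall i r, t i j r = t' i j r) ->
  column_word bots t j = column_word bots t' j.
Proof.
move=> eq_t; apply/ffunP => r; rewrite !ffunE (eq_pick (fun i : 'I_(bots j) => eq_t i r)).
by case: pickP => // i _; congr Some; apply: eq_forallb => r'; rewrite eq_t.
Qed.

Lemma nth_columns (c : nat -> cword n) J j : (j < J)%N -> nth (none_word n) (columns c J) (J - j.+1)%N = c j.
Proof.
elim: J => //= J IH; rewrite ltnS leq_eqVlt => /predU1P[->|lt_j]; first by rewrite subnn.
by rewrite subSn //= -IH // subnSK.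
Qed.

Lemma eq_columns (c c' : nat -> cword n) J : (forall j, (j < J)%N -> c j = c' j) ->
  columns c J = columns c' J.
Proof. by elim: J => //= J IH eq_c; rewrite eq_c // IH // => j lt_j; apply: eq_c; exact: ltnW. Qed.

Lemma columns_inj (T T' : filling n theta) : set_valued_tableau T -> set_valued_tableau T' ->
  columns (word_of T) m = columns (word_of T') m -> T = T'.
Proof.
move=> /tableauP TP /tableauP T'P eqTT'; apply/ffunP => p; apply/setP => r; rewrite -!holds_atE.
have := valP p; rewrite [val p]surjective_pairing mem_boxes; move: (val p).1 (val p).2 => i j ij.
have eqj : word_of T j = word_of T' j.
  have lt_j : (j < m)%N.
    by rewrite -ltn_col_length (leq_ltn_trans (leq0n i)) //; case/andP: ij.
  by rewrite -(nth_columns _ lt_j) eqTT' nth_columns.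
have tE t : tableau_pred tops bots t -> t i j r =
    (column_word bots t j r != None) && (height (tops j) (column_word bots t j) r.+1 == i.+1).
  move=> tP; apply/idP/andP => [tr|[cr /eqP hr]].
    by rewrite (column_wordE tP tr) (height_entry tP tr).
  have [i' tr] := column_word_row cr.
  by move: hr; rewrite (height_entry tP tr) => -[<-].
by rewrite !tE //; move: eqj; rewrite /word_of => ->.
Qed.

(** Boxes occur only in the first [m] columns, and the last of these has no right neighbour, whence
    the heights [fun=> 0]. *)
Lemma sum_tableaux (V : nmodType) (f : seq (cword n) -> V) :
  \sum_(T : filling n theta | set_valued_tableau T) f (columns (word_of T) m) =
  \sum_(s <- word_lists n tops bots m (fun=> 0%N)) f s.
Proof.
rewrite -big_filter -(big_map (fun T => columns (word_of T) m) xpredT f).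
apply: perm_big; apply: uniq_perm.
- rewrite map_inj_in_uniq ?filter_uniq ?index_enum_uniq // => T T'.
  by rewrite !mem_filter => /andP[TP _] /andP[T'P _]; exact: columns_inj.
- exact: word_lists_uniq.
have tops_m j : (m <= j)%N -> tops j = 0%N.
  by move=> le_m; apply/eqP; rewrite -leqn0 (leq_trans (col_length_le j)) // col_length_over.
move=> s; apply/mapP/idP => [[T]|s_in].
  rewrite mem_filter => /andP[/tableauP TP _] ->; apply: columns_in => [j|r].
    by apply: column_valid TP j; [exact: col_length_noninc | exact: col_length_noninc | exact: col_length_le].
  have h_n : height (tops m) (word_of T m) n = 0%N by rewrite (height_full col_length_le TP) col_length_over.
  apply/esym/eqP; rewrite -leqn0; have [/(leq_height (tops m) (word_of T m))|] := leqP r n.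
    by rewrite h_n.
  move=> /ltnW le_n; rewrite -(subnK le_n); elim: (r - n)%N => [|k IH]; first by rewrite add0n h_n.
  by rewrite addSn height_over ?leq_addl.
pose c := nth (none_word n) (rev s).
have c_over j : (m <= j)%N -> c j = none_word n.
  by move=> le_j; rewrite /c nth_default // size_rev (word_lists_size s_in).
have cP j : valid (tops j) (bots j) (height (tops j.+1) (c j.+1)) (c j).
  have [lt_j|ge_j] := ltnP j m.
    have := word_lists_valid s_in lt_j; case: eqP => // jm.
    rewrite (eq_valid _ _ _ (g' := height (tops j.+1) (c j.+1))) // => r.
    by rewrite jm c_over // height_none tops_m.
  rewrite !c_over ?tops_m ?col_length_over ?(leq_trans ge_j) //.
  apply/and3P; split; rewrite ?height_none //.
  by apply/forallP => r; rewrite /lvalid !height_none ffunE.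
have wP := word_tableauP cP.
exists (tableau_of (word_tableau tops c)).
  by rewrite mem_filter mem_index_enum tableau_ofP.
rewrite -[LHS](columnsE s) (word_lists_size s_in); apply: eq_columns => j _.
rewrite -[LHS](column_word_tableau cP); apply: eq_column_word => i r.
by rewrite tableau_ofE.
Qed.

End Skew.


(** * The reading order and the order of entries *)

Section ReadingOrder.

Variables (n : nat) (t : nat) (c : cword n).
Local Notation New := (Some true).
Local Notation Ext := (Some false).
Local Notation h := (height t c).

Definition reads_before (r s : 'I_n) : bool :=
  (h r.+1 < h s.+1)%N || (h r.+1 == h s.+1) && (s < r)%N.

Lemma reading_take m : (m <= n)%N ->
  let st := foldl (read_step c) ([::], [::]) (take m (enum 'I_n)) in
  [/\ pairwise reads_before (st.1 ++ st.2), {in st.1, forall r : 'I_n, (h r.+1 < h m)%N},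
      {in st.2, forall r : 'I_n, h r.+1 = h m} &
      forall r, (r \in st.1 ++ st.2) = (r < m)%N && (c r != None)].
Proof.
elim: m => [_|m IH lt_m]; first by rewrite take0; split.
have [] := IH (ltnW lt_m); pose r0 := Ordinal lt_m.
rewrite (take_nth r0) ?size_enum_ord // -[m in nth _ _ m]/(val r0) nth_ord_enum foldl_rcons.
case: (foldl _ _ _) => [D C] /= prw lt_D eq_C mem_DC.
have ltS (r : 'I_n) : (r < m.+1)%N = (r == r0) || (r < m)%N by rewrite ltnS leq_eqVlt.
have hS := heightS t c r0; rewrite /= in hS.
have memE r : r \in D ++ C -> (r < m)%N by rewrite mem_DC => /andP[].
rewrite /read_step; case cr: (c r0) hS => [[]|] /=; rewrite ?addn1 ?addn0 => hS; rewrite ?hS.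
- have le_h r : r \in D ++ C -> (h r.+1 <= h m)%N.
    by rewrite mem_cat => /orP[/lt_D/ltnW//|/eq_C->].
  split=> [||r|r].
  + rewrite pairwise_cat prw /= andbT; apply/allrelP => r s rDC; rewrite inE => /eqP->.
    by rewrite /reads_before /= hS ltnS le_h.
  + by move=> r /le_h; rewrite ltnS.
  + by rewrite inE => /eqP->; rewrite -hS.
  rewrite mem_cat mem_DC mem_seq1 ltS orbC; by have [->|//] := eqVneq r r0; rewrite /= cr.
- have [lt_CD pD pC] := and3P (etrans (esym (pairwise_cat _ _ _)) prw).
  split=> [|//|r|r].
  + rewrite pairwise_cat pD /= pC andbT; apply/andP; split.
      apply/allrelP => r s rD; rewrite inE => /predU1P[->|sC].
        by rewrite /reads_before /= hS lt_D.
      exact: (allrelP lt_CD).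
    apply/allP => s sC; rewrite /reads_before /= hS eq_C // eqxx ltnn.
    by apply: memE; rewrite mem_cat sC orbT.
  + by rewrite inE => /predU1P[->|/eq_C].
  by rewrite mem_cat in_cons orbCA -mem_cat mem_DC ltS; have [->|//] := eqVneq r r0; rewrite /= cr.
split=> // r; rewrite mem_DC ltS; have [->|//] := eqVneq r r0.
by rewrite cr !andbF.
Qed.

Lemma reading_sorted : pairwise reads_before (reading c).
Proof. by have [] := reading_take (leqnn n); rewrite take_oversize ?size_enum_ord. Qed.

Lemma mem_reading r : (r \in reading c) = (c r != None).
Proof.
have [_ _ _] := reading_take (leqnn n); rewrite take_oversize ?size_enum_ord // => memE.
by rewrite [LHS]memE ltn_ord.
Qed.

Lemma reading_uniq : uniq (reading c).
Proof.
have irr : irreflexive reads_before by move=> r; rewrite /reads_before !ltnn andbF.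
have tr : transitive reads_before.
  move=> s r u; rewrite /reads_before => /orP[h1|/andP[/eqP-> h2]] /orP[g1|/andP[/eqP g1 g2]].
  - by rewrite (ltn_trans h1 g1).
  - by rewrite -g1 h1.
  - by rewrite g1.
  by rewrite g1 eqxx (ltn_trans g2 h2) orbT.
exact: sorted_uniq tr irr _ (pairwise_sorted reading_sorted).
Qed.

Lemma extras_reading : extras c = count (fun r => c r == Ext) (reading c).
Proof.
rewrite -sumn_count sumnE big_map big_uniq ?reading_uniq //= /extras big_mkcond /=.
by rewrite [RHS]big_mkcond /=; apply: eq_bigr => r _; rewrite mem_reading; case: (c r) => [[]|].
Qed.

End ReadingOrder.

Section Letters.

Variables (n : nat) (lam eta : intpart).
Hypothesis eta_lam : included eta lam.
Local Notation New := (Some true).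
Local Notation Ext := (Some false).

Local Notation theta := (boxes lam eta).
Local Notation tops := (col_length eta).
Local Notation bots := (col_length lam).
Local Notation m := (nth 0%N lam 0).

Variable T : filling n theta.
Hypothesis TP : set_valued_tableau T.
Local Notation c := (word_of T).
Local Notation h j := (height (tops j) (c j)).

(** Coordinates are kept bare here; [entry_list] adds the membership in [theta] that the type of
    entries requires. *)
Fixpoint letters (J : nat) : seq ('I_n * (nat * nat)) :=
  if J is j.+1 then [seq (r, ((h j r.+1).-1, j)) | r : 'I_n <- reading (c j)] ++ letters j
  else [::].

Definition letter_prec (x y : 'I_n * (nat * nat)) : bool :=
  [|| (x.2.2 > y.2.2)%N, (x.2.2 == y.2.2) && (x.2.1 < y.2.1)%N |
      [&& x.2.1 == y.2.1, x.2.2 == y.2.2 & (x.1 > y.1)%N]].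

Lemma holds_letter i j r : holds_at T i j r = (c j r != None) && (h j r.+1 == i.+1).
Proof.
have tP := tableauP eta_lam TP; apply/idP/andP => [tr|[cr /eqP hr]].
  by rewrite (column_wordE tP tr) (height_entry tP tr).
have [i' tr] := column_word_row cr.
by move: hr; rewrite (height_entry tP tr) => -[<-].
Qed.

Lemma height_letter j r : c j r != None -> h j r.+1 = (h j r.+1).-1.+1.
Proof.
move=> cr; have [i tr] := column_word_row cr.
by rewrite (height_entry (tableauP eta_lam TP) tr).
Qed.

Lemma mem_letters J i j r : ((r, (i, j)) \in letters J) = (j < J)%N && holds_at T i j r.
Proof.
elim: J => //= J IH; rewrite mem_cat IH [in RHS]ltnS [in RHS]leq_eqVlt andb_orl; congr (_ || _).
rewrite holds_letter; apply/mapP/andP => [[s s_in [-> -> ->]]|[/eqP-> /andP[cr /eqP hr]]].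
  by move: s_in; rewrite (mem_reading 0) => cs; rewrite cs eqxx -height_letter ?eqxx.
by exists r; rewrite ?(mem_reading 0) // hr.
Qed.

Lemma letters_sorted J : pairwise letter_prec (letters J).
Proof.
elim: J => //= J IH; rewrite pairwise_cat IH andbT; apply/andP; split.
  apply/allrelP => x [s [i j]] /mapP[r _ ->]; rewrite mem_letters => /andP[lt_j _].
  by rewrite /letter_prec /= lt_j.
rewrite pairwise_map.
have := @sub_in_pairwise _ (mem (reading (c J))) (reads_before (tops J) (c J))
  (relpre (fun r : 'I_n => (r, ((h J r.+1).-1, J))) letter_prec); apply=> [r s||]; last first.
- exact: reading_sorted.
- by apply/allP.
rewrite /= !(mem_reading 0) /reads_before /letter_prec /= => cr cs.
rewrite (height_letter cr) (height_letter cs) /= !eqxx ltnn !ltnS !eqSS /=.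
by case/orP => [->//|/andP[-> ->]]; rewrite orbT.
Qed.

Lemma letters_reading J : [seq x.1 | x <- letters J] = flatten [seq reading w | w <- columns c J].
Proof.
elim: J => //= J IH; rewrite map_cat IH -map_comp; congr (_ ++ _).
by rewrite -[RHS]map_id; apply: eq_map.
Qed.

Lemma letters_extras J :
  count (fun x => c x.2.2 x.1 == Ext) (letters J) = \sum_(w <- columns c J) extras w.
Proof.
elim: J => [|J IH]; first by rewrite big_nil.
by rewrite /= big_cons count_cat IH count_map (extras_reading 0).
Qed.

Lemma entry_list : exists es : seq (entry n theta),
  [/\ [seq (e.1, val e.2) | e <- es] = letters m, pairwise (@prec n theta) es & es =i entries T].
Proof.
have [es esE] : exists es : seq (entry n theta), [seq (e.1, val e.2) | e <- es] = letters m.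
  have : all (fun x => x.2 \in theta) (letters m).
    apply/allP => -[r [i j]]; rewrite mem_letters => /andP[_ /existsP[p /andP[/eqP <- _]]].
    exact: valP.
  elim: (letters m) => [|[r p] ls IH] /=; first by exists [::].
  by case/andP=> p_in /IH[es <-]; exists ((r, SeqSub p_in) :: es).
exists es; split=> //.
  have := letters_sorted m; rewrite -esE pairwise_map; apply: sub_pairwise => e f.
  by rewrite /prec (surjective_pairing (val e.2)) (surjective_pairing (val f.2)).
have inj : injective (fun e : entry n theta => (e.1, val e.2)).
  by move=> [r p] [s q] /= [-> /val_inj->].
move=> e; rewrite -(mem_map inj) esE /= [val e.2]surjective_pairing mem_letters holds_atE inE.
case: (boolP (e.1 \in T e.2)) => eT; rewrite ?andbF // andbT.
have := valP e.2; rewrite [X in X \in _]surjective_pairing (mem_boxes eta_lam) => /andP[_].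
by rewrite -ltn_col_length; apply: leq_ltn_trans.
Qed.

Lemma prod_entries (A : comNzRingType) (F : 'I_n -> nat * nat -> A) :
  \prod_(e in entries T) F e.1 (val e.2) = \prod_(x <- letters m) F x.1 x.2.
Proof.
have [es [<- es_prec esE]] := entry_list; rewrite big_map [RHS]big_uniq /=.
  by apply: eq_bigl => e; rewrite esE.
exact: (sorted_uniq (@prec_trans _ _) (@prec_irr _ _)) (pairwise_sorted es_prec).
Qed.

(** Every box is opened by exactly one entry, its minimum, so the entries that are not further
    entries are in bijection with the boxes. *)
Lemma excess_extras : excess T = \sum_(w <- columns c m) extras w.
Proof.
have [es [esL es_prec esE]] := entry_list.
have es_uniq : uniq es.
  exact: (sorted_uniq (@prec_trans _ _) (@prec_irr _ _)) (pairwise_sorted es_prec).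
pose is_ext (e : entry n theta) := c (val e.2).2 e.1 == Ext.
rewrite -letters_extras -esL count_map -size_filter.
rewrite /excess -(cardsID [set e | is_ext e]) -[#|box theta|]cardsT.
have -> : size [seq x <- es | is_ext x] = #|entries T :&: [set e | is_ext e]|.
  rewrite cardE; apply: perm_size; apply: uniq_perm => [||e].
  - exact: filter_uniq.
  - exact: enum_uniq.
  by rewrite mem_filter mem_enum in_setI -esE inE andbC.
suff -> : [set: box theta] = [set e.2 | e in entries T :\: [set e | is_ext e]].
  rewrite card_in_imset ?addnK // => e f; rewrite !inE => /andP[ne eT] /andP[nf fT] ef.
  move: eT fT; rewrite -!holds_atE !holds_letter -ef => /andP[ce /eqP he] /andP[cf /eqP hf].
  have new r : c (val e.2).2 r != None -> c (val e.2).2 r != Ext -> c (val e.2).2 r = New.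
    by case: (c _ r) => [[]|].
  rewrite /is_ext -ef in nf; have := new _ ce ne; have := new _ cf nf => cfN ceN.
  have lt_not r s : c (val e.2).2 s = New -> h (val e.2).2 r.+1 = h (val e.2).2 s.+1 ->
      (r < s)%N -> False.
    move=> cs hrs lt_r; have := leq_height (tops (val e.2).2) (c (val e.2).2) lt_r.
    by rewrite hrs heightS cs eqxx addn1 ltnn.
  case: e f ef {ne nf ce cf new} ceN cfN he hf lt_not => [r p] [s q] /= <- ceN cfN he hf lt_not.
  congr pair; apply: val_inj; have [lt_r|lt_s|//] := ltngtP r s.
    by case: (lt_not r s); rewrite ?he.
  by case: (lt_not s r); rewrite ?he.
apply/esym/setP => p; rewrite inE; apply/imsetP.
have pb := valP p; rewrite [X in X \in _]surjective_pairing (mem_boxes eta_lam) in pb.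
have tP := tableauP eta_lam TP; have /andP[p_top p_bot] := pb.
have [|r [_ cr hr]] := exists_new (c := c) p_top (m := n).
  by rewrite (height_full (col_length_le eta_lam) tP).
exists (r, p) => //; rewrite !inE /is_ext /= cr /=.
by rewrite -holds_atE holds_letter cr heightS cr hr addn1 eqxx.
Qed.

End Letters.

Lemma nat_int_sub p q : nat_int (p%:Z - q%:Z) = (p - q)%N.
Proof.
case: (leqP q p) => [le_qp|lt_pq]; first by rewrite subzn.
rewrite -opprB subzn ?(ltnW lt_pq) //; have := lt_pq; rewrite -subn_gt0.
by case: (q - p)%N => // k _ /=; apply/esym/eqP; rewrite subn_eq0 ltnW.
Qed.

(** * Both sides of the formula in terms of column words *)

Section Bridge.

Variables (K : fieldType) (n : nat) (beta : K) (lam eta : intpart).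
Hypothesis eta_lam : included eta lam.

Local Notation theta := (boxes lam eta).
Local Notation tops := (col_length eta).
Local Notation bots := (col_length lam).
Local Notation m := (nth 0%N lam 0).

Lemma column_weight (b : nat -> K) (T : filling n theta) j : set_valued_tableau T ->
  beta ^+ extras (word_of T j) *: \prod_(r <- reading (word_of T j))
    oplus beta%:MP 'X_r (b (r.+1 + j - (height (tops j) (word_of T j) r.+1).-1)%N)%:MP =
  cweight beta (fun z => b (nat_int z)) tops j (word_of T j) :> {mpoly K[n]}.
Proof.
move=> TP; rewrite [X in _ *: X]big_uniq ?(reading_uniq 0) //=.
rewrite (eq_bigl (fun r => word_of T j r != None)); last by move=> r; rewrite (mem_reading 0).
rewrite -mul_mpolyC rmorphXn /= /extras -prodrXr [X in _ * X]big_mkcond -big_split.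
apply: eq_bigr => r _; have := heightS (tops j) (word_of T j) r.
have := @height_letter _ _ _ eta_lam _ TP j r.
case: (word_of T j r) => [[]|] /= => [_|/(_ isT)|]; rewrite ?addn1 ?addn0 => hE;
  rewrite ?expr0 ?expr1 ?mul1r //.
  by rewrite hE /= /wt addrA -PoszD nat_int_sub.
rewrite /wt => <-; rewrite hE /=; move: (height _ _ _).-1 => i.
have -> : r.+1%:Z + (j%:Z - i.+1%:Z + 1) = (r.+1 + j)%N%:Z - i%:Z by lia.
by rewrite nat_int_sub.
Qed.

Lemma Groth_colsum (b : nat -> K) :
  Groth n beta theta b = colsum n beta (fun z => b (nat_int z)) tops bots m (fun=> 0%N).
Proof.
rewrite colsum_lists -(sum_tableaux eta_lam); apply: eq_bigr => T TP.
pose F (r : 'I_n) (p : nat * nat) := oplus beta%:MP 'X_r (b (r.+1 + p.2 - p.1)%N)%:MP : {mpoly K[n]}.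
rewrite lists_weight_columns excess_extras // (prod_entries eta_lam TP F).
elim: (m) => [|J IH]; first by rewrite big_ord0 !big_nil expr0 scale1r.
rewrite big_ord_recr -IH -column_weight //= big_cons big_cat big_map exprD.
by rewrite -scalerAr -scalerAl scalerA; congr (_ *: _); exact: mulrC.
Qed.

Lemma barred_csum (a : nat -> K) (mu nu : intpart) :
  barred_tableau_sum n beta a theta mu nu = csum n beta a tops bots nu m (fun=> 0%N) mu.
Proof.
rewrite csum_lists -(sum_tableaux eta_lam) /barred_tableau_sum exchange_big /=.
apply: eq_bigr => T TP; have [es [esL es_prec esE]] := entry_list eta_lam TP.
rewrite -letters_reading -esL -map_comp -excess_extras // -(sum_bars _ _ _ _ es_prec esE) mulr_sumr.
by apply: eq_bigr => R _; rewrite mulr_sumr.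
Qed.

End Bridge.

(** * Expansions *)

Section Expansions.

Variables (K : fieldType) (n : nat) (beta : K) (a : nat -> K).
Hypothesis n_gt0 : (0 < n)%N.
Hypothesis a_unit : forall i, (0 < i)%N -> 1 + beta * a i != 0.

Local Notation P := {mpoly K[n]}.
Local Notation stair lam := (staircase n beta (fun z => a (nat_int z)) lam).
Local Notation stair0 := (stair (fun=> 0%N)).
Local Notation G lam := (Groth n beta (diagram lam) a).

Lemma msym_Groth (lam eta : intpart) (b : nat -> K) s : included eta lam ->
  msym s (Groth n beta (boxes lam eta) b) = Groth n beta (boxes lam eta) b.
Proof.
move=> eta_lam; rewrite Groth_colsum //; apply: msym_adjacent => k k1 k1E.
by have [flat _ _] := colsum_swap beta (fun z => b (nat_int z)) (col_length eta)
  (col_length lam) k1E (nth 0%N lam 0); exact: flat.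
Qed.

Definition empty_part : intpart := @IntPart [::] isT.

Lemma empty_included (lam : intpart) : included empty_part lam.
Proof. by move=> i; rewrite nth_nil. Qed.

Lemma alt_Groth (lam : intpart) : (size lam <= n)%N ->
  alt (G lam * stair0) = alt (stair (nth 0%N lam)).
Proof.
move=> lam_n; rewrite [G lam](Groth_colsum n beta (empty_included lam)).
apply: (alt_colsum beta (fun z => a (nat_int z)) (bots := col_length lam)).
- by move=> j; exact: leq_trans (count_size _ _) lam_n.
- by move=> i j; exact: ltn_col_length.
exact: col_length_over.
Qed.

Lemma Groth_large (lam : intpart) : (n < size lam)%N -> G lam = 0.
Proof.
move=> n_lam; apply: big_pred0 => T; apply/negP => /(tableauP (empty_included lam)) TP.
have := height_full (col_length_le (empty_included lam)) TP 0.
have lt_n : (n < col_length lam 0)%N.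
  rewrite ltn_col_length lt0n; apply/eqP => lam0; have /andP[_ /negP] : is_partition lam by case: (lam).
  by apply; rewrite -lam0 mem_nth.
move=> h; rewrite -h in lt_n; move: lt_n; rewrite ltnNge => /negP; apply.
rewrite /height add0n -[leqRHS]card_ord -sum1_card big_mkcond.
by apply: leq_sum => i _; case: ifP => // _; exact: leq_b1.
Qed.

Lemma alt_stair0 : alt stair0 != 0.
Proof.
have [phi [[_ _ phi0 _] phi1 _]] := exists_coef n a_unit (nu := fun=> 0%N) (fun _ _ _ => leqnn 0).
by apply/eqP => /phi0/eqP; rewrite phi1 oner_eq0.
Qed.

(** Multiplication by the nonzero [alt stair0] is injective and turns the question into the
    expansion of an alternating polynomial; coefficients of repeated partitions are then
    collected. *)
Lemma Groth_expands (f : P) : (forall s, msym s f = f) -> exists c, Groth_expansion beta a f c.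
Proof.
move=> f_sym; have [s s_n sE] := alt_spanP n_gt0 a_unit (f * stair0).
have fE : f = \sum_(z <- s) z.1 *: G z.2.
  apply: (mulIf alt_stair0); rewrite -alt_symM // sE mulr_suml big_seq [RHS]big_seq.
  apply: eq_bigr => z zs; rewrite -scalerAl -alt_symM ?alt_Groth ?s_n // => t.
  exact: msym_Groth (empty_included z.2).
pose S := [fset z.2 | z in s]%fset.
pose c : {fsfun intpart -> K with 0} :=
  [fsfun lam in S => \sum_(z <- s | z.2 == lam) z.1].
exists c; split=> [lam lam_c|].
  have : lam \in S by apply: contraLR lam_c => lam_S; rewrite memNfinsupp fsfunE (negPf lam_S).
  by case/imfsetP => z /= zs ->; exact: s_n.
rewrite fE (big_fset_incl _ (finsupp_sub _ _ _)) => [|lam _]; last first.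
  by rewrite memNfinsupp => /eqP->; rewrite scale0r.
under [RHS]eq_big_seq => lam lamS do rewrite fsfunE lamS scaler_suml.
rewrite (exchange_big_dep xpredT) //= big_seq [RHS]big_seq; apply: eq_bigr => z zs.
rewrite -big_filter (eq_filter (a2 := pred1 z.2)); last by move=> lam; rewrite /= eq_sym.
by rewrite filter_pred1_uniq ?big_seq1 ?fset_uniq //; apply/imfsetP; exists z.
Qed.

Lemma Groth_coef (nu : intpart) (phi : P -> K) f c :
  (size nu <= n)%N -> coef_functional beta a (nth 0%N nu) phi ->
  phi (stair (nth 0%N nu)) = 1 ->
  (forall lam, noninc lam -> (exists r : 'I_n, lam r != nth 0%N nu r) -> phi (stair lam) = 0) ->
  Groth_expansion beta a f c -> c nu = phi (f * stair0).
Proof.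
move=> nu_n [phiD phiZ phi0 _] phi1 phi_ne [c_n ->].
have phi_alt p q : alt p = alt q -> phi p = phi q.
  move=> pq; rewrite -[p](subrK q) phiD phi0; first by rewrite add0r.
  by rewrite altB pq subrr.
have phi_G lam : lam \in finsupp c -> phi (G lam * stair0) = (lam == nu)%:R.
  move=> /c_n lam_n; rewrite (phi_alt _ _ (alt_Groth lam_n)); have [->//|ne] := eqVneq lam nu.
  apply: phi_ne; first exact: part_noninc.
  apply/existsP; apply: contraNT ne => /existsPn eq_lam; apply/eqP/val_inj.
  apply: partition_eq => [||i]; [by case: (lam) | by case: (nu) |].
  have [lt_i|ge_i] := ltnP i n; first by have := eq_lam (Ordinal lt_i); rewrite negbK => /eqP.
  by rewrite !nth_default // (leq_trans _ ge_i).
have phi00 : phi 0 = 0 by rewrite phi0 ?alt0.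
rewrite mulr_suml (big_morph phi phiD phi00).
under eq_big_seq => lam lam_c do rewrite -scalerAl phiZ phi_G //.
have [nu_c|] := boolP (nu \in finsupp c); last first.
  rewrite memNfinsupp => /eqP cnu; rewrite cnu big1 // => lam _.
  by case: eqP => [->|_]; rewrite ?cnu ?mul0r ?mulr0.
rewrite (bigD1_seq nu) ?fset_uniq //= eqxx mulr1 big1 ?addr0 // => lam /negPf->.
by rewrite mulr0.
Qed.

End Expansions.

Lemma barred_sum_large (K : fieldType) n (beta : K) a theta (mu nu : intpart) :
  (size nu < size mu)%N -> barred_tableau_sum n beta a theta mu nu = 0.
Proof.
move=> lt_mu; apply: big_pred0 => R; apply/negP => /andP[_ /eqP Rnu].
have size_foldl u s : (size s <= size (foldl incr_nth s u))%N.
  elim: u s => //= i u IH s; apply: leq_trans (IH _).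
  by rewrite size_incr_nth; case: ltnP => // /leqW.
by move: lt_mu; rewrite ltnNge -[in X in X -> _]Rnu size_foldl.
Qed.

Theorem theorem6p4 (F K : fieldType) (iota : {rmorphism F -> K})
    (n : nat) (beta : K) (a : nat -> K) (lam eta mu nu : intpart)
    (n_gt0 : (0 < n)%N) (eta_lam : included eta lam) (nu_n : (size nu <= n)%N)
    (a_zero : forall i, zeroed n mu nu i -> a i = 0)
    (K_rational : rational_function_field iota
                    (indeterminate n mu nu) (variable beta a)) :
  let theta := boxes lam eta in
  is_Groth_coef beta a
    (Groth n beta theta (fun=> 0) * Groth n beta (diagram mu) a) nu
    (barred_tableau_sum n beta a theta mu nu).
Proof.
move=> theta; have a_unit := one_beta_neq0 a_zero K_rational.
split.
  apply: Groth_expands => // s.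
  by rewrite rmorphM /= msym_Groth // [msym s (Groth _ _ (diagram _) _)](msym_Groth _ _ _ (empty_included mu)).
have [phi [phiP phi1 phi_ne]] := exists_coef n a_unit (part_noninc nu).
move=> c /(Groth_coef nu_n phiP phi1 phi_ne)->; have [phiD _ phi0 _] := phiP.
(* If [mu] has more than [n] rows, its polynomial is zero, and no chain leads from it to the shorter
   [nu]. *)
have [lt_mu|mu_n] := ltnP n (size mu).
  rewrite (Groth_large _ _ lt_mu) mulr0 mul0r phi0 ?alt0 //.
  by rewrite barred_sum_large // (leq_ltn_trans nu_n).
rewrite barred_csum //.
have phi_alt p q : alt p = alt q -> phi p = phi q.
  move=> pq; rewrite -[p](subrK q) phiD phi0; first by rewrite add0r.
  by rewrite altB pq subrr.
(* [phi] sees only [alt], through which the symmetric factor passes; so the polynomial of [mu] times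
   the empty staircase may be replaced by the staircase of [mu]. *)
rewrite -mulrA (phi_alt _ (Groth n beta theta (fun=> 0) * staircase n beta (fun z => a (nat_int z)) (nth 0%N mu))).
  rewrite Groth_colsum //; apply: (phi_colsum a_unit (col_length eta) (col_length lam) phiP mu_n nu_n) => //.
    by move=> rho k k1 k1E *; apply: a_zero; exact: (zeroed_step nu_n k1E).
  by split=> //; case: (mu).
have theta_sym s : msym s (Groth n beta theta (fun=> 0)) = Groth n beta theta (fun=> 0).
  exact: msym_Groth.
by rewrite alt_symM // alt_Groth // -alt_symM.
Qed.
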